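(* Let $k\geq 1$ be an integer and let $\alpha,\beta>0$ satisfy $\alpha\beta=1$. Then \begin{align*} &\alpha^{\frac{k}{2}-1}\sum_{n=1}^{\infty}r_{k}(n)\left\{ \frac{e^{\frac{\pi n\alpha^{2}}{2}}}{\sqrt{n}}W_{\frac{1-k}{2},0}\left(\pi n\alpha^{2}\right)-\frac{\pi^{\frac{1-k}{2}}}{n^{\frac{k}{2}}\alpha^{k-1}}\right\} +\pi^{\frac{1-k}{2}}\alpha^{-\frac{k}{2}}\zeta_{k-1}\left(\tfrac{k}{2}\right)\\ &\quad+\frac{\sqrt{\pi}}{\Gamma\left(\frac{k}{2}\right)\alpha^{\frac{k}{2}}}\left(2\gamma+\psi\left(\tfrac{k}{2}\right)-2\log\Phi_k -\log\left(4\pi\alpha^{2}\right)\right)\\ &=\beta^{\frac{k}{2}-1}\sum_{n=1}^{\infty}r_{k}(n)\left\{ \frac{e^{\frac{\pi n\beta^{2}}{2}}}{\sqrt{n}}W_{\frac{1-k}{2},0}\left(\pi n\beta^{2}\right)-\frac{\pi^{\frac{1-k}{2}}}{n^{\frac{k}{2}}\beta^{k-1}}\right\} +\pi^{\frac{1-k}{2}}\beta^{-\frac{k}{2}}\zeta_{k-1}\left(\tfrac{k}{2}\right)\\ &\quad+\frac{\sqrt{\pi}}{\Gamma\left(\frac{k}{2}\right)\beta^{\frac{k}{2}}}\left(2\gamma+\psi\left(\tfrac{k}{2}\right)-2\log\Phi_k-\log\left(4\pi\beta^{2}\right)\right), \end{align*} where $\Phi_k:=\prod_{\mathbf{m}\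in\mathbb{Z}^{k-1}\setminus\{\mathbf{0}\}}\left(1-e^{-2\pi|\mathbf{m}|}\right)$.
   Context: For integers $j\geq1$ and $n\geq 0$, $r_j(n)$ is the number of $(n_1,\dots,n_j)\in\mathbb{Z}^j$ with $n_1^2+\dots+n_j^2=n$, and $\zeta_j(s)=\sum_{n=1}^\infty r_j(n)n^{-s}$ for $\mathrm{Re}(s)>j/2$ (so $\zeta_{k-1}(k/2)$ is given by an absolutely convergent series when $k\ge2$). Conventions for $k=1$: $\zeta_0:=0$ and the empty product $\Phi_1:=1$. $|\mathbf{m}|$ is the Euclidean norm. $\gamma$ is the Euler–Mascheroni constant, $\psi=\Gamma'/\Gamma$ the digamma function, and $W_{\mu,\nu}(x)$ is the Whittaker function, i.e. the solution of $u''+\left(\frac{\mu}{x}+\frac{1-\nu^2}{4x^2}-\frac14\right)u=0$ characterized by $W_{\mu,\nu}(x)\sim x^{\mu}e^{-x/2}$ as $x\to\infty$. *)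

(* Defs.v *)
From Stdlib Require Import Reals.
From Coquelicot Require Import Coquelicot.
From mathcomp Require Import ssreflect ssrfun ssrbool eqtype ssrnat seq
  choice fintype finfun bigop finset.

Set Implicit Arguments.
Unset Strict Implicit.

Definition natdist (a b : nat) : nat := (a - b) + (b - a).

(* Points of Z^j with entries in [-N, N], encoded as f : 'I_j -> 'I_(2N+1)
   with integer coordinate (f i) - N.  Squared Euclidean norm: *)
Definition sqnorm (j N : nat) (f : {ffun 'I_j -> 'I_(2*N+1)}) : nat :=
  \sum_(i < j) (natdist (f i) N) ^ 2.

(* r_j(n) = #{ (n_1..n_j) in Z^j : n_1^2+...+n_j^2 = n }.
   Every solution has |n_i| <= n, so the box [-n,n]^j captures all of them. *)
Definition r (j n : nat) : nat :=
  #|[set f : {ffun 'I_j -> 'I_(2*n+1)} | sqnorm f == n]|.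

Open Scope R_scope.

Definition zeta (j : nat) (s : R) : R :=
  Series (fun n => if n is 0%nat then 0 else INR (r j n) * Rpower (INR n) (- s)).

(* Phi_k = prod_{m in Z^{k-1}\{0}} (1 - exp(-2 pi |m|)), as the limit of the
   partial products over the boxes [-N,N]^{k-1} (absolutely convergent). *)
Definition PhiN (k N : nat) : R :=
  \big[Rmult/1]_(f : {ffun 'I_(k.-1) -> 'I_(2*N+1)} | [exists i, (f i : nat) != N])
     (1 - exp (- (2 * PI * sqrt (INR (sqnorm f))))).

Definition Phi (k : nat) : R := Lim_seq (PhiN k).

Definition Gamma (s : R) : R :=
  RInt_gen (fun t => Rpower t (s - 1) * exp (- t)) (at_right 0) (Rbar_locally p_infty).

Definition digamma (s : R) : R := Derive Gamma s / Gamma s.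

Definition euler_gamma : R :=
  Lim_seq (fun n => sum_f_R0 (fun j => / INR (S j)) n - ln (INR (S n))).

Definition is_Whittaker0 (mu : R) (W : R -> R) : Prop :=
  (forall x, 0 < x ->
     ex_derive W x /\ ex_derive (Derive W) x /\
     Derive (Derive W) x + (mu / x + / (4 * x ^ 2) - / 4) * W x = 0) /\
  is_lim (fun x => W x / (Rpower x mu * exp (- x / 2))) p_infty 1.

Definition summand (k : nat) (W : R -> R) (a : R) (n : nat) : R :=
  if n is 0%nat then 0 else
  INR (r k n) *
   (exp (PI * INR n * a ^ 2 / 2) / sqrt (INR n) * W (PI * INR n * a ^ 2)
    - Rpower PI ((1 - INR k) / 2) / (Rpower (INR n) (INR k / 2) * Rpower a (INR k - 1))).

(* Main.v *)
(** The substitution [u = exp y] turns every integral of the proof into one over the real line.  Write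
    [theta u] for the sum of [exp (- PI n ^ 2 u)] over the integers, [a = k / 2] and [alpha = exp lam].
    Since [W x = exp (- x / 2) sqrt x U(a, 1, x)] with
    [Gamma(a) U(a, 1, x)] the integral of [exp (- x exp y) (1 + exp (- y)) ^ (- a)], the series in
    the theorem is, up to elementary factors, minus the integral [Z(lam)] of
    [(theta (exp y) ^ k - 1) (exp (a y - a lam) - exp (a lam) (1 + exp (2 lam - y)) ^ (- a))].
    Truncate to [[-A, B]] and expand: the part carrying [theta ^ k] and [(1 + exp (2 lam - y)) ^ (- a)]
    is exactly symmetric under [(lam, A, B) -> (- lam, B, A)], by the inversion formula of [theta];
    the two others are explicit up to a constant [D] (the finite part of the Epstein zeta function
    of the lattice of rank [k] at its pole) and a constant [c = - gamma - digamma a].  Hence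
    [Z(lam) - exp (- a lam) (D - c - 2 lam)] is even in [lam], and the theorem amounts to the value
    of [D] given by a Kronecker limit formula: applying the inversion formula to [k - 1] of the [k]
    factors [theta] splits [D] into the terms with [zeta_(k-1)], with [Phi_k], and the constant
    [gamma - ln (4 PI)] of dimension one.  The inversion formula itself is proved by Polya's argument,
    as a limit of the binomial theorem summed over roots of unity. *)

Require Import Defs.
From Stdlib Require Import Reals Lra Lia Psatz.
From Coquelicot Require Import Coquelicot.
From HB Require Import structures.
From mathcomp Require ssreflect ssrfun ssrbool eqtype ssrnat seq choice fintype finfun bigop finset zify.
Open Scope R_scope.

(** * Calculus on the real line *)

(** The kernel that carries the symmetry has no integral: it tends to [exp (- a lam)] on the left
    and to [exp (a lam)] on the right, so its truncations grow like
    [exp (- a lam) A + exp (a lam) B]. What is even in [lam] is the finite part left after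
    subtracting these terms, which the reflection exchanges together with the two ends. The rest of
    the work evaluates finite parts, each by splitting off a model with an explicit one: the
    logistic function itself for [c], a double exponential cutoff for the constant of dimension one.

    That last constant is read off from a regularized theta integral as the regularization is
    removed. The value of the Gaussian integral need not be known beforehand, since any value other
    than 1 would leave a divergence in this limit.

    [W] is given by a differential equation and its behaviour at infinity, so its expression through
    [U] is a uniqueness statement for recessive solutions. *)

Lemma exp_le (x y : R) : x <= y -> exp x <= exp y.
Proof. intros [H|E]; [left; apply exp_increasing, H|rewrite E; lra]. Qed.

Lemma exp_le_inv (x y : R) : exp x <= exp y -> x <= y.
Proof. intros H; apply Rnot_lt_le; intros Hlt; apply exp_increasing in Hlt; lra. Qed.

Lemma exp_le_1 (x : R) : x <= 0 -> exp x <= 1.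
Proof. intros H; rewrite <- exp_0; apply exp_le, H. Qed.

Lemma exp_ge_1 (x : R) : 0 <= x -> 1 <= exp x.
Proof. intros H; rewrite <- exp_0; apply exp_le, H. Qed.

Lemma exp_ge0 (x : R) : 0 <= exp x.
Proof. left; apply exp_pos. Qed.

Definition cont (f : R -> R) := forall x, continuous f x.

Lemma cont_ex_RInt (f : R -> R) (a b : R) : cont f -> ex_RInt f a b.
Proof. intros Hf; apply (@ex_RInt_continuous R_CompleteNormedModule); auto. Qed.

Lemma cont_plus (f g : R -> R) : cont f -> cont g -> cont (fun x => f x + g x).
Proof. intros Hf Hg x; apply (continuous_plus f g); auto. Qed.

Lemma cont_minus (f g : R -> R) : cont f -> cont g -> cont (fun x => f x - g x).
Proof. intros Hf Hg x; apply (continuous_minus f g); auto. Qed.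

Lemma cont_mult (f g : R -> R) : cont f -> cont g -> cont (fun x => f x * g x).
Proof. intros Hf Hg x; apply (continuous_mult f g); auto. Qed.

Lemma cont_const (c : R) : cont (fun _ => c).
Proof. intros x; apply continuous_const. Qed.

Lemma cont_comp (f g : R -> R) : cont f -> cont g -> cont (fun x => f (g x)).
Proof. intros Hf Hg x; apply (continuous_comp g f); auto. Qed.

Lemma ex_derive_cont (f : R -> R) : (forall x, ex_derive f x) -> cont f.
Proof. intros H x; apply (@ex_derive_continuous _ R_NormedModule), H. Qed.

Lemma cont_sum (f : nat -> R -> R) (N : nat) :
  (forall n, cont (f n)) -> cont (fun y => sum_f_R0 (fun n => f n y) N).
Proof.
  intros Hf; induction N as [|N IH]; [apply Hf|].
  simpl; apply cont_plus; auto.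
Qed.

Lemma cont_exp (f : R -> R) : cont f -> cont (fun x => exp (f x)).
Proof.
  apply (cont_comp exp), ex_derive_cont; intros z; auto_derive; trivial.
Qed.

Lemma cont_pow (f : R -> R) (n : nat) : cont f -> cont (fun x => f x ^ n).
Proof.
  intros Hf; induction n as [|n IH]; [exact (cont_const 1)|apply (cont_mult f); auto].
Qed.

Create HintDb cont.
#[export] Hint Resolve cont_const : cont.

(* [ring] needs the carrier to be syntactically [R], not a Coquelicot structure on it. *)
Ltac change_eq_R := match goal with |- ?a = ?b => change (@eq R a b) end.

Ltac auto_cont :=
  intros; repeat match goal with f := _ : R -> _ |- _ => subst f end; cbv beta;
  repeat match goal with
    | |- cont (fun x => @?f x - @?g x) => apply (cont_minus f g)
    | |- cont (fun x => @?f x + @?g x) => apply (cont_plus f g)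
    | |- cont (fun x => @?f x * @?g x) => apply (cont_mult f g)
    | |- cont (fun x => exp (@?f x)) => apply (cont_exp f)
    | |- cont (fun x => @?f x ^ ?n) => apply (cont_pow f n)
    end;
  solve [auto with cont | apply ex_derive_cont; intros; auto_derive; trivial].

Lemma RInt_plus_cont (f g : R -> R) (a b : R) : cont f -> cont g ->
  RInt (fun x => f x + g x) a b = RInt f a b + RInt g a b.
Proof. intros Hf Hg; apply (RInt_plus f g); apply cont_ex_RInt; auto. Qed.

Lemma RInt_minus_cont (f g : R -> R) (a b : R) : cont f -> cont g ->
  RInt (fun x => f x - g x) a b = RInt f a b - RInt g a b.
Proof. intros Hf Hg; apply (RInt_minus f g); apply cont_ex_RInt; auto. Qed.

Lemma RInt_scal_cont (f : R -> R) (c a b : R) : cont f ->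
  RInt (fun x => c * f x) a b = c * RInt f a b.
Proof. intros Hf; apply (RInt_scal f); apply cont_ex_RInt; auto. Qed.

Lemma RInt_le_cont (f g : R -> R) (a b : R) : a <= b -> cont f -> cont g ->
  (forall x, a <= x <= b -> f x <= g x) -> RInt f a b <= RInt g a b.
Proof.
  intros Hab Hf Hg H; apply RInt_le; auto using cont_ex_RInt.
  intros x Hx; apply H; lra.
Qed.

Lemma RInt_Chasles_cont (f : R -> R) (a b c : R) : cont f ->
  RInt f a c = RInt f a b + RInt f b c.
Proof. intros Hf; symmetry; apply (RInt_Chasles f); auto using cont_ex_RInt. Qed.

Lemma RInt_ge0_cont (f : R -> R) (a b : R) : a <= b -> cont f ->
  (forall x, 0 <= f x) -> 0 <= RInt f a b.
Proof. intros Hab Hf H; apply RInt_ge_0; auto using cont_ex_RInt. Qed.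

Lemma RInt_mono_cont (f : R -> R) (a b a' b' : R) : a' <= a -> a <= b -> b <= b' ->
  cont f -> (forall x, 0 <= f x) -> RInt f a b <= RInt f a' b'.
Proof.
  intros H1 H2 H3 Hf H.
  rewrite (RInt_Chasles_cont f a' a b') by auto.
  rewrite (RInt_Chasles_cont f a b b') by auto.
  generalize (RInt_ge0_cont f a' a H1 Hf H) (RInt_ge0_cont f b b' H3 Hf H); lra.
Qed.

Lemma RInt_derive_cont (f df : R -> R) (a b : R) :
  (forall x, is_derive f x (df x)) -> cont df -> RInt df a b = f b - f a.
Proof.
  intros H Hc; apply is_RInt_unique.
  apply (is_RInt_derive f df); auto.
Qed.

Lemma RInt_shift (f : R -> R) (c a b : R) : cont f ->
  RInt (fun y => f (y + c)) a b = RInt f (a + c) (b + c).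
Proof.
  intros Hf.
  rewrite <- (Rmult_1_l a), <- (Rmult_1_l b) at 2.
  rewrite <- (RInt_comp_lin f 1 c a b) by auto using cont_ex_RInt.
  apply RInt_ext; intros x _; unfold scal; simpl; unfold mult; simpl.
  rewrite !Rmult_1_l; reflexivity.
Qed.

Lemma RInt_refl (f : R -> R) (a b : R) : cont f ->
  RInt (fun y => f (- y)) a b = RInt f (- b) (- a).
Proof.
  intros Hf.
  rewrite <- (opp_RInt_swap f (- a)) by auto using cont_ex_RInt.
  replace (- a) with (-1 * a + 0) by ring.
  replace (- b) with (-1 * b + 0) by ring.
  rewrite <- (RInt_comp_lin f (-1) 0 a b) by auto using cont_ex_RInt.
  rewrite <- (RInt_opp (V := R_CompleteNormedModule)).
  - apply RInt_ext; intros x _; unfold scal, opp; simpl; unfold mult; simpl.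
    replace (-1 * x + 0) with (- x) by ring; ring.
  - apply (ex_RInt_comp_lin f (-1) 0 a b); auto using cont_ex_RInt.
Qed.

(** * Limits as both truncation parameters tend to infinity *)

(** The two parameters are independent: a translation of the integrand changes [A] and [B] by
    opposite amounts, and a reflection exchanges them. *)
Definition lim2 (F : R -> R -> R) (l : R) : Prop :=
  forall eps, 0 < eps -> exists M, forall A B, M <= A -> M <= B -> Rabs (F A B - l) < eps.

Lemma lim2_ext (F G : R -> R -> R) (l : R) :
  (forall A B, 0 <= A -> 0 <= B -> F A B = G A B) -> lim2 F l -> lim2 G l.
Proof.
  intros H HF eps He; destruct (HF eps He) as [M HM].
  exists (Rmax M 0); intros A B HA HB.
  generalize (Rmax_l M 0) (Rmax_r M 0); intros.
  rewrite <- H by lra; apply HM; lra.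
Qed.

Lemma lim2_unique (F : R -> R -> R) (l l' : R) : lim2 F l -> lim2 F l' -> l = l'.
Proof.
  intros H H'.
  destruct (Req_dec l l') as [E|E]; [exact E|exfalso].
  assert (He : 0 < Rabs (l - l') / 2).
  { apply Rdiv_lt_0_compat; [apply Rabs_pos_lt; lra|lra]. }
  destruct (H _ He) as [M HM]; destruct (H' _ He) as [M' HM'].
  set (A := Rmax M M').
  specialize (HM A A (Rmax_l _ _) (Rmax_l _ _)).
  specialize (HM' A A (Rmax_r _ _) (Rmax_r _ _)).
  revert HM HM'; unfold Rabs; repeat destruct Rcase_abs; lra.
Qed.

Lemma lim2_const (c : R) : lim2 (fun _ _ => c) c.
Proof. intros eps He; exists 0; intros; rewrite Rminus_eq_0, Rabs_R0; exact He. Qed.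

Lemma lim2_plus (F G : R -> R -> R) (l m : R) :
  lim2 F l -> lim2 G m -> lim2 (fun A B => F A B + G A B) (l + m).
Proof.
  intros HF HG eps He.
  destruct (HF (eps/2)) as [M HM]; [lra|]; destruct (HG (eps/2)) as [M' HM']; [lra|].
  exists (Rmax M M'); intros A B HA HB.
  generalize (Rmax_l M M') (Rmax_r M M'); intros.
  specialize (HM A B); specialize (HM' A B).
  replace (F A B + G A B - (l + m)) with ((F A B - l) + (G A B - m)) by ring.
  eapply Rle_lt_trans; [apply Rabs_triang|].
  generalize (HM ltac:(lra) ltac:(lra)) (HM' ltac:(lra) ltac:(lra)); lra.
Qed.

Lemma lim2_scal (c : R) (F : R -> R -> R) (l : R) :
  lim2 F l -> lim2 (fun A B => c * F A B) (c * l).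
Proof.
  intros HF eps He.
  assert (Hc : 0 < Rabs c + 1) by (generalize (Rabs_pos c); lra).
  destruct (HF (eps / (Rabs c + 1))) as [M HM]; [apply Rdiv_lt_0_compat; lra|].
  exists M; intros A B HA HB; specialize (HM A B HA HB).
  replace (c * F A B - c * l) with (c * (F A B - l)) by ring.
  rewrite Rabs_mult.
  apply Rmult_lt_compat_l with (r := Rabs c + 1) in HM; [|exact Hc].
  replace ((Rabs c + 1) * (eps / (Rabs c + 1))) with eps in HM by (field; lra).
  generalize (Rabs_pos (F A B - l)); lra.
Qed.

Lemma lim2_minus (F G : R -> R -> R) (l m : R) :
  lim2 F l -> lim2 G m -> lim2 (fun A B => F A B - G A B) (l - m).
Proof.
  intros HF HG.
  replace (l - m) with (l + (-1) * m) by ring.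
  apply (lim2_ext (fun A B => F A B + (-1) * G A B)).
  - intros; ring.
  - apply lim2_plus; [exact HF|apply lim2_scal, HG].
Qed.

Lemma lim2_swap (F : R -> R -> R) (l : R) : lim2 F l -> lim2 (fun A B => F B A) l.
Proof. intros HF eps He; destruct (HF eps He) as [M HM]; exists M; auto. Qed.

Lemma lim2_shift (F : R -> R -> R) (l c d : R) :
  lim2 F l -> lim2 (fun A B => F (A + c) (B + d)) l.
Proof.
  intros HF eps He; destruct (HF eps He) as [M HM].
  exists (M + Rabs c + Rabs d); intros A B HA HB.
  generalize (Rabs_pos c) (Rabs_pos d) (Rle_abs (-c)) (Rle_abs (-d)); rewrite !Rabs_Ropp; intros.
  apply HM; lra.
Qed.

Lemma lim2_le (F G : R -> R -> R) (l m : R) :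
  (forall A B, 0 <= A -> 0 <= B -> F A B <= G A B) -> lim2 F l -> lim2 G m -> l <= m.
Proof.
  intros H HF HG; apply Rnot_lt_le; intros Hlt.
  destruct (HF ((l - m)/2)) as [M HM]; [lra|]; destruct (HG ((l - m)/2)) as [M' HM']; [lra|].
  set (A := Rmax 0 (Rmax M M')).
  assert (0 <= A) by apply Rmax_l.
  assert (M <= A /\ M' <= A).
  { generalize (Rmax_r 0 (Rmax M M')) (Rmax_l M M') (Rmax_r M M'); fold A; lra. }
  specialize (HM A A ltac:(lra) ltac:(lra)); specialize (HM' A A ltac:(lra) ltac:(lra)).
  specialize (H A A ltac:(lra) ltac:(lra)).
  apply Rabs_def2 in HM; apply Rabs_def2 in HM'; lra.
Qed.

Lemma lim2_squeeze (F G : R -> R -> R) (l : R) :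
  (forall A B, 0 <= A -> 0 <= B -> Rabs (F A B - l) <= G A B) -> lim2 G 0 -> lim2 F l.
Proof.
  intros H HG eps He; destruct (HG eps He) as [M HM].
  exists (Rmax M 0); intros A B HA HB.
  generalize (Rmax_l M 0) (Rmax_r M 0); intros.
  eapply Rle_lt_trans; [apply H; lra|].
  specialize (HM A B ltac:(lra) ltac:(lra)); apply Rabs_def2 in HM; lra.
Qed.

Lemma lim2_exp_decay (d : R) : 0 < d -> lim2 (fun A _ => exp (- d * A)) 0.
Proof.
  (* This bound makes [d * A >= / eps], and [exp (d * A)] exceeds [d * A]. *)
  intros Hd eps He; exists (/ (d * eps)); intros A _ HA _.
  rewrite Rminus_0_r, Rabs_pos_eq by apply exp_ge0.
  assert (Hde : 0 < d * eps) by (apply Rmult_lt_0_compat; lra).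
  assert (H1 : / eps <= d * A).
  { apply (Rmult_le_compat_l d) in HA; [|lra].
    replace (d * / (d * eps)) with (/ eps) in HA by (field; lra); exact HA. }
  assert (H0 : 0 < / eps) by (apply Rinv_0_lt_compat; lra).
  replace (- d * A) with (- (d * A)) by ring.
  rewrite exp_Ropp, <- (Rinv_inv eps).
  apply Rinv_lt_contravar; [apply Rmult_lt_0_compat; [lra|apply exp_pos]|].
  generalize (exp_ineq1 (d * A)); lra.
Qed.

(** * Improper integrals over the real line *)

Definition intR (f : R -> R) (l : R) : Prop := lim2 (fun A B => RInt f (- A) B) l.

Lemma intR_unique (f : R -> R) (l l' : R) : intR f l -> intR f l' -> l = l'.
Proof. apply lim2_unique. Qed.

Lemma intR_ext (f g : R -> R) (l : R) : (forall x, f x = g x) -> intR f l -> intR g l.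
Proof.
  intros H; apply lim2_ext; intros A B _ _; apply RInt_ext; auto.
Qed.

Lemma intR_plus (f g : R -> R) (l m : R) : cont f -> cont g ->
  intR f l -> intR g m -> intR (fun x => f x + g x) (l + m).
Proof.
  intros Cf Cg Hf Hg; eapply lim2_ext; [|apply (lim2_plus _ _ _ _ Hf Hg)].
  intros A B _ _; symmetry; apply RInt_plus_cont; auto.
Qed.

Lemma intR_minus (f g : R -> R) (l m : R) : cont f -> cont g ->
  intR f l -> intR g m -> intR (fun x => f x - g x) (l - m).
Proof.
  intros Cf Cg Hf Hg; eapply lim2_ext; [|apply (lim2_minus _ _ _ _ Hf Hg)].
  intros A B _ _; symmetry; apply RInt_minus_cont; auto.
Qed.

Lemma intR_scal (c : R) (f : R -> R) (l : R) : cont f ->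
  intR f l -> intR (fun x => c * f x) (c * l).
Proof.
  intros Cf Hf; eapply lim2_ext; [|apply (lim2_scal c _ _ Hf)].
  intros A B _ _; symmetry; apply RInt_scal_cont; auto.
Qed.

Lemma intR_shift (c : R) (f : R -> R) (l : R) : cont f ->
  intR f l -> intR (fun x => f (x + c)) l.
Proof.
  intros Cf Hf; eapply lim2_ext; [|apply (lim2_shift _ _ (- c) c Hf)].
  intros A B _ _; rewrite RInt_shift by auto; f_equal; ring.
Qed.

Lemma intR_refl (f : R -> R) (l : R) : cont f ->
  intR f l -> intR (fun x => f (- x)) l.
Proof.
  intros Cf Hf; eapply lim2_ext; [|apply (lim2_swap _ _ Hf)].
  intros A B _ _; rewrite RInt_refl by auto; f_equal; ring.
Qed.

Lemma intR_le (f g : R -> R) (l m : R) : cont f -> cont g ->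
  (forall x, f x <= g x) -> intR f l -> intR g m -> l <= m.
Proof.
  intros Cf Cg H; apply lim2_le; intros A B HA HB.
  apply RInt_le_cont; auto; lra.
Qed.

Lemma intR_ge0 (f : R -> R) (l : R) : cont f -> (forall x, 0 <= f x) -> intR f l -> 0 <= l.
Proof.
  intros Cf H Hl; eapply lim2_le; [|apply (lim2_const 0)|exact Hl].
  intros A B HA HB; apply RInt_ge0_cont; auto; lra.
Qed.

Lemma intR_ge_RInt (f : R -> R) (l a b : R) : cont f -> (forall x, 0 <= f x) ->
  a <= b -> intR f l -> RInt f a b <= l.
Proof.
  intros Cf H Hab Hl; apply Rnot_lt_le; intros Hlt.
  destruct (Hl (RInt f a b - l)) as [M HM]; [lra|].
  specialize (HM (Rmax M (- a)) (Rmax M b) (Rmax_l _ _) (Rmax_l _ _)).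
  generalize (Rmax_r M (-a)) (Rmax_r M b); intros.
  apply Rabs_def2 in HM.
  generalize (RInt_mono_cont f a b (- Rmax M (- a)) (Rmax M b) ltac:(lra) Hab ltac:(lra) Cf H).
  lra.
Qed.

(** Truncations of a nonnegative function grow with the interval, and every [[-A', B']] lies between
    two symmetric intervals; so the supremum over symmetric ones is the limit. *)
Lemma intR_ex_bounded (f : R -> R) (K : R) : cont f -> (forall x, 0 <= f x) ->
  (forall A, 0 <= A -> RInt f (- A) A <= K) -> exists l, intR f l /\ l <= K.
Proof.
  intros Cf H HK.
  destruct (completeness (fun z => exists A, 0 <= A /\ z = RInt f (- A) A)) as [l [Hub Hl]].
  - exists K; intros z [A [HA ->]]; auto.
  - exists (RInt f (- 0) 0), 0; split; [lra|reflexivity].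
  - exists l; split.
    2: apply Hl; intros z [A [HA ->]]; auto.
    intros eps He.
    destruct (Classical_Prop.classic (exists A, 0 <= A /\ l - eps < RInt f (- A) A)) as [[A [HA HA']]|Hno].
    + exists A; intros A' B' HA1 HB1.
      assert (RInt f (- A) A <= RInt f (- A') B') by (apply RInt_mono_cont; auto; lra).
      assert (RInt f (- A') B' <= RInt f (- Rmax A' B') (Rmax A' B')).
      { generalize (Rmax_l A' B') (Rmax_r A' B'); intros; apply RInt_mono_cont; auto; lra. }
      assert (RInt f (- Rmax A' B') (Rmax A' B') <= l).
      { apply Hub; exists (Rmax A' B'); split; [generalize (Rmax_l A' B'); lra|reflexivity]. }
      apply Rabs_def1; lra.
    + exfalso; assert (l <= l - eps); [|lra].
      apply Hl; intros z [A [HA ->]]; apply Rnot_lt_le; intros Hlt; apply Hno; exists A; auto.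
Qed.

(** The model of exponential decay at both ends: smooth at the origin, with the bounded primitive
    [atan (exp (d * y)) / d]. *)
Lemma intR_sech (d : R) : 0 < d ->
  exists l, intR (fun y => / (exp (d * y) + exp (- d * y))) l.
Proof.
  intros Hd.
  assert (P : forall y, 0 < exp (d * y) + exp (- d * y)).
  { intros y; generalize (exp_pos (d * y)) (exp_pos (- d * y)); lra. }
  assert (C : cont (fun y => / (exp (d * y) + exp (- d * y)))).
  { apply ex_derive_cont; intros x; auto_derive; generalize (P x); lra. }
  destruct (intR_ex_bounded _ (PI / d) C) as [l [Hl _]].
  - intros y; left; apply Rinv_0_lt_compat, P.
  - intros A HA.
    rewrite (RInt_derive_cont (fun y => atan (exp (d * y)) / d)); auto.
    + generalize (atan_bound (exp (d * A))) (atan_bound (exp (d * - A))); intros H1 H2.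
      unfold Rdiv; rewrite <- Rmult_minus_distr_r.
      apply Rmult_le_compat_r; [left; apply Rinv_0_lt_compat; lra|lra].
    + intros x; generalize (P x) (exp_pos (d * x)); intros Hx Hx'.
      auto_derive; [trivial|].
      replace (exp (- d * x)) with (/ exp (d * x)).
      * field; repeat split; try lra; nra.
      * rewrite <- exp_Ropp; f_equal; ring.
  - exists l; exact Hl.
Qed.

(** Multiplied by [exp (- d * y)] and [exp (d * y)] respectively, both bounds have right-hand side
    [C]; add them. *)
Lemma min_exp_le_sech (C d y z : R) : 0 <= C -> z <= C * exp (d * y) -> z <= C * exp (- d * y) ->
  z <= 2 * C * / (exp (d * y) + exp (- d * y)).
Proof.
  intros HC H1 H2.
  assert (P1 := exp_pos (d * y)); assert (P2 := exp_pos (- d * y)).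
  assert (E : exp (d * y) * exp (- d * y) = 1).
  { rewrite <- exp_plus; replace (d * y + - d * y) with 0 by ring; apply exp_0. }
  apply (Rmult_le_reg_r (exp (d * y) + exp (- d * y))); [lra|].
  rewrite Rmult_assoc, Rinv_l by lra.
  apply (Rmult_le_compat_r (exp (- d * y))) in H1; [|lra].
  apply (Rmult_le_compat_r (exp (d * y))) in H2; [|lra].
  rewrite Rmult_assoc, ?E in H1.
  rewrite Rmult_assoc, (Rmult_comm (exp (- d * y))), E in H2.
  lra.
Qed.

(** [f + g] is nonnegative with truncations at most [2 * m], which reduces a signed integrand to the
    monotone criterion; then [f] is [(f + g) - g]. *)
Lemma intR_ex_dom (f g : R -> R) (m : R) : cont f -> cont g ->
  (forall x, Rabs (f x) <= g x) -> intR g m -> exists l, intR f l /\ Rabs l <= m.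
Proof.
  intros Cf Cg H Hg.
  destruct (intR_ex_bounded (fun x => f x + g x) (2 * m)) as [l [Hl Hl']].
  - apply cont_plus; auto.
  - intros x; specialize (H x); apply Rabs_le_between in H; lra.
  - intros A HA.
    assert (RInt g (- A) A <= m).
    { apply intR_ge_RInt; auto; [|lra].
      intros x; eapply Rle_trans; [apply Rabs_pos|apply H]. }
    rewrite RInt_plus_cont by auto.
    assert (RInt f (- A) A <= RInt g (- A) A); [|lra].
    apply RInt_le_cont; auto; [lra|].
    intros x _; eapply Rle_trans; [apply Rle_abs|apply H].
  - exists (l - m).
    assert (Hf : intR f (l - m)).
    { eapply intR_ext; [|apply (intR_minus _ _ _ _ (cont_plus _ _ Cf Cg) Cg Hl Hg)].
      intros x; simpl; ring. }
    split; [exact Hf|].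
    apply Rabs_le; split; [|lra].
    assert (0 <= l); [|lra].
    apply (intR_ge0 (fun x => f x + g x)); auto; [apply cont_plus; auto|].
    intros x; specialize (H x); apply Rabs_le_between in H; lra.
Qed.

(** [K] depends on [d] alone, so that a small factor in [C] passes to the integral. *)
Lemma intR_crit (d : R) : 0 < d -> exists K, 0 <= K /\ forall (f : R -> R) (C : R), cont f ->
  (forall y, Rabs (f y) <= C * exp (d * y)) -> (forall y, Rabs (f y) <= C * exp (- d * y)) ->
  exists l, intR f l /\ Rabs l <= C * K.
Proof.
  intros Hd; destruct (intR_sech d Hd) as [m Hm].
  assert (P : forall y, 0 < exp (d * y) + exp (- d * y)).
  { intros y; generalize (exp_pos (d * y)) (exp_pos (- d * y)); lra. }
  assert (Cs : cont (fun y => / (exp (d * y) + exp (- d * y)))).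
  { apply ex_derive_cont; intros x; auto_derive; generalize (P x); lra. }
  exists (2 * m); split.
  { assert (0 <= m); [|lra].
    apply (intR_ge0 _ _ Cs); auto; intros x; left; apply Rinv_0_lt_compat, P. }
  intros f C Cf H1 H2.
  replace (C * (2 * m)) with (2 * C * m) by ring.
  apply (intR_ex_dom f (fun y => 2 * C * / (exp (d * y) + exp (- d * y)))); auto.
  - apply cont_mult; [apply cont_const|exact Cs].
  - intros y; apply min_exp_le_sech; auto.
    specialize (H1 0); rewrite Rmult_0_r, exp_0 in H1; generalize (Rabs_pos (f 0)); lra.
  - apply intR_scal; auto.
Qed.

Lemma intR_abs_le (f g : R -> R) (l m : R) : cont f -> cont g ->
  (forall x, Rabs (f x) <= g x) -> intR f l -> intR g m -> Rabs l <= m.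
Proof.
  intros Cf Cg H Hf Hg; destruct (intR_ex_dom f g m Cf Cg H Hg) as [l' [Hl' Hb]].
  rewrite (intR_unique _ _ _ Hf Hl'); exact Hb.
Qed.

Lemma intR_pos (f : R -> R) (l : R) : cont f -> (forall x, 0 < f x) -> intR f l -> 0 < l.
Proof.
  intros Cf H Hl.
  apply Rlt_le_trans with (RInt f 0 1).
  - apply RInt_gt_0; auto; lra.
  - apply intR_ge_RInt; auto; [intros; left; auto|lra].
Qed.

(** * Exchange of sum and integral for nonnegative terms *)

Lemma sum_n_le_Series (u : nat -> R) (N : nat) : (forall n, 0 <= u n) -> ex_series u ->
  sum_n u N <= Series u.
Proof.
  intros H Hex.
  apply (is_lim_seq_incr_compare (sum_n u)).
  - apply Series_correct, Hex.
  - intros n; rewrite sum_Sn; unfold plus; simpl; generalize (H (S n)); lra.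
Qed.

Lemma is_series_sup (u : nat -> R) (l : R) : (forall n, 0 <= u n) ->
  (forall N, sum_n u N <= l) -> (forall eps, 0 < eps -> exists N, l - eps <= sum_n u N) ->
  is_series u l.
Proof.
  intros H0 H1 H2.
  assert (Hmon : forall n m, (n <= m)%nat -> sum_n u n <= sum_n u m).
  { intros n m Hnm; induction Hnm; [lra|].
    rewrite sum_Sn; unfold plus; simpl; generalize (H0 (S m)); lra. }
  change (is_lim_seq (sum_n u) l).
  apply is_lim_seq_spec; intros eps.
  destruct (H2 (eps / 2)) as [N HN]; [generalize (cond_pos eps); lra|].
  exists N; intros n Hn.
  generalize (H1 n) (Hmon _ _ Hn) (cond_pos eps); intros; apply Rabs_def1; lra.
Qed.

Lemma cont_sum_n (f : nat -> R -> R) (N : nat) :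
  (forall n, cont (f n)) -> cont (fun y => sum_n (fun n => f n y) N).
Proof.
  intros Cf x; eapply continuous_ext; [|apply (cont_sum f N Cf)].
  intros y; symmetry; apply sum_n_Reals.
Qed.

Lemma intR_sum_n (f : nat -> R -> R) (I : nat -> R) (N : nat) :
  (forall n, cont (f n)) -> (forall n, intR (f n) (I n)) ->
  intR (fun y => sum_n (fun n => f n y) N) (sum_n I N).
Proof.
  intros Cf HI; induction N as [|N IH].
  - rewrite sum_O; eapply intR_ext; [|apply (HI 0%nat)]; intros; rewrite sum_O; reflexivity.
  - rewrite sum_Sn; eapply intR_ext.
    2: apply (intR_plus _ _ _ _ (cont_sum_n f N Cf) (Cf (S N)) IH (HI (S N))).
    intros x; rewrite sum_Sn; reflexivity.
Qed.

Lemma Series_tail_small (u : nat -> R) (eps : R) : ex_series u -> 0 < eps ->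
  exists N, Series u - sum_n u N <= eps.
Proof.
  intros Hu He; apply Series_correct in Hu.
  change (is_lim_seq (sum_n u) (Series u)) in Hu.
  apply is_lim_seq_spec in Hu.
  destruct (Hu (mkposreal eps He)) as [N HN].
  exists N; specialize (HN N (Nat.le_refl _)); simpl in HN; apply Rabs_def2 in HN; lra.
Qed.

Lemma Series_tail_le (u M : nat -> R) (N : nat) : (forall n, 0 <= u n <= M n) -> ex_series M ->
  Series u - sum_n u N <= Series M - sum_n M N.
Proof.
  intros H HM.
  assert (Hu : ex_series u).
  { apply (@ex_series_le R_AbsRing R_CompleteNormedModule _ M); auto.
    intros n; unfold norm; simpl; unfold abs; simpl; rewrite Rabs_pos_eq; apply H. }
  assert (Hd : ex_series (fun n => M n - u n)) by (apply (ex_series_minus M u); auto).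
  assert (E : sum_n (fun n => M n - u n) N = sum_n M N - sum_n u N).
  { rewrite !sum_n_Reals, minus_sum; reflexivity. }
  assert (sum_n (fun n => M n - u n) N <= Series (fun n => M n - u n)).
  { apply sum_n_le_Series; auto; intros n; generalize (H n); lra. }
  rewrite Series_minus in * by auto; lra.
Qed.

(** Monotone convergence by elementary means: partial sums are bounded by [J]; conversely a
    truncation of [F] to [[-Y, Y]] carries [J] up to [eps / 2], and on it the majorant [M] makes the
    tail of the series uniformly small. *)
Lemma intR_series (f : nat -> R -> R) (F : R -> R) (I : nat -> R) (J : R) :
  (forall n, cont (f n)) -> cont F -> (forall n y, 0 <= f n y) ->
  (forall y, is_series (fun n => f n y) (F y)) ->
  (forall Y, exists M, ex_series M /\ forall n y, - Y <= y <= Y -> f n y <= M n) ->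
  (forall n, intR (f n) (I n)) -> intR F J -> is_series I J.
Proof.
  intros Cf CF H0 HF HM HI HJ.
  assert (HS : forall N y, sum_n (fun n => f n y) N <= F y).
  { intros N y; rewrite <- (is_series_unique _ _ (HF y)).
    apply sum_n_le_Series; auto; exists (F y); auto. }
  apply is_series_sup.
  - intros n; apply (intR_ge0 (f n)); auto.
  - intros N; eapply intR_le; [| |apply (HS N)|apply intR_sum_n; auto|exact HJ]; auto.
    apply cont_sum_n; auto.
  - intros eps He.
    destruct (HJ (eps / 2)) as [Y0 HY0]; [lra|].
    set (Y := Rmax Y0 1).
    assert (Y0 <= Y) by apply Rmax_l.
    assert (1 <= Y) by apply Rmax_r.
    specialize (HY0 Y Y ltac:(lra) ltac:(lra)); apply Rabs_def2 in HY0.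
    destruct (HM Y) as [M [HMs HMb]].
    (* Integrated over an interval of length [2 * Y], this tail costs the other [eps / 2]. *)
    destruct (Series_tail_small M (eps / (4 * Y)) HMs) as [N HN].
    { apply Rdiv_lt_0_compat; lra. }
    exists N.
    assert (Hle : RInt F (- Y) Y <= RInt (fun y => sum_n (fun n => f n y) N + eps / (4 * Y)) (- Y) Y).
    { apply RInt_le_cont; auto; [lra|apply cont_plus; [apply cont_sum_n; auto|apply cont_const]|].
      intros y Hy.
      generalize (Series_tail_le (fun n => f n y) M N); intros Ht.
      rewrite (is_series_unique _ _ (HF y)) in Ht.
      specialize (Ht ltac:(intros n; split; [apply H0|apply HMb; exact Hy]) HMs); lra. }
    rewrite RInt_plus_cont in Hle by (auto using cont_const, cont_sum_n).
    rewrite RInt_const in Hle; unfold scal in Hle; simpl in Hle; unfold mult in Hle; simpl in Hle.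
    replace ((Y - - Y) * (eps / (4 * Y))) with (eps / 2) in Hle by (field; lra).
    assert (RInt (fun y => sum_n (fun n => f n y) N) (- Y) Y <= sum_n I N).
    { apply intR_ge_RInt; [apply cont_sum_n; auto| |lra|apply intR_sum_n; auto].
      intros y; rewrite sum_n_Reals; apply cond_pos_sum; auto. }
    lra.
Qed.

(** * Inversion formula of the theta series *)

Local Notation bin := Binomial.C.

(** * Finite trigonometric sums and the binomial theorem *)

Fixpoint psum (f : nat -> R) (n : nat) : R :=
  match n with O => 0 | S n => psum f n + f n end.

Lemma psum_ext (f g : nat -> R) (n : nat) :
  (forall i, (i < n)%nat -> f i = g i) -> psum f n = psum g n.
Proof.
  induction n as [|n IH]; intros H; simpl; [reflexivity|].
  rewrite IH, H by (intros; try apply H; lia); reflexivity.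
Qed.

Lemma psum_plus (f g : nat -> R) (n : nat) :
  psum (fun i => f i + g i) n = psum f n + psum g n.
Proof. induction n as [|n IH]; simpl; [ring|rewrite IH; ring]. Qed.

Lemma psum_scal (c : R) (f : nat -> R) (n : nat) : psum (fun i => c * f i) n = c * psum f n.
Proof. induction n as [|n IH]; simpl; [ring|rewrite IH; ring]. Qed.

Lemma psum_S (f : nat -> R) (n : nat) : psum f (S n) = f O + psum (fun i => f (S i)) n.
Proof. induction n as [|n IH]; [simpl; ring|]. simpl in *; rewrite IH; ring. Qed.

Lemma psum_add (f : nat -> R) (n m : nat) :
  psum f (n + m) = psum f n + psum (fun i => f (n + i)%nat) m.
Proof.
  induction m as [|m IH]; [rewrite Nat.add_0_r; simpl; ring|].
  rewrite Nat.add_succ_r; simpl; rewrite IH; ring.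
Qed.

Lemma psum_zero (f : nat -> R) (n : nat) :
  (forall i, (i < n)%nat -> f i = 0) -> psum f n = 0.
Proof.
  induction n as [|n IH]; intros H; simpl; [reflexivity|].
  rewrite IH, H by (intros; try apply H; lia); ring.
Qed.

Lemma psum_exchange (f : nat -> nat -> R) (n m : nat) :
  psum (fun i => psum (f i) m) n = psum (fun j => psum (fun i => f i j) n) m.
Proof.
  induction n as [|n IH]; simpl.
  - symmetry; apply psum_zero; reflexivity.
  - rewrite IH, <- psum_plus; reflexivity.
Qed.

Lemma psum_pair (f : nat -> R) (p : nat) :
  psum f (2 * p) = psum (fun h => f h + f (2 * p - 1 - h)%nat) p.
Proof.
  revert f; induction p as [|p IH]; intros f; [reflexivity|].
  replace (2 * S p)%nat with (S (S (2 * p))) by lia.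
  rewrite psum_S, (psum_S (fun h => f h + _)); cbn [psum].
  rewrite (IH (fun i => f (S i))).
  replace (S (S (2 * p)) - 1 - 0)%nat with (S (2 * p)) by lia.
  rewrite (psum_ext (fun h => f (S h) + f (S (2 * p - 1 - h)))
             (fun i => f (S i) + f (S (S (2 * p)) - 1 - S i)%nat)); [ring|].
  intros i Hi; do 2 f_equal; lia.
Qed.

Lemma psum_center (u : nat -> R) (m : nat) :
  psum u (S (2 * m)) = u m + psum (fun j => u (m + S j)%nat + u (m - S j)%nat) m.
Proof.
  revert u; induction m as [|m IH]; intros u; [simpl; ring|].
  replace (S (2 * S m)) with (S (S (S (2 * m)))) by lia.
  rewrite psum_S; set (v := fun i => u (S i)).
  change (psum v (S (S (2 * m)))) with (psum v (S (2 * m)) + v (S (2 * m))).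
  rewrite IH; cbn [psum].
  replace (S m - S m)%nat with O by lia.
  replace (S m + S m)%nat with (S (S (2 * m))) by lia.
  rewrite (psum_ext (fun j => v (m + S j)%nat + v (m - S j)%nat)
             (fun j => u (S m + S j)%nat + u (S m - S j)%nat)).
  - unfold v; simpl; ring.
  - intros i Hi; unfold v; do 2 f_equal; lia.
Qed.

Lemma psum_multiples (f : nat -> R) (l M : nat) : (1 <= l)%nat ->
  psum (fun j => if Nat.eqb (S j mod l) 0 then f (S j) else 0) (l * M)
  = psum (fun n => f (S n * l)%nat) M.
Proof.
  intros Hl; induction M as [|M IH]; [rewrite Nat.mul_0_r; reflexivity|].
  replace (l * S M)%nat with (l * M + S (l - 1))%nat by nia.
  rewrite psum_add, IH; cbn [psum]; rewrite (psum_zero _ (l - 1)).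
  - replace (S (l * M + (l - 1))) with (S M * l)%nat by nia.
    rewrite Nat.Div0.mod_mul, Nat.eqb_refl; ring.
  - intros i Hi.
    replace (S (l * M + i)) with (S i + M * l)%nat by lia.
    rewrite Nat.Div0.mod_add, Nat.mod_small by lia; reflexivity.
Qed.

Lemma psum_binomial (n : nat) (g : nat -> R) :
  psum (fun i => bin (S n) i * g i) (S (S n))
  = psum (fun i => bin n i * g i) (S n) + psum (fun i => bin n i * g (S i)) (S n).
Proof.
  assert (H0 : forall k, bin k 0 = 1).
  { intros k; unfold Binomial.C; rewrite Nat.sub_0_r; simpl; field; apply INR_fact_neq_0. }
  assert (Hn : forall k, bin k k = 1).
  { intros k; unfold Binomial.C; rewrite Nat.sub_diag; simpl; field; apply INR_fact_neq_0. }
  rewrite psum_S, (psum_S (fun i => bin n i * g i)); cbn [psum].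
  rewrite (psum_ext (fun i => bin (S n) (S i) * g (S i)) (fun i => bin n i * g (S i) + bin n (S i) * g (S i))).
  - rewrite psum_plus, !H0, !Hn; ring.
  - intros i Hi; rewrite <- pascal by lia; ring.
Qed.

(** Real part of the binomial theorem for [(exp (i x) + exp (- i x)) ^ n * exp (i t)]; the phase [t]
    absorbs the shifts by [x] and [- x] in the induction. *)
Lemma cos_power_expansion (n : nat) (x t : R) :
  psum (fun i => bin n i * cos (t + (INR n - 2 * INR i) * x)) (S n) = 2 ^ n * cos x ^ n * cos t.
Proof.
  revert t; induction n as [|n IH]; intros t.
  - cbn [psum]; unfold Binomial.C; simpl; replace (t + (0 - 2 * 0) * x) with t by ring; field.
  - rewrite psum_binomial.
    rewrite (psum_ext (fun i => bin n i * cos (t + (INR (S n) - 2 * INR i) * x))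
              (fun i => bin n i * cos ((t + x) + (INR n - 2 * INR i) * x)) (S n)).
    2: { intros i _; rewrite S_INR; do 2 f_equal; ring. }
    rewrite (psum_ext (fun i => bin n i * cos (t + (INR (S n) - 2 * INR (S i)) * x))
              (fun i => bin n i * cos ((t - x) + (INR n - 2 * INR i) * x)) (S n)).
    2: { intros i _; rewrite !S_INR; do 2 f_equal; ring. }
    rewrite !IH, cos_plus, cos_minus; simpl; ring.
Qed.

Lemma psum_cos_telescope (a : R) (n : nat) :
  2 * sin a * psum (fun h => cos (2 * INR h * a)) n = sin ((2 * INR n - 1) * a) + sin a.
Proof.
  induction n as [|n IH].
  - simpl; replace ((2 * 0 - 1) * a) with (- a) by ring; rewrite sin_neg; ring.
  - cbn [psum]; rewrite Rmult_plus_distr_l, IH, S_INR.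
    replace ((2 * INR n - 1) * a) with (2 * INR n * a - a) by ring.
    replace ((2 * (INR n + 1) - 1) * a) with (2 * INR n * a + a) by ring.
    rewrite sin_plus, sin_minus; ring.
Qed.

(** Orthogonality of the [l]-th roots of unity: unless [l] divides [j], the right-hand side of the
    telescoping formula is zero while [sin a] is not. *)
Lemma psum_cos_roots (l j : nat) : (1 <= l)%nat ->
  psum (fun h => cos (2 * INR j * (PI * INR h / INR l))) l
  = if Nat.eqb (j mod l) 0 then INR l else 0.
Proof.
  intros Hl; assert (Hl' : 0 < INR l) by (apply lt_0_INR; lia).
  destruct (Nat.eqb_spec (j mod l) 0) as [E|E].
  - apply Nat.Div0.mod_divides in E; destruct E as [q ->].
    rewrite (psum_ext _ (fun _ => 1)).
    + clear; induction l as [|l IH]; [reflexivity|]; cbn [psum]; rewrite IH, S_INR; ring.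
    + intros h _; rewrite <- cos_0, <- (cos_period 0 (q * h)), !mult_INR.
      f_equal; field; lra.
  - set (a := PI * INR j / INR l).
    assert (Hs : sin a <> 0).
    { intros H; destruct (sin_eq_0_0 _ H) as [k Hk]; apply E.
      assert (Hj : INR j = IZR k * INR l).
      { apply (Rmult_eq_reg_r (PI / INR l)).
        - replace (INR j * (PI / INR l)) with a by (unfold a; field; lra).
          rewrite Hk; field; lra.
        - apply Rgt_not_eq, Rdiv_lt_0_compat; [apply PI_RGT_0|lra]. }
      rewrite !INR_IZR_INZ, <- mult_IZR in Hj; apply eq_IZR in Hj.
      assert (Hk0 : (0 <= k)%Z) by nia.
      replace j with (Z.to_nat k * l)%nat by nia.
      apply Nat.Div0.mod_mul. }
    generalize (psum_cos_telescope a l).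
    replace ((2 * INR l - 1) * a) with (- a + 2 * INR j * PI) by (unfold a; field; lra).
    rewrite sin_period, sin_neg.
    rewrite (psum_ext (fun h => cos (2 * INR j * (PI * INR h / INR l)))
              (fun h => cos (2 * INR h * a))).
    2: { intros h _; f_equal; unfold a; field; lra. }
    intros H; replace (- sin a + sin a) with 0 in H by ring.
    apply Rmult_integral in H; destruct H as [H|H]; [lra|exact H].
Qed.

(** A discrete Gaussian, close to [exp (- r ^ 2 / m)]. The zero beyond [m] has to be imposed:
    natural subtraction truncates, so [bin] does not vanish past the end of a row. *)
Definition rho (m r : nat) : R :=
  if Nat.leb r m then bin (2 * m) (m + r) / bin (2 * m) m else 0.

Lemma C_pos (n i : nat) : 0 < bin n i.
Proof.
  unfold Binomial.C; apply Rdiv_lt_0_compat; [|apply Rmult_lt_0_compat]; apply INR_fact_lt_0.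
Qed.

(** The sum of [cos (PI h / l) ^ (2 m)] over a full period, [l = 2 p + 1], computed twice: [E1]
    folds it by [h -> l - h], which preserves an even power; [E2] and [E3] expand the power and keep
    the indices whose distance to the central one is a multiple of [l]. *)
Lemma cos_power_sum (m p : nat) :
  1 + 2 * psum (fun h => cos (PI * INR (S h) / INR (2 * p + 1)) ^ (2 * m)) p
  = INR (2 * p + 1) * (bin (2 * m) m / 4 ^ m)
    * (1 + 2 * psum (fun n => rho m (S n * (2 * p + 1))) m).
Proof.
  set (l := (2 * p + 1)%nat).
  assert (Hl : 0 < INR l) by (apply lt_0_INR; lia).
  assert (H4 : 0 < 4 ^ m) by (apply pow_lt; lra).
  assert (HC := C_pos (2 * m) m).
  assert (E1 : psum (fun h => cos (PI * INR h / INR l) ^ (2 * m)) l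
     = 1 + 2 * psum (fun h => cos (PI * INR (S h) / INR l) ^ (2 * m)) p).
  { transitivity (psum (fun h => cos (PI * INR h / INR l) ^ (2 * m)) (S (2 * p))); [f_equal; lia|].
    rewrite psum_S, psum_pair, <- psum_scal; f_equal.
    - replace (PI * INR 0 / INR l) with 0 by (simpl; field; lra).
      rewrite cos_0, pow1; reflexivity.
    - apply psum_ext; intros h Hh.
      replace (cos (PI * INR (S (2 * p - 1 - h)) / INR l) ^ (2 * m))
        with (cos (PI * INR (S h) / INR l) ^ (2 * m)); [ring|].
      rewrite !pow_mult.
      replace (PI * INR (S (2 * p - 1 - h)) / INR l) with (PI - PI * INR (S h) / INR l).
      + f_equal; rewrite cos_minus, cos_PI, sin_PI; simpl; ring.
      + replace (S (2 * p - 1 - h)) with (l - S h)%nat by lia.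
        rewrite minus_INR by lia; field; lra. }
  assert (E2 : 4 ^ m * psum (fun h => cos (PI * INR h / INR l) ^ (2 * m)) l
     = psum (fun i => bin (2 * m) i *
         psum (fun h => cos ((INR (2 * m) - 2 * INR i) * (PI * INR h / INR l))) l) (S (2 * m))).
  { rewrite <- psum_scal.
    rewrite (psum_ext (fun i => bin (2 * m) i * psum _ l)
      (fun i => psum (fun h => bin (2 * m) i * cos ((INR (2 * m) - 2 * INR i) * (PI * INR h / INR l))) l)).
    2: { intros i _; rewrite psum_scal; reflexivity. }
    rewrite psum_exchange; apply psum_ext; intros h _.
    rewrite (psum_ext _ (fun i => bin (2 * m) i * cos (0 + (INR (2 * m) - 2 * INR i) * (PI * INR h / INR l)))).
    2: { intros i _; rewrite Rplus_0_l; reflexivity. }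
    rewrite cos_power_expansion, cos_0, Rmult_1_r; f_equal.
    rewrite pow_mult; f_equal; ring. }
  assert (E3 : psum (fun i => bin (2 * m) i *
         psum (fun h => cos ((INR (2 * m) - 2 * INR i) * (PI * INR h / INR l))) l) (S (2 * m))
     = bin (2 * m) m * (INR l * (1 + 2 * psum (fun n => rho m (S n * l)) m))).
  { rewrite psum_center.
    rewrite (psum_ext (fun h => cos ((INR (2 * m) - 2 * INR m) * (PI * INR h / INR l)))
              (fun h => cos (2 * INR 0 * (PI * INR h / INR l)))).
    2: { intros h _; f_equal; rewrite mult_INR; simpl; ring. }
    rewrite psum_cos_roots by lia.
    rewrite Nat.Div0.mod_0_l; cbn [Nat.eqb].
    rewrite (psum_ext _ (fun j => 2 * (bin (2 * m) m * INR l) *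
               (if Nat.eqb (S j mod l) 0 then rho m (S j) else 0))).
    - rewrite psum_scal.
      replace (psum (fun j => if Nat.eqb (S j mod l) 0 then rho m (S j) else 0) m)
        with (psum (fun n => rho m (S n * l)) m); [ring|].
      rewrite <- (psum_multiples (rho m) l m) by lia.
      (* [rho m] vanishes beyond [m], so the range may be prolonged to the multiple [l * m]. *)
      replace (l * m)%nat with (m + (l - 1) * m)%nat by nia.
      rewrite psum_add, (psum_zero (fun i => if Nat.eqb (S (m + i) mod l) 0 then _ else 0)); [ring|].
      intros i _; unfold rho; destruct (Nat.leb_spec (S (m + i)) m); [lia|].
      destruct (Nat.eqb _ _); reflexivity.
    - intros j Hj.
      rewrite (psum_ext (fun h => cos ((INR (2 * m) - 2 * INR (m + S j)) * (PI * INR h / INR l)))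
                (fun h => cos (2 * INR (S j) * (PI * INR h / INR l)))).
      2: { intros h _; rewrite <- cos_neg; f_equal; rewrite plus_INR, mult_INR; simpl (INR 2); ring. }
      rewrite (psum_ext (fun h => cos ((INR (2 * m) - 2 * INR (m - S j)) * (PI * INR h / INR l)))
                (fun h => cos (2 * INR (S j) * (PI * INR h / INR l)))).
      2: { intros h _; f_equal; rewrite minus_INR, mult_INR by lia; simpl (INR 2); ring. }
      rewrite psum_cos_roots by lia.
      replace (bin (2 * m) (m - S j)) with (bin (2 * m) (m + S j)).
      + unfold rho; destruct (Nat.leb_spec (S j) m); [|lia].
        destruct (Nat.eqb _ _); field; lra.
      + unfold Binomial.C.
        replace (2 * m - (m + S j))%nat with (m - S j)%nat by lia.
        replace (2 * m - (m - S j))%nat with (m + S j)%nat by lia.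
        rewrite (Rmult_comm (INR (Factorial.fact (m + S j)))); reflexivity. }
  rewrite <- E1.
  apply (Rmult_eq_reg_l (4 ^ m)); [|lra].
  rewrite E2, E3; field; lra.
Qed.

(** * Gaussian bounds for ratios of binomial coefficients *)

Lemma exp_le_1_minus (t : R) : 0 <= t < 1 -> exp (- (t / (1 - t))) <= 1 - t.
Proof.
  intros Ht.
  assert (E : 1 + t / (1 - t) = / (1 - t)) by (field; lra).
  rewrite exp_Ropp; apply Rle_trans with (/ / (1 - t)); [|rewrite Rinv_inv; lra].
  apply Rinv_le_contravar; [apply Rinv_0_lt_compat; lra|].
  rewrite <- E; apply exp_ineq1_le.
Qed.

Lemma one_minus_le_exp (t : R) : 1 - t <= exp (- t).
Proof. generalize (exp_ineq1_le (- t)); lra. Qed.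

Lemma rho_0 (m : nat) : rho m 0 = 1.
Proof. unfold rho; simpl Nat.leb; rewrite Nat.add_0_r; field; apply Rgt_not_eq, C_pos. Qed.

Lemma rho_S (m r : nat) : (S r <= m)%nat ->
  rho m (S r) = rho m r * (1 - INR (2 * r + 1) / INR (m + r + 1)).
Proof.
  intros H; unfold rho.
  destruct (Nat.leb_spec (S r) m); [|lia]; destruct (Nat.leb_spec r m); [|lia].
  assert (HC := C_pos (2 * m) m).
  assert (Hd : 0 < INR (m + r + 1)) by (apply lt_0_INR; lia).
  replace (bin (2 * m) (m + S r)) with (bin (2 * m) (m + r) * (1 - INR (2 * r + 1) / INR (m + r + 1))).
  - field; lra.
  - unfold Binomial.C.
    replace (2 * m - (m + r))%nat with (S (m - S r)) by lia.
    replace (2 * m - (m + S r))%nat with (m - S r)%nat by lia.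
    replace (m + S r)%nat with (S (m + r)) by lia.
    rewrite !fact_simpl, !mult_INR.
    replace (1 - INR (2 * r + 1) / INR (m + r + 1)) with (INR (S (m - S r)) / INR (S (m + r))).
    + assert (INR (S (m - S r)) <> 0) by (apply not_0_INR; lia).
      assert (INR (S (m + r)) <> 0) by (apply not_0_INR; lia).
      field; repeat split; auto using INR_fact_neq_0.
    + replace (S (m + r)) with (m + r + 1)%nat by lia.
      replace (INR (S (m - S r))) with (INR (m + r + 1) - INR (2 * r + 1)).
      * field; lra.
      * rewrite <- minus_INR by lia; f_equal; lia.
Qed.

(** [rho m r] is the product of [1 - (2 i + 1) / (m + i + 1)] over [i < r]. Each factor lies between
    two exponentials, and the odd numbers [2 i + 1] add up to [r ^ 2]. The cap [R0] makes the
    denominators uniform in [i]. *)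
Lemma rho_bounds (m R0 r : nat) : (R0 <= m)%nat -> (r <= R0)%nat ->
  exp (- (INR r ^ 2 / INR (m - R0 + 1))) <= rho m r <= exp (- (INR r ^ 2 / INR (m + R0))).
Proof.
  intros HR; induction r as [|r IH]; intros Hr.
  - rewrite rho_0; simpl (INR 0); unfold Rdiv; rewrite pow_ne_zero, !Rmult_0_l, Ropp_0, exp_0 by lia; lra.
  - specialize (IH ltac:(lia)); rewrite rho_S by lia.
    assert (Hd1 : 0 < INR (m - R0 + 1)) by (apply lt_0_INR; lia).
    assert (Hd2 : 0 < INR (m + R0)) by (apply lt_0_INR; lia).
    assert (Hd3 : 0 < INR (m + r + 1)) by (apply lt_0_INR; lia).
    set (t := INR (2 * r + 1) / INR (m + r + 1)) in *.
    assert (Hlt : INR (2 * r + 1) < INR (m + r + 1)) by (apply lt_INR; lia).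
    assert (Ht : 0 <= t < 1).
    { unfold t; split.
      - apply Rle_mult_inv_pos; [apply pos_INR|lra].
      - apply (Rmult_lt_reg_r (INR (m + r + 1))); [lra|]; unfold Rdiv.
        rewrite Rmult_assoc, Rinv_l by lra; lra. }
    assert (Esq : INR (S r) ^ 2 = INR r ^ 2 + INR (2 * r + 1)).
    { rewrite plus_INR, mult_INR, S_INR; simpl; ring. }
    assert (Hu : t >= INR (2 * r + 1) / INR (m + R0)).
    { apply Rle_ge; unfold t, Rdiv; apply Rmult_le_compat_l; [apply pos_INR|].
      apply Rinv_le_contravar; [lra|apply le_INR; lia]. }
    assert (Hl : t / (1 - t) <= INR (2 * r + 1) / INR (m - R0 + 1)).
    { assert (E : t / (1 - t) = INR (2 * r + 1) / INR (m - r)).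
      { unfold t; replace (INR (m - r)) with (INR (m + r + 1) - INR (2 * r + 1)).
        - field; lra.
        - rewrite <- minus_INR by lia; f_equal; lia. }
      rewrite E; unfold Rdiv; apply Rmult_le_compat_l; [apply pos_INR|].
      apply Rinv_le_contravar; [lra|apply le_INR; lia]. }
    rewrite Esq; unfold Rdiv; rewrite !Rmult_plus_distr_r, !Ropp_plus_distr, !exp_plus.
    split.
    + apply Rmult_le_compat; try (left; apply exp_pos); [apply IH|].
      eapply Rle_trans; [|apply exp_le_1_minus, Ht].
      apply exp_le; unfold Rdiv in *; lra.
    + apply Rmult_le_compat; [|lra|apply IH|].
      * eapply Rle_trans; [|apply IH]; left; apply exp_pos.
      * eapply Rle_trans; [apply one_minus_le_exp|].
        apply exp_le; unfold Rdiv in *; lra.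
Qed.

(** * Passage to the limit in the finite identity *)

Definition theta (u : R) : R := 1 + 2 * Series (fun n => exp (- (PI * INR (S n) ^ 2 * u))).

Lemma psum_sum_n (f : nat -> R) (n : nat) : psum f (S n) = sum_n f n.
Proof.
  induction n as [|n IH]; [rewrite sum_O; simpl; ring|].
  rewrite sum_Sn, <- IH; reflexivity.
Qed.

Lemma Series_eq_psum (f : nat -> R) (p : nat) : (forall n, (p <= n)%nat -> f n = 0) ->
  Series f = psum f p.
Proof.
  intros H; apply is_series_unique.
  change (is_lim_seq (sum_n f) (psum f p)).
  apply is_lim_seq_ext_loc with (fun _ => psum f p); [|apply is_lim_seq_const].
  exists p; intros n Hn; rewrite <- psum_sum_n.
  replace (S n) with (p + (S n - p))%nat by lia.
  rewrite psum_add, (psum_zero _ (S n - p)); [ring|].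
  intros i _; apply H; lia.
Qed.

Lemma ex_series_geom_exp (c : R) : 0 < c -> ex_series (fun n => exp (- (c * INR (S n)))).
Proof.
  intros Hc.
  apply (ex_series_incr_1 (fun n => exp (- (c * INR n)))).
  apply (ex_series_ext (fun n => exp (- c) ^ n)).
  - intros n; induction n as [|n IH]; [simpl; rewrite Rmult_0_r, Ropp_0, exp_0; reflexivity|].
    rewrite S_INR; simpl; rewrite IH, <- exp_plus; f_equal; ring.
  - apply ex_series_geom; rewrite Rabs_pos_eq by apply exp_ge0.
    rewrite <- exp_0; apply exp_increasing; lra.
Qed.

Lemma ex_series_le_pos (a b : nat -> R) : (forall n, 0 <= a n <= b n) -> ex_series b -> ex_series a.
Proof.
  intros H; apply (@ex_series_le R_AbsRing R_CompleteNormedModule).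
  intros n; unfold norm; simpl; unfold abs; simpl; rewrite Rabs_pos_eq; apply H.
Qed.

(** Dominated convergence for series: beyond [K] every sum is within the tail of [b], and up to [K]
    the limit is taken termwise. *)
Lemma tannery (a : nat -> nat -> R) (l b : nat -> R) : ex_series b ->
  eventually (fun N => forall n, 0 <= a N n <= b n) ->
  (forall n, is_lim_seq (fun N => a N n) (l n)) ->
  is_lim_seq (fun N => Series (a N)) (Series l).
Proof.
  intros Hb [N0 Hab] Hl.
  assert (Hlb : forall n, 0 <= l n <= b n).
  { intros n; split.
    - apply (is_lim_seq_le_loc (fun _ => 0) (fun N => a N n) 0 (l n)); auto using is_lim_seq_const.
      exists N0; intros N HN; apply Hab, HN.
    - apply (is_lim_seq_le_loc (fun N => a N n) (fun _ => b n) (l n) (b n)); auto using is_lim_seq_const.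
      exists N0; intros N HN; apply Hab, HN. }
  apply is_lim_seq_spec; intros eps.
  assert (He := cond_pos eps).
  destruct (Series_tail_small b (eps / 4) Hb) as [K HK]; [lra|].
  assert (Hs : is_lim_seq (fun N => sum_n (a N) K) (sum_n l K)).
  { clear HK; induction K as [|K IH].
    - rewrite sum_O; eapply is_lim_seq_ext; [|apply Hl]; intros; rewrite sum_O; reflexivity.
    - rewrite sum_Sn; apply is_lim_seq_ext with (fun N => sum_n (a N) K + a N (S K)).
      + intros n; rewrite sum_Sn; reflexivity.
      + apply is_lim_seq_plus'; auto. }
  apply is_lim_seq_spec in Hs.
  destruct (Hs (mkposreal (eps / 4) ltac:(lra))) as [N1 HN1]; simpl in HN1.
  exists (Nat.max N0 N1); intros N HN.
  specialize (HN1 N ltac:(lia)); apply Rabs_def2 in HN1.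
  specialize (Hab N ltac:(lia)).
  generalize (Series_tail_le (a N) b K Hab Hb) (Series_tail_le l b K Hlb Hb).
  generalize (sum_n_le_Series (a N) K (fun n => proj1 (Hab n)) (ex_series_le_pos _ _ Hab Hb)).
  generalize (sum_n_le_Series l K (fun n => proj1 (Hlb n)) (ex_series_le_pos _ _ Hlb Hb)).
  intros; apply Rabs_def1; lra.
Qed.

Lemma sin_ge_cubic (x : R) : 0 <= x -> x - x ^ 3 / 6 <= sin x.
Proof.
  intros Hx.
  destruct (MVT_gen (fun x => sin x - x + x ^ 3 / 6) 0 x (fun x => cos x - 1 + x ^ 2 / 2)) as [c [Hc E]].
  - intros y _; auto_derive; [trivial|]; field.
  - intros y _; apply derivable_continuous_pt, ex_derive_Reals_0; auto_derive; trivial.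
  - simpl in E; rewrite sin_0 in E.
    assert (0 <= cos c - 1 + c ^ 2 / 2).
    { replace c with (2 * (c / 2)) at 1 by field.
      rewrite cos_2a_sin.
      assert (Hs : Rabs (sin (c / 2)) <= Rabs (c / 2)).
      { rewrite Rmin_left, Rmax_right in Hc by lra.
        destruct (Req_dec c 0) as [->|Hc0]; [replace (0/2) with 0 by field; rewrite sin_0; lra|].
        rewrite (Rabs_pos_eq (c / 2)) by lra.
        destruct (Rle_dec (c / 2) PI) as [Hp|Hp].
        - rewrite Rabs_pos_eq; [left; apply sin_lt_x; lra|apply sin_ge_0; lra].
        - apply Rle_trans with 1; [apply Rabs_le, SIN_bound|].
          generalize PI2_1; lra. }
      apply Rsqr_le_abs_1 in Hs; unfold Rsqr in Hs.
      assert (Ec : c / 2 * (c / 2) = c ^ 2 / 4) by field; rewrite Ec in Hs; lra. }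
    assert (0 <= (cos c - 1 + c * (c * 1) / 2) * (x - 0)).
    { apply Rmult_le_pos; [exact H|lra]. }
    lra.
Qed.

Lemma cos2_eq (x : R) : cos x ^ 2 = 1 - sin x ^ 2.
Proof. generalize (sin2_cos2 x); unfold Rsqr; intros; simpl; lra. Qed.

Lemma sin_sq_bounds (x : R) : 0 <= x <= 2 ->
  x ^ 2 * (1 - x ^ 2 / 6) ^ 2 <= sin x ^ 2 <= x ^ 2.
Proof.
  intros Hx; generalize (sin_ge_cubic x ltac:(lra)); intros Hs.
  assert (Hu : sin x <= x).
  { destruct (Req_dec x 0) as [->|]; [rewrite sin_0; lra|left; apply sin_lt_x; lra]. }
  replace (x ^ 2 * (1 - x ^ 2 / 6) ^ 2) with ((x - x ^ 3 / 6) ^ 2) by field.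
  assert (0 <= x - x ^ 3 / 6).
  { replace (x - x ^ 3 / 6) with (x * (1 - x ^ 2 / 6)) by field; apply Rmult_le_pos; nra. }
  split; apply pow_incr; lra.
Qed.

Lemma cos_power_bounds (x : R) (N : nat) : 0 <= x <= 2 -> x < 1 ->
  exp (- (INR N * x ^ 2 / (1 - x ^ 2))) <= cos x ^ (2 * N)
    <= exp (- (INR N * x ^ 2 * (1 - x ^ 2 / 6) ^ 2)).
Proof.
  intros Hx Hx1; rewrite pow_mult, cos2_eq.
  destruct (sin_sq_bounds x Hx) as [H1 H2].
  assert (Hx2 : 0 <= x ^ 2 < 1) by (split; nra).
  assert (E : forall t, exp (- (INR N * t)) = exp (- t) ^ N).
  { intros t; induction N as [|N IH]; [simpl; rewrite Rmult_0_l, Ropp_0, exp_0; reflexivity|].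
    rewrite S_INR; simpl; rewrite <- IH, <- exp_plus; f_equal; ring. }
  unfold Rdiv; rewrite !Rmult_assoc, !E; split; apply pow_incr; split; try apply exp_ge0; try lra.
  - eapply Rle_trans; [apply (exp_le_1_minus (x ^ 2)); exact Hx2|lra].
  - eapply Rle_trans; [apply one_minus_le_exp|apply exp_le; unfold Rdiv in H1; lra].
Qed.

(** A cruder constant that holds for all the angles of the sum, which stay below [PI / 2]: for
    [x <= 2] one has [1 - x ^ 2 / 6 >= 1 / 3], whence the [9]. *)
Lemma cos_power_dom (x : R) (N : nat) : 0 <= x <= 2 ->
  0 <= cos x ^ (2 * N) <= exp (- (INR N * x ^ 2 / 9)).
Proof.
  intros Hx; rewrite pow_mult, cos2_eq.
  destruct (sin_sq_bounds x Hx) as [H1 H2].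
  assert (Hc : 0 <= 1 - sin x ^ 2) by (rewrite <- cos2_eq; apply pow2_ge_0).
  assert (E : forall t, exp (- (INR N * t)) = exp (- t) ^ N).
  { intros t; induction N as [|N IH]; [simpl; rewrite Rmult_0_l, Ropp_0, exp_0; reflexivity|].
    rewrite S_INR; simpl; rewrite <- IH, <- exp_plus; f_equal; ring. }
  unfold Rdiv; rewrite Rmult_assoc, E; split; [apply pow_le, Hc|apply pow_incr; split; [exact Hc|]].
  eapply Rle_trans; [apply one_minus_le_exp|apply exp_le].
  assert (/ 9 <= (1 - x ^ 2 / 6) ^ 2).
  { replace (/ 9) with ((/ 3) ^ 2) by field; apply pow_incr; split; [lra|nra]. }
  nra.
Qed.

Lemma is_lim_seq_exp (v : nat -> R) (l : R) : is_lim_seq v l -> is_lim_seq (fun n => exp (v n)) (exp l).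
Proof.
  intros H; apply is_lim_seq_continuous; [|exact H].
  apply derivable_continuous_pt, derivable_pt_exp.
Qed.

Lemma is_lim_seq_opp_finite (v : nat -> R) (l : R) : is_lim_seq v l -> is_lim_seq (fun n => - v n) (- l).
Proof. intros H; apply (is_lim_seq_opp v (Finite l)), H. Qed.

Lemma is_lim_seq_inv_INR : is_lim_seq (fun N => / INR N) 0.
Proof.
  apply (is_lim_seq_inv (fun N => INR N) p_infty); [apply is_lim_seq_INR|discriminate].
Qed.

(* Both lemmas below let [l = 2 p + 1] and [N] tend to infinity with [l ^ 2 / N] convergent. *)
Lemma cos_side_limit (u : R) (p : nat -> nat) : 0 < u ->
  is_lim_seq (fun N => INR (2 * p N + 1) ^ 2 / INR N) (PI * u) ->
  is_lim_seq (fun N => 1 + 2 * psum (fun h => cos (PI * INR (S h) / INR (2 * p N + 1)) ^ (2 * N)) (p N))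
    (theta (/ u)).
Proof.
  intros Hu Hz; assert (HP := PI_RGT_0).
  set (l := fun N => INR (2 * p N + 1)) in *.
  set (z := fun N => l N ^ 2 / INR N) in *.
  assert (Hl : forall N, 0 < l N) by (intros N; apply lt_0_INR; lia).
  assert (HPu : 0 < PI * u) by (apply Rmult_lt_0_compat; lra).
  apply (is_lim_seq_plus' (fun _ => 1)); [apply is_lim_seq_const|].
  apply (is_lim_seq_scal_l _ 2 (Finite _)).
  (* Padding with zeros turns the finite sums into series over a common index set. *)
  set (a := fun N h => if Nat.ltb h (p N) then cos (PI * INR (S h) / l N) ^ (2 * N) else 0).
  apply is_lim_seq_ext with (fun N => Series (a N)).
  { intros N; rewrite (Series_eq_psum _ (p N)).
    - apply psum_ext; intros i Hi; unfold a; destruct (Nat.ltb_spec i (p N)); [reflexivity|lia].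
    - intros n Hn; unfold a; destruct (Nat.ltb_spec n (p N)); [lia|reflexivity]. }
  assert (Ez : eventually (fun N => (1 <= N)%nat /\ PI * u / 2 < z N < 2 * (PI * u))).
  { apply is_lim_seq_spec in Hz; destruct (Hz (mkposreal (PI * u / 2) ltac:(lra))) as [N0 HN0].
    exists (S N0); intros N HN; split; [lia|].
    specialize (HN0 N ltac:(lia)); cbn [pos] in HN0; change (Rabs (z N - PI * u) < PI * u / 2) in HN0.
    apply Rabs_def2 in HN0; destruct HN0; split; lra. }
  assert (Ex : forall N h, (1 <= N)%nat -> INR N * (PI * INR (S h) / l N) ^ 2 = PI ^ 2 * INR (S h) ^ 2 / z N).
  { intros N h HN; assert (0 < INR N) by (apply lt_0_INR; lia); specialize (Hl N).
    unfold z; field; split; lra. }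
  assert (Hx : forall N h, (h < p N)%nat -> 0 <= PI * INR (S h) / l N <= 2).
  { intros N h Hh; assert (HS := pos_INR (S h)); split.
    - apply Rle_mult_inv_pos; [apply Rmult_le_pos; lra|auto].
    - apply (Rmult_le_reg_r (l N)); [auto|]; unfold Rdiv; rewrite Rmult_assoc, Rinv_l by (generalize (Hl
        N); lra).
      assert (INR (S h) <= l N / 2).
      { apply le_INR in Hh; unfold l; rewrite plus_INR, mult_INR; simpl (INR 2); simpl (INR 1); lra. }
      generalize PI_4; nra. }
  (* With [h] for [S h]: [N x ^ 2 = PI ^ 2 h ^ 2 / z], and eventually [z < 2 PI u]. Together with
     the [9] of [cos_power_dom] this gives [18 u]; then [h ^ 2 >= h] makes the majorant
     geometric. *)
  apply tannery with (b := fun h => exp (- (PI / (18 * u) * INR (S h)))).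
  - apply ex_series_geom_exp, Rdiv_lt_0_compat; lra.
  - destruct Ez as [N0 HN0]; exists N0; intros N HN h; destruct (HN0 N HN) as [H1 H2].
    unfold a; destruct (Nat.ltb_spec h (p N)) as [Hh|Hh]; [|split; [lra|apply exp_ge0]].
    destruct (cos_power_dom _ N (Hx N h Hh)) as [H3 H4]; split; [exact H3|].
    eapply Rle_trans; [exact H4|]; apply exp_le, Ropp_le_contravar.
    rewrite Ex by auto.
    assert (HS : 1 <= INR (S h)) by (rewrite S_INR; generalize (pos_INR h); lra).
    apply Rle_trans with (PI ^ 2 * INR (S h) ^ 2 / (2 * (PI * u)) / 9).
    + replace (PI ^ 2 * INR (S h) ^ 2 / (2 * (PI * u)) / 9) with (PI / (18 * u) * INR (S h) ^ 2) by (field;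
        lra).
      apply Rmult_le_compat_l; [left; apply Rdiv_lt_0_compat; lra|nra].
    + unfold Rdiv; apply Rmult_le_compat_r; [lra|]; apply Rmult_le_compat_l.
      * apply Rmult_le_pos; apply pow2_ge_0.
      * apply Rinv_le_contravar; lra.
  - intros h.
    assert (Hw : is_lim_seq (fun N => PI ^ 2 * INR (S h) ^ 2 / z N) (PI * INR (S h) ^ 2 * / u)).
    { replace (PI * INR (S h) ^ 2 * / u) with (PI ^ 2 * INR (S h) ^ 2 / (PI * u)) by (field; lra).
      apply is_lim_seq_div'; [apply is_lim_seq_const|exact Hz|lra]. }
    assert (Hx2 : is_lim_seq (fun N => (PI ^ 2 * INR (S h) ^ 2 / z N) * / INR N) 0).
    { replace (Finite 0) with (Finite (PI * INR (S h) ^ 2 * / u * 0)) by (f_equal; ring).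
      apply is_lim_seq_mult'; [exact Hw|apply is_lim_seq_inv_INR]. }
    set (w := fun N => PI ^ 2 * INR (S h) ^ 2 / z N) in *.
    set (x2 := fun N => w N * / INR N) in *.
    assert (Ev : eventually (fun N => (1 <= N)%nat /\ (h < p N)%nat /\ x2 N < 1)).
    { apply is_lim_seq_spec in Hx2; destruct (Hx2 (mkposreal 1 ltac:(lra))) as [N1 HN1].
      exists (S N1); intros N HN; specialize (HN1 N ltac:(lia)).
      cbn [pos] in HN1; change (Rabs (x2 N - 0) < 1) in HN1; rewrite Rminus_0_r in HN1.
      apply Rabs_def2 in HN1.
      assert (HNp : 0 < INR N) by (apply lt_0_INR; lia).
      split; [lia|split; [|lra]].
      assert (E : x2 N = (PI * INR (S h) / l N) ^ 2).
      { unfold x2, w; rewrite <- Ex by lia; field; split; [generalize (Hl N); lra|lra]. }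
      assert (Hlt : PI * INR (S h) < l N).
      { apply Rnot_le_lt; intros Hle.
        assert (1 <= PI * INR (S h) / l N).
        { apply (Rmult_le_reg_r (l N)); [auto|]; unfold Rdiv; rewrite Rmult_assoc, Rinv_l by (generalize
            (Hl N); lra); lra. }
        rewrite E in HN1; nra. }
      assert (Hlt2 : 2 * INR (S h) < l N).
      { generalize PI2_1 (pos_INR (S h)); intros; nra. }
      unfold l in Hlt2; replace 2 with (INR 2) in Hlt2 by reflexivity.
      rewrite <- mult_INR in Hlt2; apply INR_lt in Hlt2; lia. }
    (* [x2] is the square of the angle and tends to zero, while [w], which is [N * x2], converges;
       so the two bounds have the same limit. *)
    apply is_lim_seq_le_le_loc with
      (u := fun N => exp (- (w N / (1 - x2 N)))) (w := fun N => exp (- (w N * (1 - x2 N / 6) ^ 2))).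
    + destruct Ev as [N1 HN1]; exists N1; intros N HN; destruct (HN1 N HN) as [H1 [H2 H3]].
      unfold a; destruct (Nat.ltb_spec h (p N)); [|lia].
      assert (HNp : 0 < INR N) by (apply lt_0_INR; lia).
      assert (E : x2 N = (PI * INR (S h) / l N) ^ 2).
      { unfold x2, w; rewrite <- Ex by lia; field; split; [generalize (Hl N); lra|lra]. }
      unfold w; rewrite <- Ex, E by lia.
      apply cos_power_bounds; [auto|].
      rewrite E in H3; generalize (Hx N h H2); nra.
    + replace (exp (- (PI * INR (S h) ^ 2 * / u))) with (exp (- (PI * INR (S h) ^ 2 * / u / (1 - 0))))
        by (f_equal; field; lra).
      apply is_lim_seq_exp, is_lim_seq_opp_finite.
      apply is_lim_seq_div'; [exact Hw| |lra].
      apply is_lim_seq_minus'; [apply is_lim_seq_const|exact Hx2].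
    + replace (exp (- (PI * INR (S h) ^ 2 * / u))) with (exp (- (PI * INR (S h) ^ 2 * / u * ((1 - 0 / 6) *
        ((1 - 0 / 6) * 1)))))
        by (f_equal; field; lra).
      apply is_lim_seq_exp, is_lim_seq_opp_finite.
      assert (H6 : is_lim_seq (fun N => 1 - x2 N / 6) (1 - 0 / 6)).
      { apply is_lim_seq_minus'; [apply is_lim_seq_const|].
        apply is_lim_seq_div'; [exact Hx2|apply is_lim_seq_const|lra]. }
      apply is_lim_seq_mult'; [exact Hw|]; simpl.
      apply is_lim_seq_mult'; [exact H6|]; apply is_lim_seq_mult'; [exact H6|apply is_lim_seq_const].
Qed.

Lemma is_lim_seq_sqrt (v : nat -> R) (l : R) : 0 <= l -> is_lim_seq v l -> is_lim_seq (fun n => sqrt (v n))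
    (sqrt l).
Proof. intros Hl H; apply is_lim_seq_continuous; [apply continuity_pt_sqrt, Hl|exact H]. Qed.

Lemma binomial_side_limit (u : R) (p : nat -> nat) : 0 < u ->
  is_lim_seq (fun N => INR (2 * p N + 1) ^ 2 / INR N) (PI * u) ->
  is_lim_seq (fun N => 1 + 2 * psum (fun n => rho N (S n * (2 * p N + 1))) N) (theta u).
Proof.
  intros Hu Hz; assert (HP := PI_RGT_0).
  set (z := fun N => INR (2 * p N + 1) ^ 2 / INR N) in *.
  assert (HPu : 0 < PI * u) by (apply Rmult_lt_0_compat; lra).
  apply (is_lim_seq_plus' (fun _ => 1)); [apply is_lim_seq_const|].
  apply (is_lim_seq_scal_l _ 2 (Finite _)).
  set (r := fun N n => (S n * (2 * p N + 1))%nat).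
  set (a := fun N n => rho N (r N n)).
  apply is_lim_seq_ext with (fun N => Series (a N)).
  { intros N; rewrite (Series_eq_psum _ N); [reflexivity|].
    intros n Hn; unfold a, rho, r; destruct (Nat.leb_spec (S n * (2 * p N + 1)) N); [nia|reflexivity]. }
  assert (Er : forall N n, (1 <= N)%nat -> INR (r N n) ^ 2 = INR (S n) ^ 2 * z N * INR N).
  { intros N n HN; assert (0 < INR N) by (apply lt_0_INR; lia).
    unfold z, r; rewrite mult_INR; field; lra. }
  assert (Hrho : forall N n, (1 <= N)%nat -> (r N n <= N)%nat -> 0 <= a N n <= exp (- (INR (r N n) ^ 2 /
      INR (N + r N n)))).
  { intros N n HN Hr; destruct (rho_bounds N (r N n) (r N n) Hr (Nat.le_refl _)) as [H1 H2].
    split; [eapply Rle_trans; [apply exp_ge0|exact H1]|exact H2]. }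
  (* For [r <= N], [r ^ 2 / (N + r) >= r ^ 2 / (2 N) = (n + 1) ^ 2 z / 2], and eventually
     [z > PI u / 2]. *)
  apply tannery with (b := fun n => exp (- (PI * u / 4 * INR (S n)))).
  - apply ex_series_geom_exp; lra.
  - apply is_lim_seq_spec in Hz; destruct (Hz (mkposreal (PI * u / 2) ltac:(lra))) as [N0 HN0].
    exists (S N0); intros N HN n.
    specialize (HN0 N ltac:(lia)); cbn [pos] in HN0; change (Rabs (z N - PI * u) < PI * u / 2) in HN0.
    apply Rabs_def2 in HN0; destruct HN0 as [_ HN0].
    assert (HNp : 0 < INR N) by (apply lt_0_INR; lia).
    destruct (Nat.le_gt_cases (r N n) N) as [Hr|Hr].
    + destruct (Hrho N n ltac:(lia) Hr) as [H1 H2]; split; [exact H1|].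
      eapply Rle_trans; [exact H2|]; apply exp_le, Ropp_le_contravar.
      assert (HS : 1 <= INR (S n)) by (rewrite S_INR; generalize (pos_INR n); lra).
      apply Rle_trans with (INR (r N n) ^ 2 / (2 * INR N)).
      * rewrite Er by lia.
        replace (INR (S n) ^ 2 * z N * INR N / (2 * INR N)) with (INR (S n) ^ 2 * (z N / 2)) by (field; lra).
        rewrite (Rmult_comm (PI * u / 4)); apply Rmult_le_compat; try lra; nra.
      * unfold Rdiv; apply Rmult_le_compat_l; [apply pow2_ge_0|].
        apply Rinv_le_contravar; [rewrite plus_INR; generalize (pos_INR (r N n)); lra|].
        apply le_INR in Hr; rewrite plus_INR; lra.
    + unfold a, rho; destruct (Nat.leb_spec (r N n) N); [lia|].
      split; [lra|apply exp_ge0].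
  - intros n.
    set (w := fun N => INR (S n) ^ 2 * z N).
    assert (Hw : is_lim_seq w (PI * INR (S n) ^ 2 * u)).
    { replace (PI * INR (S n) ^ 2 * u) with (INR (S n) ^ 2 * (PI * u)) by ring.
      apply (is_lim_seq_scal_l z (INR (S n) ^ 2) (Finite _)), Hz. }
    (* [t] is the ratio [r / N], written as a root so that its limit follows from that of [w]. *)
    set (t := fun N => sqrt (w N * / INR N)).
    assert (Ht : is_lim_seq t 0).
    { rewrite <- sqrt_0; apply is_lim_seq_sqrt; [lra|].
      replace (Finite 0) with (Finite (PI * INR (S n) ^ 2 * u * 0)) by (f_equal; ring).
      apply is_lim_seq_mult'; [exact Hw|apply is_lim_seq_inv_INR]. }
    assert (Et : forall N, (1 <= N)%nat -> INR (r N n) = t N * INR N).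
    { intros N HN; assert (0 < INR N) by (apply lt_0_INR; lia).
      replace (t N) with (INR (r N n) / INR N); [field; lra|].
      unfold t, w; replace (INR (S n) ^ 2 * z N * / INR N) with ((INR (r N n) / INR N) ^ 2).
      - symmetry; apply sqrt_pow2, Rle_mult_inv_pos; [apply pos_INR|lra].
      - unfold Rdiv; rewrite Rpow_mult_distr, Er by lia; field; lra. }
    assert (Ev : eventually (fun N => (1 <= N)%nat /\ (r N n <= N)%nat)).
    { apply is_lim_seq_spec in Ht; destruct (Ht (mkposreal 1 ltac:(lra))) as [N1 HN1].
      exists (S N1); intros N HN; specialize (HN1 N ltac:(lia)).
      cbn [pos] in HN1; change (Rabs (t N - 0) < 1) in HN1; apply Rabs_def2 in HN1.
      split; [lia|].
      apply INR_le; rewrite Et by lia; generalize (pos_INR N); nra. }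
    apply is_lim_seq_le_le_loc with
      (u := fun N => exp (- (w N / (1 - t N + / INR N)))) (w := fun N => exp (- (w N / (1 + t N)))).
    + destruct Ev as [N1 HN1]; exists N1; intros N HN; destruct (HN1 N HN) as [H1 H2].
      assert (HNp : 0 < INR N) by (apply lt_0_INR; lia).
      assert (Hr0 : 0 < INR (r N n)) by (apply lt_0_INR; unfold r; lia).
      assert (Hr1 : INR (r N n) <= INR N) by (apply le_INR, H2).
      destruct (rho_bounds N (r N n) (r N n) H2 (Nat.le_refl _)) as [H3 H4].
      rewrite plus_INR, minus_INR in H3 by lia; rewrite plus_INR in H4; simpl (INR 1) in H3.
      rewrite Er in H3, H4 by lia; rewrite Et in H3, H4, Hr0, Hr1 by lia.
      fold (w N) in H3, H4.
      assert (Q : 0 < INR N - t N * INR N + 1) by lra.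
      assert (Q' : 0 < t N) by (apply (Rmult_lt_reg_r (INR N)); lra).
      assert (Ed : INR N - t N * INR N + 1 = INR N * (1 - t N + / INR N)) by (field; lra).
      assert (D : 0 < 1 - t N + / INR N) by (apply (Rmult_lt_reg_l (INR N)); lra).
      rewrite Ed in H3.
      assert (Ed' : INR N + t N * INR N = INR N * (1 + t N)) by ring.
      rewrite Ed' in H4.
      split; [eapply Rle_trans; [|exact H3]|eapply Rle_trans; [exact H4|]]; right; do 2 f_equal.
      * set (d := 1 - t N + / INR N) in *; field; lra.
      * field; lra.
    + replace (exp (- (PI * INR (S n) ^ 2 * u))) with (exp (- (PI * INR (S n) ^ 2 * u / (1 - 0 + 0))))
        by (f_equal; field; lra).
      apply is_lim_seq_exp, is_lim_seq_opp_finite.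
      apply is_lim_seq_div'; [exact Hw| |lra].
      apply is_lim_seq_plus'; [|apply is_lim_seq_inv_INR].
      apply is_lim_seq_minus'; [apply is_lim_seq_const|exact Ht].
    + replace (exp (- (PI * INR (S n) ^ 2 * u))) with (exp (- (PI * INR (S n) ^ 2 * u / (1 + 0))))
        by (f_equal; field; lra).
      apply is_lim_seq_exp, is_lim_seq_opp_finite.
      apply is_lim_seq_div'; [exact Hw| |lra].
      apply is_lim_seq_plus'; [apply is_lim_seq_const|exact Ht].
Qed.

Lemma ex_series_theta (u : R) : 0 < u -> ex_series (fun n => exp (- (PI * INR (S n) ^ 2 * u))).
Proof.
  intros Hu; assert (HP := PI_RGT_0).
  apply ex_series_le_pos with (b := fun n => exp (- (PI * u * INR (S n)))).
  - intros n; split; [apply exp_ge0|apply exp_le].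
    assert (1 <= INR (S n)) by (rewrite S_INR; generalize (pos_INR n); lra).
    assert (0 < PI * u) by (apply Rmult_lt_0_compat; lra).
    replace (PI * INR (S n) ^ 2 * u) with (PI * u * INR (S n) ^ 2) by ring.
    apply Ropp_le_contravar, Rmult_le_compat_l; nra.
  - apply ex_series_geom_exp, Rmult_lt_0_compat; lra.
Qed.

Lemma theta_ge_1 (u : R) : 0 < u -> 1 <= theta u.
Proof.
  intros Hu; unfold theta.
  assert (0 <= Series (fun n => exp (- (PI * INR (S n) ^ 2 * u)))); [|lra].
  eapply Rle_trans; [|apply (sum_n_le_Series _ 0)].
  - rewrite sum_O; apply exp_ge0.
  - intros; apply exp_ge0.
  - apply ex_series_theta, Hu.
Qed.

Lemma ex_odd_sequence (u : R) : 0 < u -> exists p : nat -> nat,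
  is_lim_seq (fun N => INR (2 * p N + 1) / sqrt (INR N)) (sqrt (PI * u)).
Proof.
  intros Hu; assert (HP := PI_RGT_0).
  assert (HPu : 0 < PI * u) by (apply Rmult_lt_0_compat; lra).
  assert (Hs : forall N, 0 <= sqrt (PI * u) * sqrt (INR N) / 2).
  { intros N; assert (0 <= sqrt (PI * u) * sqrt (INR N)); [|lra].
    apply Rmult_le_pos; apply sqrt_pos. }
  (* With [p] the integer part of [sqrt (PI u N) / 2], the odd number [2 p + 1] differs from
     [sqrt (PI u N)] by at most one. *)
  exists (fun N => proj1_sig (nfloor_ex _ (Hs N))).
  assert (H1 : is_lim_seq (fun N => sqrt (/ INR N)) 0).
  { rewrite <- sqrt_0; apply is_lim_seq_sqrt; [lra|apply is_lim_seq_inv_INR]. }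
  apply is_lim_seq_le_le_loc with
    (u := fun N => sqrt (PI * u) - sqrt (/ INR N)) (w := fun N => sqrt (PI * u) + sqrt (/ INR N)).
  - exists 1%nat; intros N HN.
    destruct (nfloor_ex _ (Hs N)) as [q [Hq1 Hq2]]; simpl proj1_sig.
    assert (HN' : 0 < sqrt (INR N)) by (apply sqrt_lt_R0, lt_0_INR; lia).
    rewrite sqrt_inv.
    rewrite plus_INR, mult_INR; simpl (INR 2); simpl (INR 1).
    assert (E : sqrt (PI * u) * sqrt (INR N) / sqrt (INR N) = sqrt (PI * u)) by (field; lra).
    rewrite <- E.
    assert (Hi : 0 < / sqrt (INR N)) by (apply Rinv_0_lt_compat, HN').
    unfold Rdiv in *; split; nra.
  - replace (sqrt (PI * u)) with (sqrt (PI * u) - 0) by ring.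
    apply is_lim_seq_minus'; [|exact H1]; rewrite Rminus_0_r; apply is_lim_seq_const.
  - replace (Finite (sqrt (PI * u))) with (Finite (sqrt (PI * u) + 0)) by (f_equal; ring).
    apply is_lim_seq_plus'; [apply is_lim_seq_const|exact H1].
Qed.

(* Polya: [cos_power_sum] at exponent [N] for the two lengths [l ~ sqrt (PI u N)] and
   [l' ~ sqrt (PI N)]; dividing the two limits removes the central binomial coefficient. *)
Theorem theta_inversion (u : R) : 0 < u -> theta (/ u) = sqrt u * theta u.
Proof.
  intros Hu; assert (HP := PI_RGT_0).
  assert (Hsq : forall p v, 0 < v ->
    is_lim_seq (fun N => INR (2 * p N + 1) / sqrt (INR N)) (sqrt (PI * v)) ->
    is_lim_seq (fun N => INR (2 * p N + 1) ^ 2 / INR N) (PI * v)).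
  { intros p v Hv Hp.
    apply is_lim_seq_ext_loc with (fun N => INR (2 * p N + 1) / sqrt (INR N) * (INR (2 * p N + 1) / sqrt
        (INR N))).
    - exists 1%nat; intros N HN.
      assert (HN0 : 0 < INR N) by (apply lt_0_INR; lia).
      rewrite <- (sqrt_sqrt (INR N)) at 3 by lra.
      assert (0 < sqrt (INR N)) by (apply sqrt_lt_R0, HN0); field; lra.
    - rewrite <- (sqrt_sqrt (PI * v)) by (apply Rmult_le_pos; lra).
      apply is_lim_seq_mult'; exact Hp. }
  destruct (ex_odd_sequence u Hu) as [p Hp]; destruct (ex_odd_sequence 1 Rlt_0_1) as [p1 Hp1].
  generalize (cos_side_limit u p Hu (Hsq p u Hu Hp)) (binomial_side_limit u p Hu (Hsq p u Hu Hp)).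
  generalize (cos_side_limit 1 p1 Rlt_0_1 (Hsq p1 1 Rlt_0_1 Hp1)) (binomial_side_limit 1 p1 Rlt_0_1 (Hsq p1
      1 Rlt_0_1 Hp1)).
  rewrite Rinv_1; intros HL1 HR1 HL HR.
  (* Cross-multiplied form of the quotient: at each [N] both products contain the same central
     coefficient and both lengths, so they agree before the limit. *)
  assert (E : theta (/ u) * theta 1 * sqrt (PI * 1) = theta 1 * theta u * sqrt (PI * u)).
  { generalize (is_lim_seq_mult' _ _ _ _ (is_lim_seq_mult' _ _ _ _ HL HR1) Hp1).
    generalize (is_lim_seq_mult' _ _ _ _ (is_lim_seq_mult' _ _ _ _ HL1 HR) Hp); intros H1 H2.
    apply is_lim_seq_unique in H1; apply is_lim_seq_unique in H2.
    apply (f_equal real) in H1; apply (f_equal real) in H2; cbn [real] in H1, H2.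
    rewrite <- H1, <- H2; f_equal; apply Lim_seq_ext; intros N.
    rewrite !cos_power_sum.
    unfold Rdiv; ring. }
  rewrite Rmult_1_r, sqrt_mult in E by lra.
  assert (Ht := theta_ge_1 1 Rlt_0_1).
  assert (0 < sqrt PI) by (apply sqrt_lt_R0; lra).
  apply (Rmult_eq_reg_r (theta 1 * sqrt PI)); [|nra].
  rewrite <- Rmult_assoc, E; ring.
Qed.

(** * Sums over boxes of lattice points *)

Module BoxSums.
Import ssreflect ssrfun ssrbool eqtype ssrnat seq choice fintype finfun bigop finset zify.
Import Monoid.
Set Implicit Arguments.
Unset Strict Implicit.

#[local] HB.instance Definition _ := isComLaw.Build R 0 Rplus
  (fun x y z => esym (Rplus_assoc x y z)) Rplus_comm Rplus_0_l.
#[local] HB.instance Definition _ := isComLaw.Build R 1 Rmult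
  (fun x y z => esym (Rmult_assoc x y z)) Rmult_comm Rmult_1_l.
#[local] HB.instance Definition _ := isMulLaw.Build R 0 Rmult Rmult_0_l Rmult_0_r.
#[local] HB.instance Definition _ := isAddLaw.Build R Rmult Rplus
  Rmult_plus_distr_r Rmult_plus_distr_l.

(** [r] counts in a box that grows with [n], while a partial product [PhiN] uses one box for all
    norms; this count mediates between them. *)
Definition box_count (j N n : nat) : nat :=
  #|[set f : {ffun 'I_j -> 'I_(2*N+1)} | sqnorm f == n]|.

Lemma leq_card_inj (T U : finType) (A : {set T}) (B : {set U}) (h : T -> U) :
  {in A &, injective h} -> {in A, forall x, h x \in B} -> (#|A| <= #|B|)%N.
Proof.
move=> hi hs; rewrite -(card_in_imset hi); apply: subset_leq_card.
by apply/subsetP => _ /imsetP[x xA ->]; apply: hs.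
Qed.

Lemma sqnorm_coord j N (f : {ffun 'I_j -> 'I_(2*N+1)}) i : ((natdist (f i) N) ^ 2 <= sqnorm f)%N.
Proof. by rewrite /sqnorm (bigD1 i) //= leq_addr. Qed.

Lemma box_count_mono j N M n : (N <= M)%N -> (box_count j N n <= box_count j M n)%N.
Proof.
move=> NM.
have lt (f : {ffun 'I_j -> 'I_(2*N+1)}) i : (f i + (M - N) < 2 * M + 1)%N.
  by have := ltn_ord (f i); lia.
apply: (@leq_card_inj _ _ _ _ (fun f => [ffun i => Ordinal (lt f i)])).
  move=> f g _ _ /ffunP e; apply/ffunP => i; apply/val_inj.
  by have := congr1 val (e i); rewrite !ffunE /=; lia.
move=> f; rewrite !inE => /eqP <-; apply/eqP; rewrite /sqnorm.
by apply: eq_bigr => i _; rewrite ffunE /natdist /=; congr (_ ^ _)%N; lia.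
Qed.

(** Since [d <= d ^ 2] for naturals, the coordinates of a point of squared norm [n] are at most [n]
    in absolute value, so every box of size at least [n] contains all solutions. *)
Lemma box_count_stable j N M n : (N <= M)%N -> (n <= N)%N -> box_count j M n = box_count j N n.
Proof.
move=> NM nN; apply/eqP; rewrite eqn_leq (box_count_mono _ _ NM) andbT.
have P : (0 < 2 * N + 1)%N by lia.
(* Recentring from the large box to the small one; on solutions [bd] keeps the value in range, so
   [insubd] does not fall back on its default. *)
pose h (f : {ffun 'I_j -> 'I_(2*M+1)}) : {ffun 'I_j -> 'I_(2*N+1)} :=
  [ffun i => insubd (Ordinal P) (f i - (M - N))%N].
have bd (f : {ffun 'I_j -> 'I_(2*M+1)}) i : sqnorm f = n -> (M - N <= f i <= M + N)%N.
  move=> e; have := sqnorm_coord f i; rewrite e => le1.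
  have : (natdist (f i) M <= N)%N.
    apply: (leq_trans _ nN); apply: (leq_trans _ le1).
    by case: (natdist _ _) => // d; rewrite expnS expn1; nia.
  by rewrite /natdist; lia.
have hE f i : sqnorm f = n -> h f i = (f i - (M - N))%N :> nat.
  move=> e; rewrite ffunE insubdK // /in_mem /=.
  by have := bd f i e; lia.
apply: (@leq_card_inj _ _ _ _ h).
  move=> f g; rewrite !inE => /eqP ef /eqP eg e; apply/ffunP => i; apply/val_inj => /=.
  have := hE f i ef; rewrite e hE //.
  by have := bd f i ef; have := bd g i eg; lia.
move=> f; rewrite !inE => /eqP e; apply/eqP; rewrite -[RHS]e /sqnorm.
apply: eq_bigr => i _; rewrite hE // /natdist.
by have := bd f i e => b; congr (_ ^ _)%N; lia.
Qed.

Lemma box_count_r j N n : (n <= N)%N -> box_count j N n = r j n.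
Proof. by move=> nN; rewrite (@box_count_stable j n N n). Qed.

Lemma box_count_le_r j N n : (box_count j N n <= r j n)%N.
Proof.
case: (leqP n N) => [nN|Nn]; first by rewrite box_count_r.
by rewrite (leq_trans (box_count_mono _ _ (ltnW Nn))).
Qed.

Lemma r_zero j : r j 0 = 1%N.
Proof.
have P : (0 < 2 * 0 + 1)%N by [].
rewrite /r (_ : [set _ | _] = [set: {ffun 'I_j -> 'I_(2*0+1)}]).
  by rewrite cardsT card_ffun !card_ord exp1n.
apply/setP => f; rewrite !inE; apply/eqP; rewrite /sqnorm big1 // => i _.
by rewrite (_ : nat_of_ord (f i) = 0%N) //; have := ltn_ord (f i); lia.
Qed.

Lemma big_ord_psum (K : nat) (F : nat -> R) : \big[Rplus/0]_(i < K) F i = psum F K.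
Proof. by elim: K => [|K IH]; rewrite ?big_ord0 // big_ord_recr /= IH. Qed.

Lemma box_sum_count j N (g : nat -> R) (K : nat) : (j * N ^ 2 < K)%N ->
  \big[Rplus/0]_(f : {ffun 'I_j -> 'I_(2*N+1)}) g (sqnorm f)
  = psum (fun n => INR (box_count j N n) * g n) K.
Proof.
move=> jK.
have bd (f : {ffun 'I_j -> 'I_(2*N+1)}) : (sqnorm f < K)%N.
  apply: leq_ltn_trans jK; rewrite /sqnorm.
  apply: (@leq_trans (\sum_(i < j) N ^ 2)).
    apply: leq_sum => i _; rewrite leq_exp2r // /natdist.
    by have := ltn_ord (f i); lia.
  by rewrite sum_nat_const card_ord.
rewrite -big_ord_psum.
transitivity (\big[Rplus/0]_(f : {ffun 'I_j -> 'I_(2*N+1)}) \big[Rplus/0]_(i < K)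
    (if sqnorm f == i then g i else 0)).
  apply: eq_bigr => f _.
  rewrite (bigD1 (Ordinal (bd f))) //= eqxx big1 ?Rplus_0_r // => i ne.
  by case: eqP => // e; case/eqP: ne; apply/val_inj.
rewrite exchange_big /=; apply: eq_bigr => i _.
rewrite -big_mkcond /= big_const /box_count cardsE.
have -> : #|[pred f : {ffun 'I_j -> 'I_(2*N+1)} | sqnorm f == i]|
        = #|(fun f : {ffun 'I_j -> 'I_(2*N+1)} => sqnorm f == i)| by [].
elim: #|_| => [|m IH]; first by rewrite /= Rmult_0_l.
by rewrite iterS IH S_INR; ring.
Qed.

(** [q ^ sqnorm f] is a product over the coordinates, so distributivity factors the sum over the
    box. *)
Lemma box_power_sum j N (q : R) :
  \big[Rplus/0]_(f : {ffun 'I_j -> 'I_(2*N+1)}) (q ^ sqnorm f)%R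
  = (1 + 2 * psum (fun n => (q ^ (S n * S n)%coq_nat)%R) N) ^ j.
Proof.
have -> : (1 + 2 * psum (fun n => (q ^ (S n * S n)%coq_nat)%R) N)
   = \big[Rplus/0]_(a < 2 * N + 1) (q ^ (natdist a N ^ 2))%R.
  rewrite (big_ord_psum _ (fun a => (q ^ (natdist a N ^ 2))%R)).
  have -> : (2 * N + 1)%N = S (2 * N)%coq_nat by lia.
  rewrite psum_center; congr (_ + _).
    by rewrite /natdist subnn.
  rewrite -psum_scal; apply: psum_ext => i iN.
  have -> : natdist (N + i.+1)%coq_nat N = i.+1 by rewrite /natdist; lia.
  have -> : natdist (N - i.+1)%coq_nat N = i.+1 by rewrite /natdist; lia.
  have -> : (i.+1 ^ 2)%N = (i.+1 * i.+1)%coq_nat by lia.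
  ring.
transitivity (\big[Rmult/1]_(i < j) \big[Rplus/0]_(a < 2 * N + 1) (q ^ (natdist a N ^ 2))%R).
  rewrite bigA_distr_bigA /=; apply: eq_bigr => f _; rewrite /sqnorm.
  by apply: (big_morph (fun n => (q ^ n)%R)) => // m n; rewrite -pow_add.
rewrite big_const card_ord; elim: j => //= m ->; reflexivity.
Qed.

(** For positive [n], [g n] is minus the logarithm of a factor; the value [g 0 = 0] encodes the
    exclusion of the origin, so the restricted product becomes a sum over the full box. *)
Lemma PhiN_box_sum k N (g : nat -> R) : g 0%N = 0 ->
  (forall n, (0 < n)%N -> exp (- g n) = 1 - exp (- (2 * PI * sqrt (INR n)))) ->
  PhiN k N = exp (- \big[Rplus/0]_(f : {ffun 'I_(k.-1) -> 'I_(2*N+1)}) g (sqnorm f)).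
Proof.
move=> g0 gn; rewrite /PhiN.
rewrite (big_morph (fun x => exp (- x)) (id1 := 1) (op1 := Rmult)); first last.
- by rewrite Ropp_0 exp_0.
- by move=> x y; rewrite Ropp_plus_distr exp_plus.
rewrite big_mkcond; apply: eq_bigr => f _.
case: ifPn => [/existsP[i ne]|].
  rewrite gn //; have := sqnorm_coord f i; apply: leq_trans.
  rewrite expn_gt0 orbF.
  by move: ne; rewrite /natdist; case: eqP => // ne _; lia.
rewrite negb_exists => /forallP all0.
rewrite (_ : sqnorm f = 0%N) ?g0 ?Ropp_0 ?exp_0 //.
rewrite /sqnorm big1 // => i _; have := all0 i; rewrite negbK => /eqP ->.
by rewrite /natdist subnn.
Qed.

Definition box_sum (j : nat) (g : nat -> R) (N : nat) : R :=
  \big[Rplus/0]_(f : {ffun 'I_j -> 'I_(2*N+1)}) g (sqnorm f).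

(** Up to norm [N] the box count equals [r], above it is at most [r]: for nonnegative [g], box sums
    and partial sums of the series interleave. *)
Lemma box_sum_bounds j N (g : nat -> R) : (forall n, 0 <= g n) ->
  exists K, psum (fun n => INR (r j n) * g n) (S N) <= box_sum j g N
    <= psum (fun n => INR (r j n) * g n) K.
Proof.
move=> g0.
have le (u v : nat -> R) m : (forall n, u n <= v n) -> psum u m <= psum v m.
  by move=> uv; elim: m => [|m IH] /=; [exact: Rle_refl|exact: Rplus_le_compat].
exists (j * N ^ 2 + N.+2)%N; rewrite /box_sum.
rewrite (@box_sum_count j N g (j * N ^ 2 + N.+2)); last by lia.
split.
  have -> : (j * N ^ 2 + N.+2)%N = (N.+1 + (j * N ^ 2 + 1))%coq_nat by lia.
  rewrite psum_add (psum_ext (fun n => INR (box_count j N n) * g n) (fun n => INR (r j n) * g n)).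
    rewrite -[X in X <= _]Rplus_0_r; apply: Rplus_le_compat_l.
    elim: (j * N ^ 2 + 1)%N => [|m IH] /=; first exact: Rle_refl.
    by apply: Rplus_le_le_0_compat => //; apply: Rmult_le_pos => //; apply: pos_INR.
  by move=> i iN; rewrite box_count_r //; lia.
apply: le => n; apply: Rmult_le_compat_r => //; apply: le_INR; apply/leP.
exact: box_count_le_r.
Qed.

Lemma box_sum_pow j N (q : R) :
  box_sum j (fun n => (q ^ n)%R) N = (1 + 2 * psum (fun n => (q ^ (S n * S n)%coq_nat)%R) N) ^ j.
Proof. exact: box_power_sum. Qed.

Lemma PhiN_exp k N (g : nat -> R) : g 0%N = 0 ->
  (forall n, (0 < n)%coq_nat -> exp (- g n) = 1 - exp (- (2 * PI * sqrt (INR n)))) ->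
  PhiN k N = exp (- box_sum (k - 1)%coq_nat g N).
Proof.
move=> g0 gn; rewrite (@PhiN_box_sum k N g) //; first by rewrite /box_sum -subn1.
by move=> n /ltP; apply: gn.
Qed.

End BoxSums.

Definition box_sum := BoxSums.box_sum.

Lemma r_zero_r (j : nat) : r j 0 = 1%nat.
Proof. apply BoxSums.r_zero. Qed.

Lemma is_series_psum (u : nat -> R) (l : R) : is_series u l <-> is_lim_seq (psum u) l.
Proof.
  split; intros H.
  - apply is_lim_seq_incr_1; apply is_lim_seq_ext with (sum_n u); [|exact H].
    intros n; symmetry; apply psum_sum_n.
  - change (is_lim_seq (sum_n u) l).
    apply is_lim_seq_ext with (fun n => psum u (S n)); [intros n; apply psum_sum_n|].
    apply is_lim_seq_incr_1 in H; exact H.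
Qed.

Lemma psum_le_series (u : nat -> R) (l : R) (K : nat) : (forall n, 0 <= u n) -> is_series u l -> psum u K <= l.
Proof.
  intros H Hs; rewrite <- (is_series_unique _ _ Hs).
  apply Rle_trans with (psum u (S K)); [simpl; generalize (H K); lra|].
  rewrite psum_sum_n; apply sum_n_le_Series; [exact H|exists l; exact Hs].
Qed.

Lemma is_series_of_box_limit (j : nat) (g : nat -> R) (l : R) : (forall n, 0 <= g n) ->
  is_lim_seq (box_sum j g) l -> is_series (fun n => INR (r j n) * g n) l.
Proof.
  intros Hg Hl; set (u := fun n => INR (r j n) * g n).
  assert (Hu : forall n, 0 <= u n) by (intros n; apply Rmult_le_pos; [apply pos_INR|apply Hg]).
  assert (Hm : forall n m, (n <= m)%nat -> psum u n <= psum u m).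
  { intros n m H; induction H; [lra|simpl; generalize (Hu m); lra]. }
  apply is_series_sup; [exact Hu| |].
  - intros N.
    apply (is_lim_seq_le_loc (fun _ => sum_n u N) (box_sum j g) (sum_n u N) l);
      [|apply is_lim_seq_const|exact Hl].
    exists N; intros M HM; destruct (@BoxSums.box_sum_bounds j M g Hg) as [K [H1 _]].
    rewrite <- psum_sum_n; eapply Rle_trans; [apply (Hm (S N) (S M)); lia|exact H1].
  - intros eps He; apply is_lim_seq_spec in Hl.
    destruct (Hl (mkposreal eps He)) as [N HN]; specialize (HN N (Nat.le_refl _)); cbn [pos] in HN.
    apply Rabs_def2 in HN.
    destruct (@BoxSums.box_sum_bounds j N g Hg) as [K [_ H2]].
    exists K; rewrite <- psum_sum_n.
    assert (psum u K <= psum u (S K)) by (apply Hm; lia).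
    unfold box_sum in *; fold u in H2; lra.
Qed.

Lemma is_lim_box_of_series (j : nat) (g : nat -> R) (l : R) : (forall n, 0 <= g n) ->
  is_series (fun n => INR (r j n) * g n) l -> is_lim_seq (box_sum j g) l.
Proof.
  intros Hg Hl; set (u := fun n => INR (r j n) * g n) in *.
  assert (Hu : forall n, 0 <= u n) by (intros n; apply Rmult_le_pos; [apply pos_INR|apply Hg]).
  apply is_lim_seq_le_le with (u := fun N => psum u (S N)) (w := fun _ => l).
  - intros N; destruct (@BoxSums.box_sum_bounds j N g Hg) as [K [H1 H2]]; split; [exact H1|].
    eapply Rle_trans; [exact H2|]; apply psum_le_series; auto.
  - apply is_series_psum in Hl; apply is_lim_seq_incr_1 in Hl; exact Hl.
  - apply is_lim_seq_const.
Qed.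

Lemma exp_pow (x : R) (n : nat) : exp x ^ n = exp (INR n * x).
Proof.
  induction n as [|n IH]; [simpl; rewrite Rmult_0_l, exp_0; reflexivity|].
  rewrite S_INR; simpl; rewrite IH, <- exp_plus; f_equal; ring.
Qed.

Lemma is_series_r_theta (j : nat) (u : R) : 0 < u ->
  is_series (fun n => INR (r j n) * exp (- (PI * INR n * u))) (theta u ^ j).
Proof.
  intros Hu; set (q := exp (- (PI * u))).
  assert (Hq : 0 < q) by apply exp_pos.
  apply is_series_ext with (fun n => INR (r j n) * q ^ n).
  { intros n; unfold q; rewrite exp_pow; do 2 f_equal; ring. }
  apply is_series_of_box_limit; [intros n; left; apply pow_lt, Hq|].
  apply is_lim_seq_ext with (fun N => (1 + 2 * psum (fun n => q ^ (S n * S n)) N) ^ j).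
  { intros N; symmetry; apply (@BoxSums.box_sum_pow j). }
  assert (H : is_lim_seq (fun N => 1 + 2 * psum (fun n => q ^ (S n * S n)) N) (theta u)).
  { apply is_lim_seq_plus'; [apply is_lim_seq_const|].
    apply (is_lim_seq_scal_l _ 2 (Finite _)), is_series_psum.
    apply is_series_ext with (fun n => exp (- (PI * INR (S n) ^ 2 * u))).
    - intros n; unfold q; rewrite exp_pow, mult_INR; f_equal; ring.
    - apply Series_correct, ex_series_theta, Hu. }
  induction j as [|j IH]; simpl; [apply is_lim_seq_const|apply is_lim_seq_mult'; auto].
Qed.

Lemma Phi_eq_exp (k : nat) (g : nat -> R) (l : R) : g 0%nat = 0 -> (forall n, 0 <= g n) ->
  (forall n, (0 < n)%nat -> exp (- g n) = 1 - exp (- (2 * PI * sqrt (INR n)))) ->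
  is_series (fun n => INR (r (k - 1) n) * g n) l -> Phi k = exp (- l).
Proof.
  intros H0 Hg Hn Hl; unfold Phi.
  assert (H : is_lim_seq (PhiN k) (exp (- l))).
  { apply is_lim_seq_ext with (fun N => exp (- box_sum (k - 1) g N)).
    - intros N; symmetry; apply BoxSums.PhiN_exp; auto.
    - apply is_lim_seq_exp, is_lim_seq_opp_finite, is_lim_box_of_series; auto. }
  rewrite (is_lim_seq_unique _ _ H); reflexivity.
Qed.

(** * The Gamma function *)

Lemma lim2_exp_both (C d : R) : 0 < d -> lim2 (fun A B => C * exp (- d * A) + C * exp (- d * B)) 0.
Proof.
  intros Hd; replace 0 with (C * 0 + C * 0) by ring.
  apply (lim2_plus (fun A _ => C * exp (- d * A)) (fun _ B => C * exp (- d * B))).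
  - apply lim2_scal, lim2_exp_decay, Hd.
  - apply lim2_scal, (lim2_swap (fun A _ => exp (- d * A))), lim2_exp_decay, Hd.
Qed.

Lemma intR_exact (h f : R -> R) (C d : R) : 0 < d ->
  (forall x, is_derive h x (f x)) -> cont f ->
  (forall y, Rabs (h y) <= C * exp (d * y)) -> (forall y, Rabs (h y) <= C * exp (- d * y)) ->
  intR f 0.
Proof.
  intros Hd Hh Cf H1 H2.
  apply (lim2_squeeze _ (fun A B => C * exp (- d * A) + C * exp (- d * B))); [|apply lim2_exp_both, Hd].
  intros A B _ _; rewrite (RInt_derive_cont h), Rminus_0_r by auto.
  unfold Rminus; eapply Rle_trans; [apply Rabs_triang|]; rewrite Rabs_Ropp.
  specialize (H1 (- A)); replace (d * - A) with (- d * A) in H1 by ring.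
  generalize (H2 B); lra.
Qed.

(** The tangent line of [exp] at [ln (c / x)], the point where the exponent is largest. *)
Lemma exp_exp_bound (c x : R) : 0 < c -> 0 < x ->
  exists K, 1 <= K /\ forall y, exp (c * y - x * exp y) <= K.
Proof.
  intros Hc Hx; exists (Rmax 1 (exp (c * ln (c / x) - c))); split; [apply Rmax_l|].
  intros y; eapply Rle_trans; [|apply Rmax_r]; apply exp_le.
  assert (Hcx : 0 < c / x) by (apply Rdiv_lt_0_compat; lra).
  generalize (exp_ineq1_le (y - ln (c / x))); intros H.
  unfold Rminus in H; rewrite exp_plus, exp_Ropp, exp_ln in H by exact Hcx.
  apply (Rmult_le_compat_r c) in H; [|lra].
  replace (exp y * / (c / x) * c) with (x * exp y) in H by (field; lra).
  lra.
Qed.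

Lemma gamma_kernel_bounds (s x : R) : 0 < s -> 0 < x -> exists K, 1 <= K /\
  forall y, exp (s * y - x * exp y) <= K * exp (s * y) /\ exp (s * y - x * exp y) <= K * exp (- s * y).
Proof.
  intros Hs Hx; destruct (exp_exp_bound (2 * s) x) as [K [HK Hb]]; [lra|exact Hx|].
  exists K; split; [exact HK|]; intros y; split.
  - apply Rle_trans with (1 * exp (s * y)).
    + rewrite Rmult_1_l; apply exp_le.
      assert (0 < x * exp y) by (apply Rmult_lt_0_compat; [lra|apply exp_pos]); lra.
    + apply Rmult_le_compat_r; [apply exp_ge0|exact HK].
  - replace (s * y - x * exp y) with ((2 * s * y - x * exp y) + - s * y) by ring.
    rewrite exp_plus; apply Rmult_le_compat_r; [apply exp_ge0|apply Hb].
Qed.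

Lemma cont_gamma_kernel (s x : R) : cont (fun y => exp (s * y - x * exp y)).
Proof. apply ex_derive_cont; intros y; auto_derive; trivial. Qed.

#[export] Hint Resolve cont_gamma_kernel : cont.

Lemma intR_gamma_kernel_ex (s x : R) : 0 < s -> 0 < x -> exists l, intR (fun y => exp (s * y - x * exp y)) l.
Proof.
  intros Hs Hx; destruct (intR_crit s Hs) as [K0 [_ Hc]].
  destruct (gamma_kernel_bounds s x Hs Hx) as [K [_ HK]].
  destruct (Hc _ K (cont_gamma_kernel s x)) as [l [Hl _]]; [| |exists l; exact Hl];
    intros y; rewrite Rabs_pos_eq by apply exp_ge0; apply HK.
Qed.

Lemma is_RInt_gamma_integrand (s a b : R) :
  is_RInt (fun t => Rpower t (s - 1) * exp (- t)) (exp a) (exp b) (RInt (fun y => exp (s * y - 1 * exp y)) a b).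
Proof.
  assert (Hd : forall t, 0 < t -> ex_derive (fun t => Rpower t (s - 1) * exp (- t)) t).
  { intros t Ht; unfold Rpower; auto_derive; exact Ht. }
  assert (Hc : forall t, 0 < t -> continuous (fun t => Rpower t (s - 1) * exp (- t)) t).
  { intros t Ht; apply (@ex_derive_continuous _ R_NormedModule), Hd, Ht. }
  replace (RInt (fun y => exp (s * y - 1 * exp y)) a b)
    with (RInt (fun t => Rpower t (s - 1) * exp (- t)) (exp a) (exp b)).
  - apply (@RInt_correct R_CompleteNormedModule), (@ex_RInt_continuous R_CompleteNormedModule).
    intros t Ht; apply Hc.
    destruct Ht as [Ht _]; eapply Rlt_le_trans; [|exact Ht].
    apply Rmin_case; apply exp_pos.
  - rewrite <- (RInt_comp (V := R_CompleteNormedModule) _ exp exp).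
    + apply RInt_ext; intros y _; unfold scal; simpl; unfold mult; simpl; unfold Rpower.
      rewrite ln_exp, <- !exp_plus; f_equal; ring.
    + intros y _; apply Hc, exp_pos.
    + intros y _; split; [apply is_derive_Reals, derivable_pt_lim_exp|].
      auto_cont.
Qed.

(** Passage from the half-line to the line: under [t = exp y], neighbourhoods of zero and of
    infinity become the conditions [M <= A] and [M <= B]. *)
Lemma intR_Gamma (s : R) : 0 < s -> intR (fun y => exp (s * y - exp y)) (Gamma s).
Proof.
  intros Hs; destruct (intR_gamma_kernel_ex s 1 Hs Rlt_0_1) as [l Hl].
  apply intR_ext with (fun y => exp (s * y - 1 * exp y)); [intros y; rewrite Rmult_1_l; reflexivity|].
  replace (Gamma s) with l; [exact Hl|].
  symmetry; unfold Gamma; apply (is_RInt_gen_unique (V := R_CompleteNormedModule)).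
  intros P [eps HP].
  destruct (Hl eps (cond_pos eps)) as [M HM].
  apply Filter_prod with (fun x => 0 < x <= exp (- M)) (fun y => exp M <= y).
  - exists (mkposreal _ (exp_pos (- M))); intros x Hx Hx0; split; [exact Hx0|].
    unfold ball in Hx; simpl in Hx; unfold AbsRing_ball, abs, minus, plus, opp in Hx; simpl in Hx.
    apply Rabs_def2 in Hx; lra.
  - exists (exp M); intros y Hy; lra.
  - intros x y Hx Hy; simpl.
    assert (Hy0 : 0 < y) by (generalize (exp_pos M); lra).
    exists (RInt (fun y => exp (s * y - 1 * exp y)) (ln x) (ln y)); split.
    + rewrite <- (exp_ln x), <- (exp_ln y) at 1 by lra; apply is_RInt_gamma_integrand.
    + apply HP; unfold ball; simpl; unfold AbsRing_ball, abs, minus, plus, opp; simpl.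
      replace (ln x) with (- - ln x) by ring; apply HM.
      * apply Ropp_le_cancel; rewrite Ropp_involutive; apply exp_le_inv; rewrite exp_ln; lra.
      * apply exp_le_inv; rewrite exp_ln; lra.
Qed.

Lemma intR_gamma_scaled (a X : R) : 0 < a -> 0 < X ->
  intR (fun y => exp (a * y - X * exp y)) (Gamma a * Rpower X (- a)).
Proof.
  intros Ha HX.
  assert (H := intR_Gamma a Ha).
  apply (intR_shift (ln X)) in H.
  2: { auto_cont. }
  apply (intR_scal (Rpower X (- a))) in H.
  2: { auto_cont. }
  rewrite Rmult_comm; eapply intR_ext; [|exact H].
  intros y; cbv beta; unfold Rpower.
  rewrite <- exp_plus, (exp_plus y), exp_ln by exact HX; f_equal; ring.
Qed.

Lemma exp_taylor1 (t : R) : Rabs (exp t - 1 - t) <= t ^ 2 * exp (Rabs t).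
Proof.
  assert (H0 := exp_ineq1_le t).
  rewrite Rabs_pos_eq by lra.
  assert (H1 : exp t - 1 <= t * exp t).
  { generalize (exp_ineq1_le (- t)) (exp_pos t); intros H Hp.
    apply (Rmult_le_compat_r (exp t)) in H; [|lra].
    rewrite <- exp_plus, Rplus_opp_l, exp_0 in H; nra. }
  assert (H2 : 1 <= exp (Rabs t)) by (rewrite <- exp_0; apply exp_le, Rabs_pos).
  destruct (Rle_dec 0 t) as [Ht|Ht].
  - rewrite Rabs_pos_eq in * by exact Ht; nra.
  - assert (t * (exp t - 1) <= t * t) by nra; nra.
Qed.

(** Differentiation under the integral by a Taylor bound: [exp (h phi) - 1 - h phi] is at most [(h
    phi) ^ 2 (exp (d phi) + exp (- d phi))], so the error is at most [h ^ 2 * m]. It serves [Gamma],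
    with [phi y = y], and [kummer], with [phi y = - exp y]. *)
Lemma is_derive_intR_exp (w phi F : R -> R) (s d F1 m : R) :
  cont w -> cont phi -> (forall y, 0 <= w y) -> 0 < d ->
  (forall h, Rabs h < d -> intR (fun y => w y * exp ((s + h) * phi y)) (F (s + h))) ->
  intR (fun y => phi y * (w y * exp (s * phi y))) F1 ->
  intR (fun y => phi y ^ 2 * (w y * exp ((s + d) * phi y) + w y * exp ((s - d) * phi y))) m ->
  is_derive F s F1.
Proof.
  intros Cw Cp Hw Hd HF HF1 Hm.
  assert (Ce : forall t, cont (fun y => w y * exp (t * phi y))) by auto_cont.
  assert (Cg : cont (fun y => phi y ^ 2 * (w y * exp ((s + d) * phi y) + w y * exp ((s - d) * phi y)))) by
      auto_cont.
  assert (Hbound : forall h, Rabs h < d -> Rabs (F (s + h) - F s - h * F1) <= h ^ 2 * m).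
  { intros h Hh.
    assert (H0 : intR (fun y => w y * exp (s * phi y)) (F s)).
    { specialize (HF 0); rewrite Rplus_0_r, Rabs_R0 in HF; apply HF, Hd. }
    apply (intR_abs_le
      (fun y => w y * exp ((s + h) * phi y) - w y * exp (s * phi y) - h * (phi y * (w y * exp (s * phi y))))
      (fun y => h ^ 2 * (phi y ^ 2 * (w y * exp ((s + d) * phi y) + w y * exp ((s - d) * phi y))))).
    - auto_cont.
    - auto_cont.
    - intros y; set (t := phi y).
      replace (w y * exp ((s + h) * t) - w y * exp (s * t) - h * (t * (w y * exp (s * t))))
        with (w y * exp (s * t) * (exp (h * t) - 1 - h * t)).
      2: { rewrite Rmult_plus_distr_r, exp_plus; ring. }
      rewrite Rabs_mult, (Rabs_pos_eq (w y * exp (s * t))).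
      2: { apply Rmult_le_pos; [apply Hw|apply exp_ge0]. }
      apply Rle_trans with (w y * exp (s * t) * ((h * t) ^ 2 * exp (Rabs (h * t)))).
      { apply Rmult_le_compat_l; [|apply exp_taylor1].
        apply Rmult_le_pos; [apply Hw|apply exp_ge0]. }
      assert (He : exp (Rabs (h * t)) <= exp (d * t) + exp (- d * t)).
      { generalize (exp_pos (d * t)) (exp_pos (- d * t)); intros.
        rewrite Rabs_mult.
        assert (Hht : Rabs h * Rabs t <= d * Rabs t).
        { apply Rmult_le_compat_r; [apply Rabs_pos|lra]. }
        eapply Rle_trans; [apply exp_le, Hht|].
        destruct (Rle_dec 0 t); [rewrite Rabs_pos_eq by lra; lra|].
        rewrite Rabs_left by lra; replace (d * - t) with (- d * t) by ring; lra. }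
      replace ((s + d) * t) with (s * t + d * t) by ring.
      replace ((s - d) * t) with (s * t + - d * t) by ring.
      rewrite !exp_plus.
      replace (h ^ 2 * (t ^ 2 * (w y * (exp (s * t) * exp (d * t)) + w y * (exp (s * t) * exp (- d * t)))))
        with ((w y * exp (s * t) * (h * t) ^ 2) * (exp (d * t) + exp (- d * t))) by ring.
      rewrite <- Rmult_assoc; apply Rmult_le_compat_l; [|exact He].
      apply Rmult_le_pos; [apply Rmult_le_pos; [apply Hw|apply exp_ge0]|apply pow2_ge_0].
    - apply intR_minus; auto.
      + auto_cont.
      + auto_cont.
      + apply intR_minus; auto.
      + apply intR_scal; [auto_cont|auto].
    - apply intR_scal; auto. }
  apply is_derive_Reals; intros eps He.
  assert (Hm0 : 0 <= m).
  { apply (intR_ge0 _ _ Cg); auto; intros y; apply Rmult_le_pos; [apply pow2_ge_0|].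
    generalize (Hw y) (exp_pos ((s + d) * phi y)) (exp_pos ((s - d) * phi y)); intros; nra. }
  assert (Hdel : 0 < Rmin d (eps / (m + 1))).
  { apply Rmin_pos; [exact Hd|apply Rdiv_lt_0_compat; lra]. }
  exists (mkposreal _ Hdel); intros h Hh0 Hh; cbn [pos] in Hh.
  assert (H1 : Rabs h < d) by (eapply Rlt_le_trans; [exact Hh|apply Rmin_l]).
  assert (H2 : Rabs h < eps / (m + 1)) by (eapply Rlt_le_trans; [exact Hh|apply Rmin_r]).
  specialize (Hbound h H1).
  assert (Hp : 0 < Rabs h) by (apply Rabs_pos_lt, Hh0).
  replace ((F (s + h) - F s) / h - F1) with ((F (s + h) - F s - h * F1) / h) by (field; exact Hh0).
  unfold Rdiv; rewrite Rabs_mult, Rabs_inv.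
  apply (Rmult_lt_reg_r (Rabs h)); [exact Hp|].
  rewrite Rmult_assoc, Rinv_l, Rmult_1_r by lra.
  eapply Rle_lt_trans; [exact Hbound|].
  rewrite <- pow2_abs.
  apply (Rmult_lt_compat_r (m + 1)) in H2; [|lra].
  replace (eps / (m + 1) * (m + 1)) with eps in H2 by (field; lra).
  nra.
Qed.

Lemma abs_le_exp (d y : R) : 0 < d -> Rabs y <= / d * (exp (d * y) + exp (- d * y)).
Proof.
  intros Hd; apply (Rmult_le_reg_l d); [exact Hd|].
  rewrite <- Rmult_assoc, Rinv_r, Rmult_1_l by lra.
  generalize (exp_ineq1_le (d * y)) (exp_ineq1_le (- d * y)) (exp_pos (d * y)) (exp_pos (- d * y)).
  unfold Rabs; destruct (Rcase_abs y); intros; nra.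
Qed.

Lemma sq_le_exp (d y : R) : 0 < d -> y ^ 2 <= 2 * (/ d) ^ 2 * (exp (2 * d * y) + exp (- (2 * d) * y)).
Proof.
  intros Hd; generalize (abs_le_exp d y Hd) (Rabs_pos y); intros H1 H2.
  rewrite <- pow2_abs.
  replace (exp (2 * d * y)) with (exp (d * y) ^ 2) by (simpl; rewrite Rmult_1_r, <- exp_plus; f_equal; ring).
  replace (exp (- (2 * d) * y)) with (exp (- d * y) ^ 2) by (simpl; rewrite Rmult_1_r, <- exp_plus;
      f_equal; ring).
  apply Rle_trans with ((/ d * (exp (d * y) + exp (- d * y))) ^ 2).
  - apply pow_incr; auto.
  - rewrite Rpow_mult_distr, (Rmult_comm 2), Rmult_assoc.
    apply Rmult_le_compat_l; [apply pow2_ge_0|].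
    generalize (pow2_ge_0 (exp (d * y) - exp (- d * y))); lra.
Qed.

(** Powers of [y] are absorbed by moving the exponent. The step [d] of the differentiation and the
    bound on [y ^ 2] each cost [s / 4], so all the integrals involved are values of [Gamma] between
    [s / 2] and [3 s / 2]. *)
Lemma Gamma_derive (s : R) : 0 < s ->
  intR (fun y => y * exp (s * y - exp y)) (Derive Gamma s) /\ is_derive Gamma s (Derive Gamma s).
Proof.
  intros Hs.
  set (g := fun t y => exp (t * y - exp y)).
  assert (Cg : forall t, cont (g t)) by auto_cont.
  assert (Cid : cont (fun y => y)) by auto_cont.
  assert (Csq : cont (fun y => y ^ 2)) by auto_cont.
  assert (E : forall t u y, exp (u * y) * g t y = g (t + u) y).
  { intros t u y; unfold g; rewrite <- exp_plus; f_equal; ring. }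
  destruct (intR_ex_dom (fun y => y * g s y)
     (fun y => / (s / 4) * (g (s + s / 4) y + g (s - s / 4) y))
     (/ (s / 4) * (Gamma (s + s / 4) + Gamma (s - s / 4)))) as [G1 [HG1 _]].
  - auto_cont.
  - auto_cont.
  - intros y; rewrite Rabs_mult, (Rabs_pos_eq (g s y)) by apply exp_ge0.
    unfold Rminus; rewrite <- !E, <- Rmult_plus_distr_r, <- Rmult_assoc.
    apply Rmult_le_compat_r; [apply exp_ge0|].
    apply abs_le_exp; lra.
  - apply intR_scal; [apply cont_plus; auto|].
    apply intR_plus; auto; apply intR_Gamma; lra.
  - assert (HD : is_derive Gamma s G1).
    { set (h := fun y => 2 * (/ (s / 8)) ^ 2 *
         ((g (s + s / 4 + s / 4) y + g (s + s / 4 - s / 4) y) + (g (s - s / 4 + s / 4) y + g (s - s / 4 - s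
             / 4) y))).
      assert (Ch : cont h) by auto_cont.
      destruct (intR_ex_dom (fun y => y ^ 2 * (g (s + s / 4) y + g (s - s / 4) y)) h
        (2 * (/ (s / 8)) ^ 2 * ((Gamma (s + s / 4 + s / 4) + Gamma (s + s / 4 - s / 4)) + (Gamma (s - s / 4
            + s / 4) + Gamma (s - s / 4 - s / 4)))))
        as [m [Hm _]].
      - apply cont_mult; [exact Csq|apply cont_plus; auto].
      - exact Ch.
      - intros y; rewrite Rabs_pos_eq.
        2: { apply Rmult_le_pos; [apply pow2_ge_0|unfold g].
             generalize (exp_pos ((s + s / 4) * y - exp y)) (exp_pos ((s - s / 4) * y - exp y)); lra. }
        unfold h, Rminus; rewrite <- !E.
        assert (Hq : y ^ 2 <= 2 * (/ (s / 8)) ^ 2 * (exp (s / 4 * y) + exp (- (s / 4) * y))).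
        { replace (s / 4) with (2 * (s / 8)) by field; apply sq_le_exp; lra. }
        eapply Rle_trans; [apply Rmult_le_compat_r; [|exact Hq]|].
        + apply Rplus_le_le_0_compat; apply Rmult_le_pos; apply exp_ge0.
        + right; ring.
      - apply intR_scal; [repeat apply cont_plus; auto|].
        apply intR_plus; try (apply cont_plus; auto); apply intR_plus; auto; apply intR_Gamma; lra.
      - apply (is_derive_intR_exp (fun y => exp (- exp y)) (fun y => y) Gamma s (s / 4) G1 m).
        + auto_cont.
        + exact Cid.
        + intros y; apply exp_ge0.
        + lra.
        + intros t Ht; apply Rabs_def2 in Ht.
          apply intR_ext with (g (s + t)); [|apply intR_Gamma; lra].
          intros y; unfold g; rewrite <- exp_plus; f_equal; ring.
        + apply intR_ext with (fun y => y * g s y); [|exact HG1].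
          intros y; unfold g; rewrite <- exp_plus; do 2 f_equal; ring.
        + eapply intR_ext; [|exact Hm]; intros y; simpl; unfold g; rewrite <- !exp_plus; do 3 f_equal; ring. }
    rewrite (is_derive_unique _ _ _ HD); split; [exact HG1|exact HD].
Qed.

Lemma Gamma_pos (s : R) : 0 < s -> 0 < Gamma s.
Proof.
  intros Hs; apply (intR_pos (fun y => exp (s * y - exp y))).
  - auto_cont.
  - intros y; apply exp_pos.
  - apply intR_Gamma, Hs.
Qed.

Lemma Gamma_succ (s : R) : 0 < s -> Gamma (s + 1) = s * Gamma s.
Proof.
  intros Hs.
  assert (C1 : forall t, cont (fun y => exp (t * y - exp y))) by auto_cont.
  assert (H0 : intR (fun y => s * exp (s * y - exp y) - exp ((s + 1) * y - exp y)) 0).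
  { destruct (gamma_kernel_bounds s 1 Hs Rlt_0_1) as [K [HK Hb]].
    apply (intR_exact (fun y => exp (s * y - exp y)) _ K s Hs).
    - intros y; auto_derive; [trivial|].
      replace ((s + 1) * y - exp y) with (y + (s * y - exp y)) by ring.
      unfold Rminus; rewrite !exp_plus; ring.
    - auto_cont.
    - intros y; rewrite Rabs_pos_eq by apply exp_ge0.
      rewrite <- (Rmult_1_l (exp y)); apply Hb.
    - intros y; rewrite Rabs_pos_eq by apply exp_ge0.
      rewrite <- (Rmult_1_l (exp y)); apply Hb. }
  assert (H1 : intR (fun y => s * exp (s * y - exp y) - exp ((s + 1) * y - exp y)) (s * Gamma s - Gamma (s
      + 1))).
  { apply intR_minus; [auto_cont|auto_cont| |apply intR_Gamma; lra].
    apply intR_scal; [auto_cont|apply intR_Gamma, Hs]. }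
  generalize (intR_unique _ _ _ H0 H1); lra.
Qed.

Lemma Gamma_1 : Gamma 1 = 1.
Proof.
  apply (intR_unique (fun y => exp (1 * y - exp y))); [apply intR_Gamma; lra|].
  apply lim2_ext with (fun A B => exp (- exp (- A)) - exp (- exp B)).
  - intros A B _ _; rewrite (RInt_derive_cont (fun y => - exp (- exp y))); [ring| |].
    + intros y; auto_derive; [trivial|].
      replace (1 * y - exp y) with (y + - exp y) by ring; rewrite !exp_plus; ring.
    + auto_cont.
  - replace 1 with (1 - 0) by ring; apply (lim2_minus (fun A B => exp (- exp (- A))) (fun A B => exp (- exp
      B))).
    + apply (lim2_squeeze _ (fun A _ => exp (- 1 * A))); [|apply (lim2_exp_decay 1 Rlt_0_1)].
      intros A B _ _; replace (-1 * A) with (- A) by ring.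
      generalize (one_minus_le_exp (exp (- A))) (exp_pos (- A)); intros.
      assert (exp (- exp (- A)) <= 1) by (apply exp_le_1; lra).
      apply Rabs_le; split; lra.
    + apply (lim2_squeeze _ (fun A B => exp (- 1 * B))); [|apply (lim2_swap (fun A _ => exp (- 1 * A))),
        (lim2_exp_decay 1 Rlt_0_1)].
      intros A B _ _; rewrite Rminus_0_r, Rabs_pos_eq by apply exp_ge0.
      apply exp_le; generalize (exp_ineq1_le B); lra.
Qed.

Lemma digamma_succ (s : R) : 0 < s -> digamma (s + 1) = digamma s + / s.
Proof.
  intros Hs; unfold digamma.
  destruct (Gamma_derive s Hs) as [_ H]; destruct (Gamma_derive (s + 1) ltac:(lra)) as [_ H'].
  assert (E : Derive Gamma (s + 1) = Gamma s + s * Derive Gamma s).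
  { assert (H1 : is_derive (fun t => Gamma (t + 1)) s (Derive Gamma (s + 1))).
    { replace (Derive Gamma (s + 1)) with (scal 1 (Derive Gamma (s + 1))) by (apply Rmult_1_l).
      apply (is_derive_comp Gamma (fun t => t + 1)); [exact H'|].
      auto_derive; [trivial|ring]. }
    assert (H2 : is_derive (fun t => Gamma (t + 1)) s (1 * Gamma s + s * Derive Gamma s)).
    { apply is_derive_ext_loc with (fun t => t * Gamma t).
      - exists (mkposreal s Hs); intros t Ht; symmetry; apply Gamma_succ.
        unfold ball in Ht; simpl in Ht; unfold AbsRing_ball, abs, minus, plus, opp in Ht; simpl in Ht.
        apply Rabs_def2 in Ht; lra.
      - apply (is_derive_mult (fun t => t) Gamma); [apply (is_derive_id (K := R_AbsRing))|exact H|].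
        intros; apply Rmult_comm. }
    rewrite <- (is_derive_unique _ _ _ H1), (is_derive_unique _ _ _ H2); ring. }
  rewrite E, Gamma_succ by exact Hs; generalize (Gamma_pos s Hs); intros; field; lra.
Qed.

(* Jensen: the tangent line of exp (or of exp (-y)) at [ln s], integrated against the Gamma density. *)
Lemma digamma_le_ln (s : R) : 0 < s -> digamma s <= ln s.
Proof.
  intros Hs; unfold digamma.
  destruct (Gamma_derive s Hs) as [H _]; assert (HG := Gamma_pos s Hs).
  assert (C1 : forall t, cont (fun y => exp (t * y - exp y))) by auto_cont.
  assert (C2 : cont (fun y => y * exp (s * y - exp y))) by auto_cont.
  assert (Hle : s * (1 - ln s) * Gamma s + s * Derive Gamma s <= Gamma (s + 1)).
  { apply (intR_le (fun y => s * (1 - ln s) * exp (s * y - exp y) + s * (y * exp (s * y - exp y)))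
                   (fun y => exp ((s + 1) * y - exp y))).
    - auto_cont.
    - auto.
    - intros y.
      generalize (exp_ineq1_le (y - ln s)); intros Hy.
      unfold Rminus in Hy; rewrite exp_plus, exp_Ropp, exp_ln in Hy by exact Hs.
      apply (Rmult_le_compat_r s) in Hy; [|lra].
      replace (exp y * / s * s) with (exp y) in Hy by (field; lra).
      replace ((s + 1) * y - exp y) with (y + (s * y - exp y)) by ring; rewrite exp_plus.
      generalize (exp_pos (s * y - exp y)); nra.
    - apply intR_plus; try auto_cont; apply intR_scal; auto using intR_Gamma.
    - apply intR_Gamma; lra. }
  rewrite Gamma_succ in Hle by exact Hs.
  apply (Rmult_le_reg_r (Gamma s)); [exact HG|]; unfold Rdiv; rewrite Rmult_assoc, Rinv_l by lra.
  apply (Rmult_le_reg_l s); nra.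
Qed.

Lemma ln_le_digamma_succ (s : R) : 0 < s -> ln s <= digamma (s + 1).
Proof.
  intros Hs; unfold digamma.
  destruct (Gamma_derive (s + 1) ltac:(lra)) as [H _]; assert (HG := Gamma_pos s Hs).
  assert (C1 : forall t, cont (fun y => exp (t * y - exp y))) by auto_cont.
  assert (C2 : cont (fun y => y * exp ((s + 1) * y - exp y))) by auto_cont.
  assert (Hle : / s * (1 + ln s) * Gamma (s + 1) - / s * Derive Gamma (s + 1) <= Gamma s).
  { apply (intR_le (fun y => / s * (1 + ln s) * exp ((s + 1) * y - exp y) - / s * (y * exp ((s + 1) * y -
      exp y)))
                   (fun y => exp (s * y - exp y))).
    - auto_cont.
    - auto.
    - intros y.
      generalize (exp_ineq1_le (- y + ln s)); intros Hy.
      rewrite exp_plus, exp_ln in Hy by exact Hs.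
      apply (Rmult_le_compat_r (/ s)) in Hy; [|left; apply Rinv_0_lt_compat; lra].
      rewrite Rmult_assoc, Rinv_r, Rmult_1_r in Hy by lra.
      replace (s * y - exp y) with (- y + ((s + 1) * y - exp y)) by ring; rewrite exp_plus.
      generalize (exp_pos ((s + 1) * y - exp y)); nra.
    - apply intR_minus; try auto_cont; apply intR_scal; auto.
      apply intR_Gamma; lra.
    - apply intR_Gamma; lra. }
  rewrite Gamma_succ in * by exact Hs.
  apply (Rmult_le_reg_r (s * Gamma s)); [nra|]; unfold Rdiv.
  replace (Derive Gamma (s + 1) * / (s * Gamma s) * (s * Gamma s)) with (Derive Gamma (s + 1)) by (field; lra).
  replace (/ s * (1 + ln s) * (s * Gamma s)) with ((1 + ln s) * Gamma s) in Hle by (field; lra).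
  apply (Rmult_le_compat_l s) in Hle; [|lra].
  rewrite Rmult_minus_distr_l, <- (Rmult_assoc s (/ s)), Rinv_r, Rmult_1_l in Hle by lra.
  lra.
Qed.

(** The recurrence gives [digamma (n + 1) = digamma 1 + H_n] with the harmonic number [H_n], and the
    two Jensen bounds pin [digamma (n + 1)] between [ln n] and [ln (n + 1)]. *)
Lemma digamma_1 : digamma 1 = - euler_gamma.
Proof.
  assert (HS : forall n, digamma (INR (S n) + 1) = digamma 1 + sum_f_R0 (fun j => / INR (S j)) n).
  { induction n as [|n IH].
    - simpl (INR 1); rewrite digamma_succ by lra; simpl; reflexivity.
    - rewrite (S_INR (S n)), digamma_succ, IH.
      + cbn [sum_f_R0]; rewrite (S_INR (S n)); ring.
      + generalize (pos_INR (S n)); lra. }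
  assert (Hl : is_lim_seq (fun n => sum_f_R0 (fun j => / INR (S j)) n - ln (INR (S n))) (- digamma 1)).
  { apply is_lim_seq_le_le with (u := fun _ => - digamma 1) (w := fun n => - digamma 1 + / INR (S n)).
    - intros n.
      assert (Hp : 0 < INR (S n)) by (apply lt_0_INR; lia).
      generalize (ln_le_digamma_succ (INR (S n)) Hp) (digamma_le_ln (INR (S n) + 1) ltac:(lra)).
      rewrite HS.
      assert (Hln : ln (INR (S n) + 1) - ln (INR (S n)) <= / INR (S n)).
      { rewrite <- ln_div by lra.
        replace ((INR (S n) + 1) / INR (S n)) with (1 + / INR (S n)) by (field; lra).
        rewrite <- (ln_exp (/ INR (S n))) at 2.
        apply ln_le; [generalize (Rinv_0_lt_compat _ Hp); lra|apply exp_ineq1_le]. }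
      lra.
    - apply is_lim_seq_const.
    - replace (Finite (- digamma 1)) with (Finite (- digamma 1 + 0)) by (f_equal; ring).
      apply is_lim_seq_plus'; [apply is_lim_seq_const|].
      apply (is_lim_seq_incr_1 (fun n => / INR n)), is_lim_seq_inv_INR. }
  unfold euler_gamma; rewrite (is_lim_seq_unique _ _ Hl); simpl; ring.
Qed.

(** * Constants of logistic and exponential integrals *)

(** The [a]-th power of the logistic function: like [exp (a * y)] on the far left, like 1 on the far
    right. *)
Definition sigm (a y : R) : R := Rpower (1 + exp (- y)) (- a).

Lemma is_derive_sigm (a y : R) : is_derive (sigm a) y (a * (sigm a y - sigm (a + 1) y)).
Proof.
  assert (P := exp_pos (- y)); unfold sigm, Rpower.
  auto_derive; [lra|].
  replace (- (a + 1) * ln (1 + exp (- y))) with (- a * ln (1 + exp (- y)) + - ln (1 + exp (- y))) by ring.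
  rewrite exp_plus, (exp_Ropp (ln _)), exp_ln by lra; field; lra.
Qed.

Lemma cont_sigm (a : R) : cont (sigm a).
Proof. apply ex_derive_cont; intros y; eexists; apply is_derive_sigm. Qed.

#[export] Hint Resolve cont_sigm : cont.

Lemma sigm_pos (a y : R) : 0 < sigm a y.
Proof. apply exp_pos. Qed.

Lemma ln_1_exp_bounds (y : R) : 0 < ln (1 + exp (- y)) <= exp (- y) /\ - y <= ln (1 + exp (- y)).
Proof.
  assert (P := exp_pos (- y)); repeat split.
  - rewrite <- ln_1; apply ln_increasing; lra.
  - rewrite <- (ln_exp (exp (- y))) at 2; apply ln_le; [lra|apply exp_ineq1_le].
  - rewrite <- (ln_exp (- y)) at 1; apply ln_le; lra.
Qed.

Lemma sigm_antitone (a b y : R) : a <= b -> sigm b y <= sigm a y.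
Proof.
  intros H; apply exp_le; generalize (ln_1_exp_bounds y); intros [[H1 _] _]; nra.
Qed.

Lemma sigm_le_1 (a y : R) : 0 <= a -> sigm a y <= 1.
Proof.
  intros H; apply Rle_trans with (exp 0); [apply exp_le|rewrite exp_0; lra].
  generalize (ln_1_exp_bounds y); intros [[H1 _] _]; nra.
Qed.

Lemma sigm_le_exp (a y : R) : 0 <= a -> sigm a y <= exp (a * y).
Proof.
  intros H; apply exp_le; generalize (ln_1_exp_bounds y); intros [_ H1]; nra.
Qed.

Lemma one_minus_sigm (a y : R) : 0 <= a -> 1 - sigm a y <= a * exp (- y).
Proof.
  intros H; unfold sigm, Rpower.
  generalize (exp_ineq1_le (- a * ln (1 + exp (- y)))); generalize (ln_1_exp_bounds y); intros [[_ H1] _]; nra.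
Qed.

Definition is_sigm_const (a c : R) : Prop := lim2 (fun A B => RInt (sigm a) (- A) B - B) c.

Lemma is_sigm_const_1 : is_sigm_const 1 0.
Proof.
  apply lim2_ext with (fun A B => ln (1 + exp (- B)) - ln (1 + exp (- A))).
  - intros A B _ _.
    rewrite (RInt_derive_cont (fun y => y + ln (1 + exp (- y)))); [|intros y|apply cont_sigm].
    + rewrite Ropp_involutive.
      replace (1 + exp A) with (exp A * (1 + exp (- A))).
      * rewrite ln_mult, ln_exp by (generalize (exp_pos (- A)) (exp_pos A); lra); ring.
      * rewrite Rmult_plus_distr_l, <- exp_plus, Rplus_opp_r, exp_0; ring.
    + assert (P := exp_pos (- y)); auto_derive; [lra|].
      unfold sigm; rewrite Rpower_Ropp, Rpower_1 by lra; field; lra.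
  - apply (lim2_squeeze _ (fun A B => 1 * exp (- 1 * A) + 1 * exp (- 1 * B))); [|apply (lim2_exp_both 1 1
      Rlt_0_1)].
    intros A B _ _.
    replace (- 1 * A) with (- A) by ring; replace (- 1 * B) with (- B) by ring.
    generalize (ln_1_exp_bounds A) (ln_1_exp_bounds B); intros [[H1 H2] _] [[H3 H4] _].
    apply Rabs_le; split; lra.
Qed.

(** Comparison with the exponent 1, whose finite part is explicit: the difference of the two powers
    decays exponentially at both ends, at rate [Rmin a 1] on the left and 1 on the right. *)
Lemma is_sigm_const_ex (a : R) : 0 < a -> exists c, is_sigm_const a c.
Proof.
  intros Ha; set (d := Rmin a 1).
  assert (Hd : 0 < d) by (apply Rmin_pos; lra).
  assert (Hda : d <= a) by apply Rmin_l.
  assert (Hd1 : d <= 1) by apply Rmin_r.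
  destruct (intR_crit d Hd) as [K [_ Hc]].
  destruct (Hc (fun y => sigm a y - sigm 1 y) (a + 2)) as [l [Hl _]].
  - auto_cont.
  - intros y.
    generalize (sigm_antitone d a y Hda) (sigm_antitone d 1 y Hd1) (sigm_pos a y) (sigm_pos 1 y)
        (sigm_le_exp d y ltac:(lra)); intros.
    assert (P := exp_pos (d * y)); apply Rabs_le; split; nra.
  - intros y.
    assert (P := exp_pos (- d * y)).
    generalize (sigm_pos a y) (sigm_pos 1 y) (sigm_le_1 a y ltac:(lra)) (sigm_le_1 1 y ltac:(lra))
        (one_minus_sigm a y ltac:(lra)) (one_minus_sigm 1 y ltac:(lra)); intros.
    destruct (Rle_dec 0 y) as [Hy|Hy].
    + assert (exp (- y) <= exp (- d * y)) by (apply exp_le; nra).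
      apply Rabs_le; split; nra.
    + assert (1 <= exp (- d * y)) by (apply exp_ge_1; nra).
      apply Rabs_le; split; nra.
  - exists (l + 0); eapply lim2_ext; [|apply (lim2_plus _ _ _ _ Hl is_sigm_const_1)].
    intros A B _ _; simpl; rewrite RInt_minus_cont by apply cont_sigm; ring.
Qed.

(** [a * (sigm a - sigm (a + 1))] is the derivative of [sigm a], which rises from 0 to 1. *)
Lemma is_sigm_const_succ (a c : R) : 0 < a -> is_sigm_const a c -> is_sigm_const (a + 1) (c - / a).
Proof.
  intros Ha Hc; replace (c - / a) with (c - / a * (1 - 0)) by ring.
  apply lim2_ext with (fun A B => (RInt (sigm a) (- A) B - B) - / a * (sigm a B - sigm a (- A))).
  2: apply lim2_minus, lim2_scal, (lim2_minus (fun _ B => sigm a B) (fun A _ => sigm a (- A))); [exact Hc| |].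
  - intros A B _ _; simpl.
    rewrite <- (RInt_derive_cont (sigm a) (fun y => a * (sigm a y - sigm (a + 1) y))).
    + rewrite (RInt_scal_cont (fun y => sigm a y - sigm (a + 1) y)) by auto_cont.
      rewrite RInt_minus_cont by apply cont_sigm; field; lra.
    + apply is_derive_sigm.
    + auto_cont.
  - apply (lim2_squeeze _ (fun _ B => a * exp (- 1 * B))).
    + intros A B _ _; replace (- 1 * B) with (- B) by ring.
      generalize (one_minus_sigm a B ltac:(lra)) (sigm_le_1 a B ltac:(lra)); intros.
      apply Rabs_le; split; lra.
    + replace 0 with (a * 0) by ring; apply lim2_scal, (lim2_swap (fun A _ => exp (- 1 * A))),
        (lim2_exp_decay 1 Rlt_0_1).
  - apply (lim2_squeeze _ (fun A _ => exp (- a * A))); [|apply lim2_exp_decay, Ha].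
    intros A B _ _; rewrite Rminus_0_r, Rabs_pos_eq by (left; apply sigm_pos).
    replace (- a * A) with (a * - A) by ring; apply sigm_le_exp; lra.
Qed.

Lemma is_sigm_const_antitone (a b c c' : R) : a <= b -> is_sigm_const a c -> is_sigm_const b c' -> c' <= c.
Proof.
  intros Hab H H'; refine (lim2_le _ _ _ _ _ H' H); intros A B HA HB.
  apply Rplus_le_compat_r, RInt_le_cont; try apply cont_sigm; [lra|].
  intros y _; apply sigm_antitone, Hab.
Qed.

(* [c + digamma] is invariant under [a -> a + 1], so it can be compared with the case [a = 1]
   at [a + N], where [c] and [digamma] are squeezed. *)
Lemma is_sigm_const_digamma_le_1 (a : R) : 0 < a <= 1 -> is_sigm_const a (- euler_gamma - digamma a).
Proof.
  intros [Ha Ha1].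
  destruct (is_sigm_const_ex a Ha) as [c Hc].
  assert (HN : forall b e, 0 < b -> is_sigm_const b e -> forall N, is_sigm_const (b + INR N) (e + digamma b
      - digamma (b + INR N))).
  { intros b e Hb He; induction N as [|N IH].
    - simpl; rewrite Rplus_0_r; replace (e + digamma b - digamma b) with e by ring; exact He.
    - assert (0 < b + INR N) by (generalize (pos_INR N); lra).
      rewrite S_INR, <- Rplus_assoc, digamma_succ by lra.
      replace (e + digamma b - (digamma (b + INR N) + / (b + INR N)))
        with (e + digamma b - digamma (b + INR N) - / (b + INR N)) by ring.
      apply is_sigm_const_succ; auto. }
  set (x := c + digamma a + euler_gamma).
  assert (Hx : forall M, Rabs x <= 2 * / INR (S M)).
  { intros M.
    assert (HM : 0 < INR (S M)) by (apply lt_0_INR; lia).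
    set (m := INR (S M)) in *.
    (* As [0 < a <= 1], the exponent [a + m + 1] lies between [m + 1] and [m + 2], where the
       constant is known from the case of exponent 1. Monotonicity then traps [x] within
       [ln (m + 2) - ln m] of zero. *)
    assert (H1 := HN a c Ha Hc (S (S M))); rewrite S_INR in H1; fold m in H1.
    assert (H2 := HN 1 0 Rlt_0_1 is_sigm_const_1 (S M)); fold m in H2.
    assert (H3 := HN 1 0 Rlt_0_1 is_sigm_const_1 (S (S M))); rewrite S_INR in H3; fold m in H3.
    rewrite digamma_1 in H2, H3.
    assert (L1 := is_sigm_const_antitone (1 + m) (a + (m + 1)) _ _ ltac:(lra) H2 H1).
    assert (L2 := is_sigm_const_antitone (a + (m + 1)) (1 + (m + 1)) _ _ ltac:(lra) H1 H3).
    assert (L3 := digamma_le_ln (a + (m + 1)) ltac:(lra)).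
    assert (L4 := ln_le_digamma_succ m HM).
    assert (L5 := digamma_le_ln (1 + (m + 1)) ltac:(lra)).
    assert (L6 := ln_le_digamma_succ (a + m) ltac:(lra)).
    replace (a + m + 1) with (a + (m + 1)) in L6 by ring.
    replace (m + 1) with (1 + m) in L4 by ring.
    assert (L7 : ln m <= ln (a + m)) by (apply ln_le; lra).
    assert (L8 : ln (a + (m + 1)) <= ln (m + 2)) by (apply ln_le; lra).
    replace (1 + (m + 1)) with (m + 2) in * by ring.
    assert (L9 : ln (m + 2) - ln m <= 2 * / m).
    { rewrite <- ln_div by lra.
      replace ((m + 2) / m) with (1 + 2 * / m) by (field; lra).
      rewrite <- (ln_exp (2 * / m)) at 2.
      apply ln_le; [generalize (Rinv_0_lt_compat _ HM); lra|apply exp_ineq1_le]. }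
    unfold x; apply Rabs_le; split; lra. }
  assert (Hx0 : x = 0).
  { assert (Hl : Rabs x <= 0).
    { apply (is_lim_seq_le (fun _ => Rabs x) (fun M => 2 * / INR (S M)) (Rabs x) 0 Hx).
      - apply is_lim_seq_const.
      - replace (Finite 0) with (Finite (2 * 0)) by (f_equal; ring).
        apply is_lim_seq_mult'; [apply is_lim_seq_const|].
        apply (is_lim_seq_incr_1 (fun n => / INR n)), is_lim_seq_inv_INR. }
    generalize (Rabs_pos x); intros; apply Rabs_eq_0; lra. }
  replace (- euler_gamma - digamma a) with c; [exact Hc|unfold x in Hx0; lra].
Qed.

(** The recurrence raises [k / 2] by one, so the induction carries both parities of [k], starting
    from [1 / 2] and 1. *)
Lemma is_sigm_const_digamma (k : nat) : (1 <= k)%nat ->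
  is_sigm_const (INR k / 2) (- euler_gamma - digamma (INR k / 2)).
Proof.
  assert (H : forall n, is_sigm_const (INR (S n) / 2) (- euler_gamma - digamma (INR (S n) / 2))
      /\ is_sigm_const (INR (S (S n)) / 2) (- euler_gamma - digamma (INR (S (S n)) / 2))).
  { induction n as [|n [IH1 IH2]].
    - split; apply is_sigm_const_digamma_le_1; simpl; lra.
    - split; [exact IH2|].
      assert (Hp : 0 < INR (S n)) by (apply lt_0_INR; lia).
      replace (INR (S (S (S n))) / 2) with (INR (S n) / 2 + 1) by (rewrite !S_INR; field).
      rewrite digamma_succ by lra.
      replace (- euler_gamma - (digamma (INR (S n) / 2) + / (INR (S n) / 2)))
        with (- euler_gamma - digamma (INR (S n) / 2) - / (INR (S n) / 2)) by ring.
      apply is_sigm_const_succ; [lra|exact IH1]. }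
  intros Hk; destruct k as [|k]; [lia|exact (proj1 (H k))].
Qed.

(** Integration by parts, with boundary term [z * exp (- exp z)], leads to the integral of
    [z * exp (z - exp z)], that is to the derivative of [Gamma] at 1. *)
Lemma exponential_integral_const :
  lim2 (fun A B => RInt (fun z => exp (- exp z)) (- A) B - A) (- euler_gamma).
Proof.
  assert (C0 : cont (fun z => exp (- exp z))) by auto_cont.
  assert (C1 : cont (fun z => z * exp (1 * z - exp z))) by auto_cont.
  assert (HG : intR (fun z => z * exp (1 * z - exp z)) (- euler_gamma)).
  { replace (- euler_gamma) with (Derive Gamma 1); [apply (Gamma_derive 1 Rlt_0_1)|].
    generalize digamma_1; unfold digamma; rewrite Gamma_1; intros <-; field. }
  replace (- euler_gamma) with (- euler_gamma + 0) by ring.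
  eapply lim2_ext; [|apply (lim2_plus _ (fun A B => B * exp (- exp B) + - A * (1 - exp (- exp (- A)))) _ 0 HG)].
  - intros A B _ _; simpl.
    assert (E : RInt (fun z => exp (- exp z) - z * exp (1 * z - exp z)) (- A) B
      = B * exp (- exp B) - - A * exp (- exp (- A))).
    { rewrite (RInt_derive_cont (fun z => z * exp (- exp z))); [reflexivity| |auto_cont].
      intros y; auto_derive; [trivial|].
      replace (1 * y - exp y) with (y + - exp y) by ring; rewrite !exp_plus; ring. }
    rewrite RInt_minus_cont in E by auto; lra.
  - apply (lim2_squeeze _ (fun A B => 2 * exp (- / 2 * A) + 2 * exp (- / 2 * B))); [|apply (lim2_exp_both 2
      (/ 2)); lra].
    intros A B HA HB; rewrite Rminus_0_r.
    assert (Q : forall t, 0 <= t -> t * exp (- t) <= 2 * exp (- / 2 * t)).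
    { intros t Ht.
      replace (- t) with (- / 2 * t + - / 2 * t) by field; rewrite exp_plus.
      assert (t * exp (- / 2 * t) <= 2).
      { generalize (exp_ineq1_le (/ 2 * t)) (exp_pos (/ 2 * t)); intros H1 H2.
        replace (- / 2 * t) with (- (/ 2 * t)) by ring; rewrite exp_Ropp.
        apply (Rmult_le_reg_r (exp (/ 2 * t))); [lra|]; rewrite Rmult_assoc, Rinv_l by lra; lra. }
      generalize (exp_pos (- / 2 * t)); nra. }
    assert (HB1 : B * exp (- exp B) <= B * exp (- B)).
    { apply Rmult_le_compat_l; [exact HB|apply exp_le; generalize (exp_ineq1_le B); lra]. }
    assert (HA1 : A * (1 - exp (- exp (- A))) <= A * exp (- A)).
    { apply Rmult_le_compat_l; [exact HA|generalize (one_minus_le_exp (exp (- A))); lra]. }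
    assert (0 <= B * exp (- exp B)) by (apply Rmult_le_pos; [lra|apply exp_ge0]).
    assert (0 <= A * (1 - exp (- exp (- A)))).
    { apply Rmult_le_pos; [lra|].
      assert (exp (- exp (- A)) <= 1) by (apply exp_le_1; generalize (exp_pos (- A)); lra); lra. }
    generalize (Q A HA) (Q B HB) (exp_pos (- / 2 * A)) (exp_pos (- / 2 * B)); intros.
    apply Rabs_le; split; lra.
Qed.

(** * The theta series in exponential coordinates *)

Lemma is_series_scal_R (c : R) (u : nat -> R) (l : R) :
  is_series u l -> is_series (fun n => c * u n) (c * l).
Proof. apply (is_series_scal_l (V := R_NormedModule) c u l). Qed.

Lemma intR_two_sided (d : R) : 0 < d -> exists K, 0 <= K /\ forall (f : R -> R) (C : R), cont f ->
  (forall y, 0 <= y -> Rabs (f y) <= C * exp (- d * y)) ->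
  (forall y, 0 <= y -> Rabs (f (- y)) <= C * exp (- d * y)) ->
  exists l, intR f l /\ Rabs l <= C * K.
Proof.
  intros Hd; destruct (intR_crit d Hd) as [K [HK Hc]].
  exists K; split; [exact HK|]; intros f C Cf H1 H2.
  assert (HC : 0 <= C).
  { specialize (H1 0 (Rle_refl _)); rewrite Rmult_0_r, exp_0 in H1; generalize (Rabs_pos (f 0)); lra. }
  apply Hc; auto; intros y.
  - destruct (Rle_dec 0 y) as [Hy|Hy].
    + eapply Rle_trans; [apply H1, Hy|]; apply Rmult_le_compat_l; [exact HC|apply exp_le; nra].
    + specialize (H2 (- y) ltac:(lra)); rewrite Ropp_involutive in H2.
      replace (d * y) with (- d * - y) by ring; exact H2.
  - destruct (Rle_dec 0 y) as [Hy|Hy]; [apply H1, Hy|].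
    specialize (H2 (- y) ltac:(lra)); rewrite Ropp_involutive in H2.
    eapply Rle_trans; [exact H2|]; apply Rmult_le_compat_l; [exact HC|apply exp_le; nra].
Qed.

Lemma intR_ex_two_sided (d C1 C2 : R) (f : R -> R) : 0 < d -> cont f ->
  (forall y, 0 <= y -> Rabs (f y) <= C1 * exp (- d * y)) ->
  (forall y, 0 <= y -> Rabs (f (- y)) <= C2 * exp (- d * y)) ->
  exists l, intR f l.
Proof.
  intros Hd Cf H1 H2; destruct (intR_two_sided d Hd) as [K [_ HK]].
  destruct (HK f (Rmax C1 C2) Cf) as [l [Hl _]]; [| |exists l; exact Hl]; intros y Hy.
  - eapply Rle_trans; [apply H1, Hy|]; apply Rmult_le_compat_r; [apply exp_ge0|apply Rmax_l].
  - eapply Rle_trans; [apply H2, Hy|]; apply Rmult_le_compat_r; [apply exp_ge0|apply Rmax_r].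
Qed.

Definition vth (y : R) : R := theta (exp y).

Lemma vth_ge_1 (y : R) : 1 <= vth y.
Proof. apply theta_ge_1, exp_pos. Qed.

Lemma vth_pow_ge_1 (j : nat) (y : R) : 1 <= vth y ^ j.
Proof. apply pow_R1_Rle, vth_ge_1. Qed.

Lemma vth_opp (y : R) : vth (- y) = exp (y / 2) * vth y.
Proof.
  unfold vth; rewrite exp_Ropp, theta_inversion by apply exp_pos; f_equal.
  apply sqrt_lem_1; [apply exp_ge0|apply exp_ge0|].
  rewrite <- exp_plus; f_equal; field.
Qed.

Lemma vth_pow_opp (j : nat) (y : R) : vth (- y) ^ j = exp (INR j * y / 2) * vth y ^ j.
Proof.
  rewrite vth_opp, Rpow_mult_distr, exp_pow; do 2 f_equal; field.
Qed.

Definition rcoef (j n : nat) : R := match n with O => 0 | S _ => INR (r j n) end.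

Lemma rcoef_pos (j n : nat) : 0 <= rcoef j n.
Proof. destruct n; simpl; [lra|apply pos_INR]. Qed.

Lemma is_series_vth_pow (j : nat) (y : R) :
  is_series (fun n => rcoef j n * exp (- (PI * INR n * exp y))) (vth y ^ j - 1).
Proof.
  assert (H := is_series_r_theta j (exp y) (exp_pos y)); fold (vth y) in H.
  assert (H0 : is_series (fun n => match n with O => 1 | S _ => 0 end) 1).
  { apply is_series_psum; apply is_lim_seq_incr_1.
    apply is_lim_seq_ext with (fun _ => 1); [|apply is_lim_seq_const].
    intros n; rewrite psum_S, psum_zero by reflexivity; ring. }
  eapply is_series_ext; [|apply (is_series_minus _ _ _ _ H H0)].
  intros n; unfold plus, opp; simpl; destruct n; unfold rcoef.
  - rewrite r_zero_r; simpl (INR 0); rewrite Rmult_0_r, Rmult_0_l, Ropp_0, exp_0; simpl; ring.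
  - ring.
Qed.

(** [vth y] is a power series in [exp (- PI exp y)] with coefficients [r 1 n]. Its terms stay
    bounded at the larger argument belonging to [exp y / 2], so the point is strictly inside the
    disc of convergence. *)
Lemma cont_vth : cont vth.
Proof.
  intros y.
  apply continuous_ext with (fun y => PSeries (fun n => INR (r 1 n)) (exp (- (PI * exp y)))).
  { intros z; rewrite <- (pow_1 (vth z)); symmetry; unfold vth.
    rewrite <- (is_series_unique _ _ (is_series_r_theta 1 (exp z) (exp_pos z))).
    unfold PSeries; apply Series_ext; intros n; rewrite exp_pow; do 2 f_equal; ring. }
  apply (continuous_comp (fun y => exp (- (PI * exp y))) (PSeries (fun n => INR (r 1 n)))).
  - auto_cont.
  - apply continuity_pt_filterlim, PSeries_continuity.
    rewrite Rabs_pos_eq by apply exp_ge0.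
    assert (HP := PI_RGT_0); assert (HE := exp_pos y).
    apply Rbar_lt_le_trans with (Rabs (exp (- (PI * (exp y / 2))))).
    + simpl; rewrite Rabs_pos_eq by apply exp_ge0; apply exp_increasing; nra.
    + rewrite Rabs_pos_eq by apply exp_ge0.
      apply (proj1 (CV_radius_bounded _)); exists (theta (exp y / 2) ^ 1); intros n.
      assert (HS := is_series_r_theta 1 (exp y / 2) ltac:(lra)).
      assert (H0 : forall m, 0 <= INR (r 1 m) * exp (- (PI * INR m * (exp y / 2)))).
      { intros m; apply Rmult_le_pos; [apply pos_INR|apply exp_ge0]. }
      apply Rle_trans with (psum (fun m => INR (r 1 m) * exp (- (PI * INR m * (exp y / 2)))) (S n)).
      * rewrite exp_pow.
        replace (INR n * - (PI * (exp y / 2))) with (- (PI * INR n * (exp y / 2))) by ring.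
        rewrite Rabs_pos_eq by apply H0; cbn [psum].
        generalize (H0 n); intros.
        assert (0 <= psum (fun m => INR (r 1 m) * exp (- (PI * INR m * (exp y / 2)))) n); [|lra].
        clear -H0; induction n as [|n IH]; simpl; [lra|generalize (H0 n); lra].
      * apply psum_le_series; auto.
Qed.

#[export] Hint Resolve cont_vth : cont.

Lemma cont_vth_opp : cont (fun y => vth (- y)).
Proof. apply (cont_comp vth (fun y => - y)); auto_cont. Qed.

#[export] Hint Resolve cont_vth_opp : cont.

(** Termwise comparison with [y = 0]: since [(n - 1) (exp y - 1) >= 0], [exp (- PI n exp y)] is at
    most [exp (PI - PI exp y) exp (- PI n)], and the double exponential beats every
    [exp (- b y)]. *)
Lemma vth_pow_decay (j : nat) (b : R) : 0 < b ->
  exists C, 0 <= C /\ forall y, 0 <= y -> vth y ^ j - 1 <= C * exp (- b * y).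
Proof.
  intros Hb; assert (HP := PI_RGT_0).
  destruct (exp_exp_bound b PI Hb HP) as [K [HK Hexp]].
  assert (HC : 0 <= exp PI * (vth 0 ^ j - 1)).
  { apply Rmult_le_pos; [apply exp_ge0|generalize (vth_pow_ge_1 j 0); lra]. }
  exists (exp PI * (vth 0 ^ j - 1) * K); split; [apply Rmult_le_pos; lra|].
  intros y Hy.
  apply Rle_trans with (exp PI * (vth 0 ^ j - 1) * exp (- (PI * exp y))).
  - assert (HS := is_series_scal_l (exp PI * exp (- (PI * exp y))) _ _ (is_series_vth_pow j 0)).
    rewrite <- (is_series_unique _ _ (is_series_vth_pow j y)).
    replace (exp PI * (vth 0 ^ j - 1) * exp (- (PI * exp y)))
      with (exp PI * exp (- (PI * exp y)) * (vth 0 ^ j - 1)) by ring.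
    apply is_series_unique in HS as HS'.
    change (Series (fun n => exp PI * exp (- (PI * exp y)) * (rcoef j n * exp (- (PI * INR n * exp 0))))
      = exp PI * exp (- (PI * exp y)) * (vth 0 ^ j - 1)) in HS'.
    rewrite <- HS'; apply Series_le; [|eexists; exact HS].
    intros n; split; [apply Rmult_le_pos; [apply rcoef_pos|apply exp_ge0]|].
    destruct n as [|n]; [simpl; rewrite !Rmult_0_l; lra|].
    replace (exp PI * exp (- (PI * exp y)) * (rcoef j (S n) * exp (- (PI * INR (S n) * exp 0))))
      with (rcoef j (S n) * (exp PI * exp (- (PI * exp y)) * exp (- (PI * INR (S n) * exp 0)))) by ring.
    apply Rmult_le_compat_l; [apply rcoef_pos|].
    rewrite <- !exp_plus, exp_0; apply exp_le.
    assert (1 <= exp y) by (apply exp_ge_1, Hy).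
    assert (1 <= INR (S n)) by (rewrite S_INR; generalize (pos_INR n); lra).
    assert (0 <= PI * ((INR (S n) - 1) * (exp y - 1))) by (apply Rmult_le_pos; [lra|apply Rmult_le_pos; lra]).
    nra.
  - rewrite (Rmult_assoc _ K); apply Rmult_le_compat_l; [exact HC|].
    specialize (Hexp y); unfold Rminus in Hexp; rewrite exp_plus in Hexp.
    replace (- b * y) with (- (b * y)) by ring; rewrite (exp_Ropp (b * y)).
    apply (Rmult_le_reg_l (exp (b * y))); [apply exp_pos|].
    replace (exp (b * y) * (K * / exp (b * y))) with K by (field; generalize (exp_pos (b * y)); lra).
    exact Hexp.
Qed.

Lemma vth_pow_bounded (j : nat) : exists C, 0 <= C /\ forall y, 0 <= y -> vth y ^ j <= C.
Proof.
  destruct (vth_pow_decay j 1 Rlt_0_1) as [C [HC H]].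
  exists (1 + C); split; [lra|]; intros y Hy; specialize (H y Hy).
  assert (exp (- (1) * y) <= 1) by (apply exp_le_1; lra).
  nra.
Qed.

Lemma cont_bounded_above (w : R -> R) (Y : R) : cont w -> exists W, 0 <= W /\ forall y, - Y <= y <= Y -> w
    y <= W.
Proof.
  intros Cw; destruct (Rle_dec (- Y) Y) as [HY|HY].
  - destruct (continuity_ab_maj w (- Y) Y HY) as [M [HM _]].
    + intros y _; apply continuity_pt_filterlim, Cw.
    + exists (Rmax 0 (w M)); split; [apply Rmax_l|].
      intros y Hy; eapply Rle_trans; [apply HM, Hy|apply Rmax_r].
  - exists 0; split; [lra|intros; lra].
Qed.

Lemma intR_vth_series (j : nat) (w : R -> R) (I : nat -> R) (J : R) :
  cont w -> (forall y, 0 <= w y) ->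
  (forall n, (1 <= n)%nat -> intR (fun y => exp (- (PI * INR n * exp y)) * w y) (I n)) ->
  intR (fun y => (vth y ^ j - 1) * w y) J -> is_series (fun n => rcoef j n * I n) J.
Proof.
  intros Cw Hw HI HJ; assert (HP := PI_RGT_0).
  assert (Ce : forall n, cont (fun y => exp (- (PI * INR n * exp y)))) by auto_cont.
  apply (intR_series (fun n y => rcoef j n * (exp (- (PI * INR n * exp y)) * w y)) (fun y => (vth y ^ j -
      1) * w y)).
  - intros n; auto_cont.
  - auto_cont.
  - intros n y; apply Rmult_le_pos; [apply rcoef_pos|apply Rmult_le_pos; [apply exp_ge0|apply Hw]].
  - intros y; rewrite Rmult_comm.
    eapply is_series_ext; [|apply (is_series_scal_l (w y) _ _ (is_series_vth_pow j y))].
    intros n; simpl; unfold scal; simpl; unfold mult; simpl; ring.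
  - intros Y; destruct (cont_bounded_above w Y Cw) as [Wb [HW0 HWb]].
    exists (fun n => Wb * (rcoef j n * exp (- (PI * INR n * exp (- Y))))); split.
    + apply (ex_series_scal_l Wb (fun n => rcoef j n * exp (- (PI * INR n * exp (- Y))))).
      eexists; apply is_series_vth_pow.
    + intros n y Hy.
      replace (Wb * (rcoef j n * exp (- (PI * INR n * exp (- Y)))))
        with (rcoef j n * (exp (- (PI * INR n * exp (- Y))) * Wb)) by ring.
      apply Rmult_le_compat_l; [apply rcoef_pos|].
      apply Rmult_le_compat; auto; [apply exp_ge0|apply exp_le, Ropp_le_contravar].
      apply Rmult_le_compat_l; [apply Rmult_le_pos; [lra|apply pos_INR]|apply exp_le; lra].
  - intros n; destruct n as [|n].
    + simpl rcoef; rewrite Rmult_0_l.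
      eapply lim2_ext; [|apply (lim2_const 0)]; intros A B _ _; simpl.
      rewrite (RInt_scal_cont (fun y => exp (- (PI * INR 0 * exp y)) * w y)) by auto_cont; ring.
    + apply intR_scal; [auto_cont|apply HI; lia].
  - exact HJ.
Qed.

(** * The Gaussian integral and the constant of dimension one *)

Lemma lim2_comp (F : R -> R -> R) (u : R -> R) (l : R) :
  (forall M, exists M', forall A, M' <= A -> M <= u A) ->
  lim2 F l -> lim2 (fun A B => F (u A) (u B)) l.
Proof.
  intros Hu HF eps He; destruct (HF eps He) as [M HM]; destruct (Hu M) as [M' HM'].
  exists M'; auto.
Qed.

Lemma intR_gaussian_ex : exists G, intR (fun w => exp (- (PI * w ^ 2))) G.
Proof.
  destruct (intR_ex_two_sided 1 (exp 1) (exp 1) (fun w => exp (- (PI * w ^ 2)))) as [G HG].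
  - lra.
  - auto_cont.
  - intros y Hy; rewrite Rabs_pos_eq by apply exp_ge0.
    rewrite <- exp_plus; apply exp_le; generalize PI2_1; intros.
    assert (2 * y ^ 2 <= PI * y ^ 2) by (apply Rmult_le_compat_r; [apply pow2_ge_0|lra]); nra.
  - intros y Hy; rewrite Rabs_pos_eq by apply exp_ge0.
    rewrite <- exp_plus; apply exp_le; generalize PI2_1; intros.
    assert (2 * y ^ 2 <= PI * y ^ 2) by (apply Rmult_le_compat_r; [apply pow2_ge_0|lra]); nra.
  - exists G; exact HG.
Qed.

(* Symmetrizing under [z -> - z] turns [exp (z / 2)] into half the derivative (up to a constant)
   of [w = 2 sqrt c sinh (z / 2)], for which [w ^ 2 = c (exp z + exp (- z) - 2)]. *)
Lemma intR_bessel_half_aux (G c : R) : intR (fun w => exp (- (PI * w ^ 2))) G -> 0 < c ->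
  intR (fun z => exp (- (PI * c * (exp z + exp (- z)))) * exp (z / 2)) (exp (- (2 * PI * c)) / sqrt c * G).
Proof.
  intros HG Hc; assert (HP := PI_RGT_0).
  assert (Hs : 0 < sqrt c) by (apply sqrt_lt_R0, Hc).
  assert (Hsc : sqrt c ^ 2 = c) by (simpl; rewrite Rmult_1_r; apply sqrt_sqrt; lra).
  set (f := fun z => exp (- (PI * c * (exp z + exp (- z)))) * exp (z / 2)).
  assert (Cf : cont f) by auto_cont.
  assert (HPc : 0 < PI * c) by (apply Rmult_lt_0_compat; lra).
  destruct (exp_exp_bound 1 (PI * c) Rlt_0_1 HPc) as [K [HK Hb]].
  assert (Hf0 : forall y, 0 <= y -> Rabs (f y) <= K * exp (- / 2 * y) /\ Rabs (f (- y)) <= K * exp (- / 2 * y)).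
  { intros y Hy.
    assert (Q : exp (- (PI * c * (exp y + exp (- y)))) <= K * exp (- y)).
    { apply Rle_trans with (exp (1 * y - PI * c * exp y) * exp (- y)).
      - rewrite <- exp_plus; apply exp_le; generalize (exp_pos (- y)); intros; nra.
      - apply Rmult_le_compat_r; [apply exp_ge0|apply Hb]. }
    assert (E : exp (- y) * exp (y / 2) = exp (- / 2 * y)) by (rewrite <- exp_plus; f_equal; field).
    assert (E' : exp (- y) * exp (- y / 2) <= exp (- / 2 * y)) by (rewrite <- exp_plus; apply exp_le; lra).
    split; rewrite Rabs_pos_eq; unfold f; try (apply Rmult_le_pos; apply exp_ge0).
    - rewrite <- E, <- Rmult_assoc; apply Rmult_le_compat_r; [apply exp_ge0|exact Q].
    - rewrite Ropp_involutive, (Rplus_comm (exp (- y))).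
      apply Rle_trans with (K * (exp (- y) * exp (- y / 2))); [|apply Rmult_le_compat_l; lra].
      rewrite <- Rmult_assoc; apply Rmult_le_compat_r; [apply exp_ge0|exact Q]. }
  destruct (intR_ex_two_sided (/ 2) K K f ltac:(lra) Cf) as [l Hl].
  { intros y Hy; apply Hf0, Hy. }
  { intros y Hy; apply Hf0, Hy. }
  replace (exp (- (2 * PI * c)) / sqrt c * G) with l; [exact Hl|].
  set (w := fun z => sqrt c * (exp (z / 2) - exp (- z / 2))).
  set (dw := fun z => sqrt c * ((exp (z / 2) + exp (- z / 2)) / 2)).
  assert (Hw : intR (fun z => dw z * exp (- (PI * w z ^ 2))) G).
  { apply lim2_ext with (fun A B => RInt (fun v => exp (- (PI * v ^ 2))) (- w A) (w B));
      [|apply (lim2_comp (fun A B => RInt (fun v => exp (- (PI * v ^ 2))) (- A) B) w G); [|exact HG]].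
    - intros A B _ _; simpl.
      replace (- w A) with (w (- A)).
      + symmetry; apply (RInt_comp (V := R_CompleteNormedModule) (fun v => exp (- (PI * v ^ 2))) w dw).
        * intros z _; auto_cont.
        * intros z _; split.
          -- unfold w, dw; auto_derive; [trivial|]; unfold Rdiv; field.
          -- auto_cont.
      + unfold w; replace (- - A / 2) with (A / 2) by field; ring.
    - intros M; exists (Rmax 0 (2 * (M / sqrt c + 1))); intros A HA.
      generalize (Rmax_l 0 (2 * (M / sqrt c + 1))) (Rmax_r 0 (2 * (M / sqrt c + 1))); intros H1 H2.
      assert (exp (- A / 2) <= 1).
      { apply exp_le_1; lra. }
      generalize (exp_ineq1_le (A / 2)); intros H3.
      unfold w; apply Rle_trans with (sqrt c * (M / sqrt c)); [right; field; lra|].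
      apply Rmult_le_compat_l; lra. }
  assert (H2 : intR (fun z => f z + f (- z)) (l + l)).
  { apply intR_plus; auto; [apply (cont_comp f); [exact Cf|]|apply intR_refl; auto].
    auto_cont. }
  assert (H3 : intR (fun z => f z + f (- z)) (2 * exp (- (2 * PI * c)) / sqrt c * G)).
  { eapply intR_ext; [|refine (intR_scal (2 * exp (- (2 * PI * c)) / sqrt c) _ _ _ Hw)].
    - intros z; unfold f, dw.
      replace (exp (- (PI * c * (exp (- z) + exp (- - z))))) with (exp (- (PI * c * (exp z + exp (- z)))))
        by (f_equal; rewrite Ropp_involutive; ring).
      replace (exp (- (PI * c * (exp z + exp (- z))))) with (exp (- (2 * PI * c)) * exp (- (PI * w z ^ 2))).
      + field; lra.
      + rewrite <- exp_plus; f_equal; unfold w.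
        rewrite Rpow_mult_distr, Hsc.
        replace (exp z) with (exp (z / 2) * exp (z / 2)) by (rewrite <- exp_plus; f_equal; field).
        replace (exp (- z)) with (exp (- z / 2) * exp (- z / 2)) by (rewrite <- exp_plus; f_equal; field).
        replace (- z / 2) with (- (z / 2)) by field.
        assert (E : exp (z / 2) * exp (- (z / 2)) = 1) by (rewrite <- exp_plus, Rplus_opp_r; apply exp_0).
        replace (- (2 * PI * c)) with (- (2 * PI * c * 1)) by ring; rewrite <- E; ring.
    - auto_cont. }
  generalize (intR_unique _ _ _ H2 H3); unfold Rdiv; intros; lra.
Qed.

(** The Bessel integral of order one half, which is elementary. Translating by [ln (p / x)] reduces
    to the balanced case, where both exponentials have coefficient [p * x]. *)
Lemma intR_bessel_half (G p x : R) : intR (fun w => exp (- (PI * w ^ 2))) G -> 0 < p -> 0 < x ->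
  intR (fun y => exp (- (PI * p ^ 2 * exp y)) * (exp (y / 2) * exp (- (PI * x ^ 2 * exp (- y)))))
    (G * exp (- (2 * PI * (p * x))) / p).
Proof.
  intros HG Hp Hx.
  assert (Hpx : 0 < p * x) by (apply Rmult_lt_0_compat; auto).
  assert (H := intR_bessel_half_aux G (p * x) HG Hpx).
  apply (intR_shift (ln (p / x))) in H.
  2: { auto_cont. }
  apply (intR_scal (sqrt (x / p))) in H.
  2: { auto_cont. }
  assert (Hd : 0 < p / x) by (apply Rdiv_lt_0_compat; auto).
  assert (Hd' : 0 < x / p) by (apply Rdiv_lt_0_compat; auto).
  assert (Hsq : 0 < sqrt (x / p)) by (apply sqrt_lt_R0; auto).
  replace (G * exp (- (2 * PI * (p * x))) / p)
    with (sqrt (x / p) * (exp (- (2 * PI * (p * x))) / sqrt (p * x) * G)).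
  2: { assert (E : sqrt (p * x) = p * sqrt (x / p)).
       { replace (p * x) with (p ^ 2 * (x / p)) by (field; lra).
         rewrite sqrt_mult, sqrt_pow2 by nra; reflexivity. }
       rewrite E; field; lra. }
  eapply intR_ext; [|exact H]; intros y; cbv beta.
  replace (- (y + ln (p / x))) with (- y + - ln (p / x)) by ring.
  replace ((y + ln (p / x)) / 2) with (y / 2 + ln (p / x) / 2) by field.
  rewrite !exp_plus, (exp_Ropp (ln (p / x))), exp_ln by exact Hd.
  replace (exp (ln (p / x) / 2)) with (/ sqrt (x / p)).
  2: { replace (/ sqrt (x / p)) with (sqrt (p / x)).
       - symmetry; rewrite <- (exp_ln (p / x)) at 2 by exact Hd; symmetry.
         apply sqrt_lem_1; try apply exp_ge0; rewrite <- exp_plus; f_equal; field.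
       - rewrite <- sqrt_inv; f_equal; field; lra. }
  replace (- (PI * (p * x) * (exp y * (p / x) + exp (- y) * / (p / x))))
    with (- (PI * p ^ 2 * exp y) + - (PI * x ^ 2 * exp (- y))) by (field; lra).
  rewrite exp_plus; field; lra.
Qed.

(** The error has derivative [- t ^ N / (1 - t)], a geometric remainder; the mean value theorem then
    bounds it by [q ^ N / (1 - q)]. *)
Lemma is_series_log (q : R) : 0 <= q < 1 -> is_series (fun n => q ^ (S n) / INR (S n)) (- ln (1 - q)).
Proof.
  intros Hq; apply is_series_psum.
  assert (Hb : forall N, Rabs (psum (fun n => q ^ (S n) / INR (S n)) N - - ln (1 - q)) <= q ^ N * (/ (1 - q))).
  { intros N.
    destruct (MVT_gen (fun t => psum (fun n => t ^ (S n) / INR (S n)) N + ln (1 - t)) 0 q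
       (fun t => psum (fun n => t ^ n) N - / (1 - t))) as [c [Hc E]].
    - intros t Ht; rewrite Rmin_left, Rmax_right in Ht by lra.
      apply (is_derive_plus (fun t => psum (fun n => t ^ (S n) / INR (S n)) N) (fun t => ln (1 - t))).
      + clear; induction N as [|N IH]; [apply (is_derive_const 0)|].
        cbn [psum]; apply (is_derive_plus (fun t => psum (fun n => t ^ (S n) / INR (S n)) N) (fun t => t ^
            (S N) / INR (S N))); [exact IH|].
        assert (INR (S N) <> 0) by (apply not_0_INR; lia).
        auto_derive; [trivial|]; simpl pred; rewrite S_INR in *; destruct N; field; exact H.
      + auto_derive; [lra|]; field; lra.
    - intros t Ht; rewrite Rmin_left, Rmax_right in Ht by lra.
      apply (continuity_pt_plus (fun t => psum (fun n => t ^ (S n) / INR (S n)) N) (fun t => ln (1 - t))).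
      + clear; induction N as [|N IH]; [apply (continuity_pt_const (fun _ => 0)); intros ? ?; reflexivity|].
        cbn [psum]; apply (continuity_pt_plus (fun t => psum (fun n => t ^ (S n) / INR (S n)) N) (fun t =>
            t ^ (S N) / INR (S N))); [exact IH|].
        apply derivable_continuous_pt, ex_derive_Reals_0.
        auto_derive; trivial.
      + apply derivable_continuous_pt, ex_derive_Reals_0; auto_derive; lra.
    - rewrite Rmin_left, Rmax_right in Hc by lra.
      rewrite (psum_zero (fun n => 0 ^ S n / INR (S n))) in E.
      2: { intros i _; simpl (0 ^ S i); unfold Rdiv; rewrite !Rmult_0_l; reflexivity. }
      rewrite Rminus_0_r, ln_1, Rplus_0_l, !Rminus_0_r in E.
      replace (psum (fun n => q ^ S n / INR (S n)) N - - ln (1 - q))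
        with (psum (fun n => q ^ S n / INR (S n)) N + ln (1 - q)) by ring.
      rewrite E.
      assert (Eg : psum (fun n => c ^ n) N - / (1 - c) = - (c ^ N / (1 - c))).
      { clear E; induction N as [|N IH]; [simpl; field; lra|].
        cbn [psum]; replace (psum (fun n => c ^ n) N + c ^ N - / (1 - c))
          with (psum (fun n => c ^ n) N - / (1 - c) + c ^ N) by ring.
        rewrite IH; simpl; field; lra. }
      rewrite Eg, Rabs_mult, Rabs_Ropp, (Rabs_pos_eq q) by lra.
      assert (0 <= c ^ N) by (apply pow_le; lra).
      assert (c ^ N <= q ^ N) by (apply pow_incr; lra).
      assert (Hi : / (1 - c) <= / (1 - q)) by (apply Rinv_le_contravar; lra).
      assert (Hi0 : 0 < / (1 - c)) by (apply Rinv_0_lt_compat; lra).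
      rewrite Rabs_pos_eq by (apply Rmult_le_pos; lra).
      apply Rle_trans with (c ^ N / (1 - c) * 1).
      + apply Rmult_le_compat_l; [apply Rmult_le_pos|]; lra.
      + rewrite Rmult_1_r; apply Rmult_le_compat; lra. }
  assert (Hq0 : is_lim_seq (fun N => q ^ N * / (1 - q)) 0).
  { replace (Finite 0) with (Finite (0 * / (1 - q))) by (f_equal; ring).
    apply is_lim_seq_mult'; [apply is_lim_seq_geom; rewrite Rabs_pos_eq; lra|apply is_lim_seq_const]. }
  apply is_lim_seq_spec; intros eps; apply is_lim_seq_spec in Hq0.
  destruct (Hq0 eps) as [N0 HN0]; exists N0; intros N HN.
  eapply Rle_lt_trans; [apply Hb|].
  specialize (HN0 N HN); rewrite Rminus_0_r in HN0; apply Rabs_def2 in HN0; lra.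
Qed.

(** The term of index [n] of the theta series contributes [2 G exp (- 2 PI n x) / n], and the
    logarithmic series sums these. This is the origin of the factors [1 - exp (- 2 PI |m|)] in
    [Phi]. *)
Lemma intR_vth_bessel (G x : R) : intR (fun w => exp (- (PI * w ^ 2))) G -> 0 < x ->
  intR (fun y => (vth y - 1) * (exp (y / 2) * exp (- (PI * x ^ 2 * exp (- y)))))
    (- (2 * G * ln (1 - exp (- (2 * PI * x))))).
Proof.
  intros HG Hx; assert (HP := PI_RGT_0).
  set (w := fun y => exp (y / 2) * exp (- (PI * x ^ 2 * exp (- y)))).
  assert (Cw : cont w) by auto_cont.
  assert (Hw : forall y, 0 <= w y) by (intros y; unfold w; apply Rmult_le_pos; apply exp_ge0).
  assert (CF : cont (fun y => (vth y - 1) * w y)) by auto_cont.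
  assert (HX : 0 < PI * x ^ 2) by (apply Rmult_lt_0_compat; [lra|nra]).
  assert (HL : exists L, intR (fun y => (vth y - 1) * w y) L).
  { destruct (vth_pow_decay 1 1 Rlt_0_1) as [C1 [HC1 H1]].
    destruct (vth_pow_bounded 1) as [C2 [HC2 H2]].
    destruct (exp_exp_bound 1 (PI * x ^ 2) Rlt_0_1 HX) as [K [HK Hb]].
    apply (intR_ex_two_sided (/ 2) C1 (C2 * K) _ ltac:(lra) CF); intros y Hy.
    - specialize (H1 y Hy); rewrite pow_1 in H1.
      generalize (vth_ge_1 y) (Hw y); intros.
      rewrite Rabs_pos_eq by (apply Rmult_le_pos; lra).
      apply Rle_trans with (C1 * exp (- (1) * y) * exp (y / 2)).
      + apply Rmult_le_compat; auto; [lra|].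
        unfold w; rewrite <- (Rmult_1_r (exp (y / 2))) at 2; apply Rmult_le_compat_l; [apply exp_ge0|].
        apply Rle_trans with (exp 0); [apply exp_le|rewrite exp_0; lra].
        generalize (exp_pos (- y)); intros; nra.
      + rewrite Rmult_assoc, <- exp_plus; right; do 2 f_equal; field.
    - specialize (H2 y Hy); rewrite pow_1 in H2.
      generalize (vth_ge_1 (- y)) (vth_ge_1 y) (Hw (- y)); intros.
      rewrite Rabs_pos_eq by (apply Rmult_le_pos; lra).
      apply Rle_trans with (vth (- y) * w (- y)); [apply Rmult_le_compat_r; lra|].
      rewrite vth_opp; unfold w; rewrite Ropp_involutive.
      replace (exp (y / 2) * vth y * (exp (- y / 2) * exp (- (PI * x ^ 2 * exp y))))
        with (vth y * (exp (y / 2) * exp (- y / 2) * exp (- (PI * x ^ 2 * exp y)))) by ring.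
      rewrite (Rmult_assoc C2); apply Rmult_le_compat; [lra| |exact H2|].
      { repeat apply Rmult_le_pos; apply exp_ge0. }
      apply Rle_trans with (exp (1 * y - PI * x ^ 2 * exp y) * exp (- y)).
      + rewrite <- !exp_plus; apply exp_le; lra.
      + apply Rmult_le_compat; try apply exp_ge0; [apply Hb|apply exp_le; lra]. }
  destruct HL as [L HL].
  assert (HS : is_series (fun n => 2 * (G * exp (- (2 * PI * (INR (S n) * x))) / INR (S n))) L).
  { apply (intR_series (fun n y => 2 * (exp (- (PI * INR (S n) ^ 2 * exp y)) * w y)) (fun y => (vth y - 1)
      * w y)).
    - auto_cont.
    - exact CF.
    - intros n y; apply Rmult_le_pos; [lra|apply Rmult_le_pos; [apply exp_ge0|apply Hw]].
    - intros y; unfold vth, theta.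
      replace ((1 + 2 * Series (fun n => exp (- (PI * INR (S n) ^ 2 * exp y))) - 1) * w y)
        with ((2 * w y) * Series (fun n => exp (- (PI * INR (S n) ^ 2 * exp y)))) by ring.
      eapply is_series_ext; [|apply (is_series_scal_R (2 * w y)), Series_correct, ex_series_theta, exp_pos].
      intros n; cbv beta; change_eq_R; ring.
    - intros Y; destruct (cont_bounded_above w Y Cw) as [Wb [HW0 HWb]].
      exists (fun n => 2 * Wb * exp (- (PI * INR (S n) ^ 2 * exp (- Y)))); split.
      + apply (ex_series_scal_l (2 * Wb) (fun n => exp (- (PI * INR (S n) ^ 2 * exp (- Y))))).
        apply ex_series_theta, exp_pos.
      + intros n y Hy; rewrite (Rmult_assoc 2 Wb); apply Rmult_le_compat_l; [lra|].
        rewrite (Rmult_comm Wb); apply Rmult_le_compat; auto; [apply exp_ge0|].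
        apply exp_le, Ropp_le_contravar, Rmult_le_compat_l.
        * apply Rmult_le_pos; [lra|apply pow2_ge_0].
        * apply exp_le; lra.
    - intros n; apply intR_scal.
      + auto_cont.
      + apply intR_bessel_half; auto; apply lt_0_INR; lia.
    - exact HL. }
  replace (- (2 * G * ln (1 - exp (- (2 * PI * x))))) with L; [exact HL|].
  assert (Hq : 0 <= exp (- (2 * PI * x)) < 1).
  { split; [apply exp_ge0|rewrite <- exp_0; apply exp_increasing; nra]. }
  rewrite <- (is_series_unique _ _ HS).
  replace (- (2 * G * ln (1 - exp (- (2 * PI * x))))) with (2 * G * - ln (1 - exp (- (2 * PI * x)))) by ring.
  apply is_series_unique; eapply is_series_ext; [|apply (is_series_scal_R (2 * G)), (is_series_log _ Hq)].
  intros n; cbv beta; rewrite exp_pow.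
  replace (INR (S n) * - (2 * PI * x)) with (- (2 * PI * (INR (S n) * x))) by ring.
  unfold Rdiv; change_eq_R; ring.
Qed.

(** * Finite part of the theta integral in dimension one *)

Lemma intR_frullani (p q : R) : 0 < p -> 0 < q ->
  intR (fun z => exp (- (p * exp z)) - exp (- (q * exp z))) (ln q - ln p).
Proof.
  intros Hp Hq.
  assert (C0 : cont (fun z => exp (- exp z))) by auto_cont.
  assert (E : forall t z, 0 < t -> exp (- (t * exp z)) = exp (- exp (z + ln t))).
  { intros t z Ht; rewrite exp_plus, exp_ln by exact Ht; do 2 f_equal; ring. }
  assert (Cs : forall t, cont (fun z => exp (- exp (z + t)))) by auto_cont.
  apply intR_ext with (fun z => exp (- exp (z + ln p)) - exp (- exp (z + ln q))).
  { intros z; rewrite !E by auto; reflexivity. }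
  replace (ln q - ln p) with (((- euler_gamma) - (- euler_gamma)) + (ln q - ln p)) by ring.
  eapply lim2_ext; [|apply (lim2_plus _ _ _ _
    (lim2_minus _ _ _ _ (lim2_shift _ _ (- ln p) (ln p) exponential_integral_const)
      (lim2_shift _ _ (- ln q) (ln q) exponential_integral_const)) (lim2_const (ln q - ln p)))].
  intros A B _ _; cbv beta.
  rewrite RInt_minus_cont by auto.
  rewrite (RInt_shift (fun z => exp (- exp z)) (ln p)), (RInt_shift (fun z => exp (- exp z)) (ln q)) by auto.
  replace (- (A + - ln p)) with (- A + ln p) by ring; replace (- (A + - ln q)) with (- A + ln q) by ring; ring.
Qed.

(* A cutoff near [- oo] for which [chi y * exp (- X exp (- y))] is a Frullani integrand. *)
Definition chi (y : R) : R := 1 - exp (- exp (- y)).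

Lemma chi_bounds (y : R) : 0 <= chi y <= exp (- y).
Proof.
  unfold chi; split.
  - assert (exp (- exp (- y)) <= exp 0) by (apply exp_le; generalize (exp_pos (- y)); lra).
    rewrite exp_0 in H; lra.
  - generalize (one_minus_le_exp (exp (- y))); lra.
Qed.

Lemma cont_chi : cont chi.
Proof. apply ex_derive_cont; intros y; unfold chi; auto_derive; trivial. Qed.

#[export] Hint Resolve cont_chi : cont.

(** By inversion [vth y * exp (y / 2)] is [vth (- y)], so the first term tends to 1 on the left, as
    [chi] does; the difference decays at both ends. *)
Definition rho_th (y : R) : R := (vth y - 1) * exp (y / 2) - chi y.

Lemma cont_vth_half : cont (fun y => (vth y - 1) * exp (y / 2)).
Proof.
  auto_cont.
Qed.

Lemma cont_rho_th : cont rho_th.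
Proof. unfold rho_th; auto_cont. Qed.

#[export] Hint Resolve cont_rho_th cont_vth_half : cont.

Lemma rho_th_bound : exists C, 0 <= C /\ forall y, 0 <= y ->
  Rabs (rho_th y) <= C * exp (- / 2 * y) /\ Rabs (rho_th (- y)) <= C * exp (- / 2 * y).
Proof.
  destruct (vth_pow_decay 1 1 Rlt_0_1) as [C1 [HC1 H1]].
  exists (C1 + 2); split; [lra|]; intros y Hy.
  specialize (H1 y Hy); rewrite pow_1 in H1.
  assert (V := vth_ge_1 y).
  assert (E0 : exp (- (1) * y) <= exp (- / 2 * y)) by (apply exp_le; lra).
  assert (P := exp_pos (- / 2 * y)).
  unfold rho_th; split.
  - assert (H2 : (vth y - 1) * exp (y / 2) <= C1 * exp (- / 2 * y)).
    { replace (- / 2 * y) with (- (1) * y + y / 2) by field; rewrite exp_plus, <- Rmult_assoc.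
      apply Rmult_le_compat_r; [apply exp_ge0|exact H1]. }
    assert (H3 : 0 <= (vth y - 1) * exp (y / 2)) by (apply Rmult_le_pos; [lra|apply exp_ge0]).
    generalize (chi_bounds y); replace (- y) with (- (1) * y) by ring; intros.
    apply Rabs_le; split; nra.
  - assert (E1 : (vth (- y) - 1) * exp (- y / 2) = vth y - exp (- / 2 * y)).
    { rewrite vth_opp; replace (- y / 2) with (- / 2 * y) by field.
      rewrite Rmult_minus_distr_r, Rmult_1_l.
      replace (exp (y / 2) * vth y * exp (- / 2 * y)) with (vth y * (exp (y / 2) * exp (- / 2 * y))) by ring.
      rewrite <- exp_plus; replace (y / 2 + - / 2 * y) with 0 by field; rewrite exp_0; ring. }
    rewrite E1; unfold chi; rewrite Ropp_involutive.
    assert (exp (- exp y) <= exp (- / 2 * y)) by (apply exp_le; generalize (exp_ineq1_le y); lra).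
    generalize (exp_pos (- exp y)); intros.
    apply Rabs_le; split; nra.
Qed.

(** The middle term is at most [Rmin 1 (exp v)]. The exponent [1 / 4] lies below the decay rate
    [1 / 2] of [rho_th], so the product of the two bounds remains integrable. *)
Lemma one_minus_exp_le_quarter (v : R) : 0 <= 1 - exp (- exp v) <= exp (v / 4).
Proof.
  assert (H0 : exp (- exp v) <= 1).
  { apply exp_le_1; generalize (exp_pos v); lra. }
  split; [lra|].
  destruct (Rle_dec v 0) as [Hv|Hv].
  - apply Rle_trans with (exp v); [generalize (one_minus_le_exp (exp v)); lra|apply exp_le; lra].
  - apply Rle_trans with (exp 0); [rewrite exp_0; generalize (exp_pos (- exp v)); lra|apply exp_le; lra].
Qed.

Lemma intR_chi_const : lim2 (fun A B => RInt chi (- A) B - A) euler_gamma.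
Proof.
  replace euler_gamma with (- 1 * - euler_gamma) by ring.
  eapply lim2_ext; [|apply (lim2_scal (- 1)), lim2_swap, exponential_integral_const].
  intros A B _ _; cbv beta.
  assert (C0 : cont (fun z => exp (- exp z))) by auto_cont.
  assert (C1 : cont (fun z => exp (- exp (- z)))) by auto_cont.
  unfold chi; rewrite (RInt_minus_cont (fun _ => 1)) by auto using cont_const.
  rewrite RInt_const, (RInt_refl (fun z => exp (- exp z))), Ropp_involutive by auto.
  unfold scal; simpl; unfold mult; simpl; ring.
Qed.

(** The factor [exp (- X exp (- y))] regularizes the divergence on the left. Under it the theta term
    becomes the logarithm of [intR_vth_bessel] and the [chi] term a Frullani integral, while for
    [rho_th] the factor changes the integral by [O(X ^ (1 / 4))], with [X = exp (- 4 M)]. *)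
Lemma vth_bessel_asymptotics (G Rr : R) : intR (fun w => exp (- (PI * w ^ 2))) G -> intR rho_th Rr ->
  exists C, forall M, 0 <= M ->
  Rabs (- (2 * G * ln (1 - exp (- (2 * sqrt PI * exp (- 2 * M))))) - (ln (1 + exp (- 4 * M)) + 4 * M) - Rr)
    <= C * exp (- M).
Proof.
  intros HG HR; assert (HP := PI_RGT_0).
  assert (HsP : 0 < sqrt PI) by (apply sqrt_lt_R0; lra).
  destruct rho_th_bound as [C [HC HrC]].
  destruct (intR_two_sided (/ 4) ltac:(lra)) as [K [HK Hcrit]].
  exists (C * K); intros M HM.
  set (X := exp (- 4 * M)); assert (HX : 0 < X) by apply exp_pos.
  set (x := exp (- 2 * M) / sqrt PI).
  assert (Hx : 0 < x) by (apply Rdiv_lt_0_compat; [apply exp_pos|exact HsP]).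
  assert (EX : PI * x ^ 2 = X).
  { unfold x, X, Rdiv; rewrite Rpow_mult_distr, exp_pow, <- Rinv_pow_depr by lra.
    simpl (sqrt PI ^ 2); rewrite Rmult_1_r, sqrt_sqrt by lra.
    replace (INR 2 * (- 2 * M)) with (- 4 * M) by (simpl; ring); field; lra. }
  assert (H1 := intR_vth_bessel G x HG Hx).
  rewrite EX in H1.
  replace (2 * PI * x) with (2 * sqrt PI * exp (- 2 * M)) in H1.
  2: { unfold x; rewrite <- (sqrt_sqrt PI) at 2 by lra; field; lra. }
  assert (H2 : intR (fun y => exp (- (X * exp (- y))) - exp (- ((X + 1) * exp (- y)))) (ln (X + 1) - ln X)).
  { apply (intR_refl (fun z => exp (- (X * exp z)) - exp (- ((X + 1) * exp z)))).
    - auto_cont.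
    - apply intR_frullani; lra. }
  assert (Ce : cont (fun y => exp (- (X * exp (- y))))) by auto_cont.
  assert (Ce1 : cont (fun y => exp (- ((X + 1) * exp (- y))))) by auto_cont.
  assert (Cv : cont (fun y => (vth y - 1) * (exp (y / 2) * exp (- (X * exp (- y)))))) by auto_cont.
  set (D := fun y => rho_th y * exp (- (X * exp (- y))) - rho_th y).
  assert (HD : intR D (- (2 * G * ln (1 - exp (- (2 * sqrt PI * exp (- 2 * M))))) - (ln (X + 1) - ln X) - Rr)).
  { eapply intR_ext; [|apply (intR_minus _ _ _ _ (cont_minus _ _ Cv (cont_minus _ _ Ce Ce1)) cont_rho_th
      (intR_minus _ _ _ _ Cv (cont_minus _ _ Ce Ce1) H1 H2) HR)].
    intros y; cbv beta; unfold D, rho_th, chi.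
    replace (- ((X + 1) * exp (- y))) with (- (X * exp (- y)) + - exp (- y)) by ring.
    rewrite exp_plus; ring. }
  assert (HDb : forall y, Rabs (D y) <= Rabs (rho_th y) * (exp (- M) * exp (- y / 4))).
  { intros y; unfold D.
    replace (rho_th y * exp (- (X * exp (- y))) - rho_th y) with (rho_th y * (exp (- (X * exp (- y))) - 1))
        by ring.
    rewrite Rabs_mult; apply Rmult_le_compat_l; [apply Rabs_pos|].
    unfold X; rewrite <- exp_plus.
    generalize (one_minus_exp_le_quarter (- 4 * M + - y)); intros Hq.
    replace ((- 4 * M + - y) / 4) with (- M + - y / 4) in Hq by field.
    rewrite (exp_plus (- M)) in Hq; apply Rabs_le; split; lra. }
  replace (- (2 * G * ln (1 - exp (- (2 * sqrt PI * exp (- 2 * M))))) - (ln (1 + X) + 4 * M) - Rr)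
    with (- (2 * G * ln (1 - exp (- (2 * sqrt PI * exp (- 2 * M))))) - (ln (X + 1) - ln X) - Rr).
  2: { unfold X at 2; rewrite ln_exp, (Rplus_comm X); ring. }
  destruct (Hcrit D (C * exp (- M))) as [l [Hl Hlb]].
  - auto_cont.
  - intros y Hy; eapply Rle_trans; [apply HDb|].
    destruct (HrC y Hy) as [H3 _].
    replace (C * exp (- M) * exp (- / 4 * y)) with ((C * 1) * (exp (- M) * exp (- / 4 * y))) by ring.
    apply Rmult_le_compat; [apply Rabs_pos|apply Rmult_le_pos; apply exp_ge0| |].
    + eapply Rle_trans; [exact H3|apply Rmult_le_compat_l; [exact HC|]].
      apply exp_le_1; lra.
    + right; do 2 f_equal; field.
  - intros y Hy; eapply Rle_trans; [apply HDb|].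
    destruct (HrC y Hy) as [_ H3].
    replace (C * exp (- M) * exp (- / 4 * y)) with ((C * exp (- / 2 * y)) * (exp (- M) * exp (- - y / 4))).
    + apply Rmult_le_compat_r; [apply Rmult_le_pos; apply exp_ge0|exact H3].
    + replace (- / 4 * y) with (- / 2 * y + - - y / 4) by field; rewrite exp_plus; ring.
  - rewrite (intR_unique _ _ _ HD Hl).
    replace (C * K * exp (- M)) with (C * exp (- M) * K) by ring; exact Hlb.
Qed.

Lemma is_lim_seq_exp_neg (c : R) : 0 < c -> is_lim_seq (fun n => exp (- c * INR n)) 0.
Proof.
  intros Hc; apply is_lim_seq_ext with (fun n => exp (- c) ^ n).
  - intros n; rewrite exp_pow; f_equal; ring.
  - apply is_lim_seq_geom; rewrite Rabs_pos_eq by apply exp_ge0.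
    rewrite <- exp_0; apply exp_increasing; lra.
Qed.

Lemma ln_one_minus_exp_bounds (t : R) : 0 < t -> 0 <= ln t - ln (1 - exp (- t)) <= t.
Proof.
  intros Ht.
  assert (H1 : 1 - exp (- t) <= t) by (generalize (one_minus_le_exp t); lra).
  assert (H0 : 0 < 1 - exp (- t)).
  { assert (exp (- t) < exp 0) by (apply exp_increasing; lra); rewrite exp_0 in H; lra. }
  assert (H2 : t * exp (- t) <= 1 - exp (- t)).
  { generalize (exp_ineq1_le t) (exp_pos (- t)); intros H P.
    apply (Rmult_le_compat_r (exp (- t))) in H; [|lra].
    rewrite <- (exp_plus t), Rplus_opp_r, exp_0 in H; lra. }
  split.
  - assert (ln (1 - exp (- t)) <= ln t) by (apply ln_le; lra); lra.
  - apply ln_le in H2; [|apply Rmult_lt_0_compat; [lra|apply exp_pos]].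
    rewrite ln_mult, ln_exp in H2 by (try apply exp_pos; lra); lra.
Qed.

(* The Gaussian integral [G = 1] and the constant come out of the same asymptotic expansion:
   a bounded sequence [(4 G - 4) n - const + o(1)] forces [G = 1]. *)
Lemma gaussian_and_theta_const :
  intR (fun w => exp (- (PI * w ^ 2))) 1 /\
  lim2 (fun A B => RInt (fun y => (vth y - 1) * exp (y / 2)) (- A) B - A) (euler_gamma - ln (4 * PI)).
Proof.
  assert (HP := PI_RGT_0).
  assert (HsP : 0 < sqrt PI) by (apply sqrt_lt_R0; lra).
  destruct intR_gaussian_ex as [G HG].
  destruct rho_th_bound as [C [HC HrC]].
  destruct (intR_ex_two_sided (/ 2) C C rho_th ltac:(lra) cont_rho_th) as [Rr HR].
  { intros y Hy; exact (proj1 (HrC y Hy)). }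
  { intros y Hy; exact (proj2 (HrC y Hy)). }
  destruct (vth_bessel_asymptotics G Rr HG HR) as [K HK].
  (* With [ln t = ln (2 sqrt PI) - 2 M], the asymptotic expansion reads
     [(4 G - 4) M - c0 = o(1)]. *)
  set (c0 := 2 * G * ln (2 * sqrt PI) + Rr).
  assert (Hlim : is_lim_seq (fun n => (4 * G - 4) * INR n) c0).
  { apply is_lim_seq_spec; intros eps.
    assert (H0 : is_lim_seq (fun n => (Rabs G * 2 * (2 * sqrt PI) + 1 + Rabs K) * exp (- (1) * INR n)) 0).
    { replace (Finite 0) with (Finite ((Rabs G * 2 * (2 * sqrt PI) + 1 + Rabs K) * 0)) by (f_equal; ring).
      apply is_lim_seq_mult'; [apply is_lim_seq_const|apply is_lim_seq_exp_neg; lra]. }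
    apply is_lim_seq_spec in H0; destruct (H0 eps) as [N HN]; exists N; intros n Hn.
    specialize (HN n Hn); rewrite Rminus_0_r in HN; apply Rabs_def2 in HN; destruct HN as [HN _].
    eapply Rle_lt_trans; [|exact HN].
    assert (Hn0 := pos_INR n); specialize (HK (INR n) Hn0).
    set (M := INR n) in *.
    set (t := 2 * sqrt PI * exp (- 2 * M)) in *.
    assert (Ht : 0 < t) by (apply Rmult_lt_0_compat; [lra|apply exp_pos]).
    assert (B1 := ln_one_minus_exp_bounds t Ht).
    assert (El : ln t = ln (2 * sqrt PI) - 2 * M).
    { unfold t; rewrite ln_mult, ln_exp by (try apply exp_pos; lra); ring. }
    set (b := ln t - ln (1 - exp (- t))) in *.
    assert (Eb : ln (1 - exp (- t)) = ln (2 * sqrt PI) - 2 * M - b) by (unfold b; lra).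
    assert (B2 : 0 <= ln (1 + exp (- 4 * M)) <= exp (- 4 * M)).
    { assert (P := exp_pos (- 4 * M)); split.
      - rewrite <- ln_1; apply ln_le; lra.
      - rewrite <- (ln_exp (exp (- 4 * M))) at 2; apply ln_le; [lra|apply exp_ineq1_le]. }
    set (e := ln (1 + exp (- 4 * M))) in *.
    rewrite Eb in HK.
    assert (E1 : exp (- 4 * M) <= exp (- (1) * M)) by (apply exp_le; lra).
    assert (E2 : exp (- 2 * M) <= exp (- (1) * M)) by (apply exp_le; lra).
    replace (exp (- M)) with (exp (- (1) * M)) in HK by (f_equal; ring).
    set (u := exp (- (1) * M)) in *.
    assert (Hu : 0 < u) by apply exp_pos.
    assert (B3 : b <= 2 * sqrt PI * u).
    { apply Rle_trans with t; [lra|unfold t; apply Rmult_le_compat_l; lra]. }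
    replace ((4 * G - 4) * M - c0)
      with ((- (2 * G * (ln (2 * sqrt PI) - 2 * M - b)) - (e + 4 * M) - Rr) - 2 * G * b + e)
      by (unfold c0; ring).
    eapply Rle_trans; [apply Rabs_triang|]; eapply Rle_trans; [apply Rplus_le_compat_r, Rabs_triang|].
    rewrite Rabs_Ropp, Rabs_mult, (Rabs_pos_eq b), (Rabs_pos_eq e), Rabs_mult, (Rabs_pos_eq 2) by lra.
    assert (B4 : Rabs G * b <= Rabs G * (2 * sqrt PI * u)) by (apply Rmult_le_compat_l; [apply Rabs_pos|lra]).
    assert (B5 : K * u <= Rabs K * u) by (apply Rmult_le_compat_r; [lra|apply Rle_abs]).
    lra. }
  (* Consecutive terms of a convergent sequence differ by [o(1)], and here by the constant
     [4 G - 4]. *)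
  assert (Hd : 4 * G - 4 = 0).
  { assert (Hlim' : is_lim_seq (fun n => (4 * G - 4) * INR (S n)) c0).
    { apply (is_lim_seq_incr_1 (fun n => (4 * G - 4) * INR n)), Hlim. }
    generalize (is_lim_seq_minus' _ _ _ _ Hlim' Hlim); intros H.
    apply (is_lim_seq_ext _ (fun _ => 4 * G - 4)) in H.
    - apply is_lim_seq_unique in H; rewrite Lim_seq_const in H; injection H; lra.
    - intros n; rewrite S_INR; ring. }
  assert (Hc0 : c0 = 0).
  { apply (is_lim_seq_ext _ (fun _ => 0)) in Hlim.
    - apply is_lim_seq_unique in Hlim; rewrite Lim_seq_const in Hlim; injection Hlim; lra.
    - intros n; rewrite Hd; ring. }
  assert (HG1 : G = 1) by lra.
  split; [rewrite HG1 in HG; exact HG|].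
  assert (HRv : Rr = - ln (4 * PI)).
  { unfold c0 in Hc0; rewrite HG1 in Hc0.
    replace (4 * PI) with ((2 * sqrt PI) * (2 * sqrt PI)).
    - rewrite ln_mult by lra; lra.
    - rewrite <- (sqrt_sqrt PI) at 3 by lra; ring. }
  replace (euler_gamma - ln (4 * PI)) with (Rr + euler_gamma) by (rewrite HRv; ring).
  eapply lim2_ext; [|apply (lim2_plus _ _ _ _ HR intR_chi_const)].
  intros A B _ _; cbv beta; unfold rho_th.
  rewrite RInt_minus_cont by auto_cont; ring.
Qed.

(** * Kronecker limit formula *)

(** The exponent lies half a unit to the right of the critical value [j / 2], so the integrand still
    decays on the left by inversion and the Mellin transform converges without a finite part. For
    [j = 0] both sides are zero. *)
Lemma intR_vth_zeta (j : nat) : let a := (INR j + 1) / 2 in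
  intR (fun y => (vth y ^ j - 1) * exp (a * y)) (Gamma a * Rpower PI (- a) * zeta j a).
Proof.
  intros a; assert (HP := PI_RGT_0); assert (Hj := pos_INR j).
  assert (Ha : / 2 <= a) by (unfold a; lra).
  set (w := fun y => exp (a * y)).
  assert (Cw : cont w) by auto_cont.
  assert (CF : cont (fun y => (vth y ^ j - 1) * w y)) by auto_cont.
  assert (HJ : exists J, intR (fun y => (vth y ^ j - 1) * w y) J).
  { destruct (vth_pow_decay j (a + / 2) ltac:(lra)) as [C1 [HC1 H1]].
    destruct (vth_pow_bounded j) as [C2 [HC2 H2]].
    apply (intR_ex_two_sided (/ 2) C1 C2 _ ltac:(lra) CF); intros y Hy.
    - specialize (H1 y Hy); generalize (vth_pow_ge_1 j y); intros.
      rewrite Rabs_pos_eq by (apply Rmult_le_pos; [lra|apply exp_ge0]).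
      replace (- / 2 * y) with (- (a + / 2) * y + a * y) by ring.
      rewrite exp_plus, <- Rmult_assoc; apply Rmult_le_compat_r; [apply exp_ge0|exact H1].
    - specialize (H2 y Hy); generalize (vth_pow_ge_1 j (- y)); intros.
      rewrite Rabs_pos_eq by (apply Rmult_le_pos; [lra|apply exp_ge0]).
      apply Rle_trans with (vth (- y) ^ j * w (- y)); [apply Rmult_le_compat_r; [apply exp_ge0|lra]|].
      rewrite vth_pow_opp; unfold w.
      replace (exp (INR j * y / 2) * vth y ^ j * exp (a * - y))
        with (vth y ^ j * (exp (INR j * y / 2) * exp (a * - y))) by ring.
      rewrite <- exp_plus; replace (INR j * y / 2 + a * - y) with (- / 2 * y) by (unfold a; field).
      apply Rmult_le_compat_r; [apply exp_ge0|exact H2]. }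
  destruct HJ as [J HJ].
  assert (HS : is_series (fun n => rcoef j n * (Gamma a * Rpower (PI * INR n) (- a))) J).
  { apply (intR_vth_series j w); auto; [intros y; apply exp_ge0|].
    intros n Hn; eapply intR_ext; [|apply intR_gamma_scaled].
    - intros y; unfold w; rewrite <- exp_plus; f_equal; ring.
    - lra.
    - apply Rmult_lt_0_compat; [lra|apply lt_0_INR; lia]. }
  replace (Gamma a * Rpower PI (- a) * zeta j a) with J; [exact HJ|].
  rewrite <- (is_series_unique _ _ HS); unfold zeta; rewrite <- Series_scal_l.
  apply Series_ext; intros n; destruct n as [|n]; simpl rcoef; [ring|].
  rewrite <- Rpower_mult_distr by (auto; apply lt_0_INR; lia); ring.
Qed.

(** After [y -> - y], expand [vth ^ j - 1] over the lattice of rank [k - 1]: a vector of length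
    [sqrt n] contributes [intR_vth_bessel] at [x = sqrt n] with [G = 1], that is [- 2] times the
    logarithm of its factor in [Phi k]. *)
Lemma intR_vth_Phi (k : nat) : let j := (k - 1)%nat in
  intR (fun y => (vth y - 1) * exp (y / 2) * (vth (- y) ^ j - 1)) (- (2 * ln (Phi k))).
Proof.
  intros j; assert (HP := PI_RGT_0); assert (Hj := pos_INR j).
  destruct gaussian_and_theta_const as [HG _].
  set (f := fun y => (vth y - 1) * exp (y / 2) * (vth (- y) ^ j - 1)).
  assert (Cf : cont f) by auto_cont.
  set (w := fun y => (vth (- y) - 1) * exp (- y / 2)).
  assert (Cneg : cont (fun y => - y)) by auto_cont.
  assert (Cw : cont w) by (apply (cont_comp (fun y => (vth y - 1) * exp (y / 2)) (fun y => - y)); [apply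
      cont_vth_half|exact Cneg]).
  assert (Hw : forall y, 0 <= w y).
  { intros y; apply Rmult_le_pos; [generalize (vth_ge_1 (- y)); lra|apply exp_ge0]. }
  assert (HJ : exists J, intR f J).
  { destruct (vth_pow_decay 1 (INR j / 2 + 1) ltac:(lra)) as [C1 [HC1 H1]].
    destruct (vth_pow_bounded j) as [C2 [HC2 H2]].
    destruct (vth_pow_bounded 1) as [C3 [HC3 H3]].
    destruct (vth_pow_decay j (/ 2) ltac:(lra)) as [C4 [HC4 H4]].
    apply (intR_ex_two_sided (/ 2) (C1 * C2) (C3 * C4) _ ltac:(lra) Cf); intros y Hy.
    - specialize (H1 y Hy); rewrite pow_1 in H1; specialize (H2 y Hy).
      assert (V1 := vth_ge_1 y); assert (V2 := vth_pow_ge_1 j (- y)); assert (V3 := vth_pow_ge_1 j y).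
      unfold f; rewrite Rabs_pos_eq by (repeat apply Rmult_le_pos; try apply exp_ge0; lra).
      apply Rle_trans with ((vth y - 1) * exp (y / 2) * vth (- y) ^ j).
      { apply Rmult_le_compat_l; [apply Rmult_le_pos; [lra|apply exp_ge0]|lra]. }
      rewrite vth_pow_opp.
      apply Rle_trans with (C1 * exp (- (INR j / 2 + 1) * y) * exp (y / 2) * (exp (INR j * y / 2) * C2)).
      + apply Rmult_le_compat; [apply Rmult_le_pos; [lra|apply exp_ge0]|apply Rmult_le_pos; [apply
          exp_ge0|lra]| |].
        * apply Rmult_le_compat_r; [apply exp_ge0|exact H1].
        * apply Rmult_le_compat_l; [apply exp_ge0|exact H2].
      + replace (- / 2 * y) with (- (INR j / 2 + 1) * y + y / 2 + INR j * y / 2) by field.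
        rewrite !exp_plus; right; ring.
    - specialize (H3 y Hy); rewrite pow_1 in H3; specialize (H4 y Hy).
      assert (V1 := vth_ge_1 y); assert (V2 := vth_ge_1 (- y)); assert (V3 := vth_pow_ge_1 j y).
      unfold f; rewrite Ropp_involutive.
      rewrite Rabs_pos_eq by (repeat apply Rmult_le_pos; try apply exp_ge0; lra).
      rewrite (Rmult_assoc C3); apply Rmult_le_compat; [apply Rmult_le_pos; [lra|apply exp_ge0]|lra| |exact H4].
      apply Rle_trans with (vth (- y) * exp (- y / 2)); [apply Rmult_le_compat_r; [apply exp_ge0|lra]|].
      rewrite vth_opp, (Rmult_comm (exp (y / 2))), Rmult_assoc, <- exp_plus.
      replace (y / 2 + - y / 2) with 0 by field; rewrite exp_0; lra. }
  destruct HJ as [J HJ].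
  set (g := fun n => match n with O => 0 | S _ => - ln (1 - exp (- (2 * PI * sqrt (INR n)))) end).
  assert (Hg : forall n, (0 < n)%nat -> 0 < 1 - exp (- (2 * PI * sqrt (INR n))) <= 1).
  { intros n Hn; assert (0 < sqrt (INR n)) by (apply sqrt_lt_R0, lt_0_INR; lia).
    assert (exp (- (2 * PI * sqrt (INR n))) < exp 0) by (apply exp_increasing; nra).
    rewrite exp_0 in H0; generalize (exp_pos (- (2 * PI * sqrt (INR n)))); lra. }
  assert (HS : is_series (fun n => rcoef j n * (2 * g n)) J).
  { apply (intR_vth_series j w (fun n => 2 * g n)); auto.
    - intros n Hn; destruct n as [|n]; [lia|].
      assert (Hs : 0 < sqrt (INR (S n))) by (apply sqrt_lt_R0, lt_0_INR; lia).
      assert (H := intR_refl _ _ (cont_mult _ _ (cont_minus _ _ cont_vth (cont_const 1))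
         (cont_mult (fun y => exp (y / 2)) (fun y => exp (- (PI * sqrt (INR (S n)) ^ 2 * exp (- y))))
            ltac:(auto_cont)
            ltac:(auto_cont)))
         (intR_vth_bessel 1 (sqrt (INR (S n))) HG Hs)).
      replace (2 * g (S n)) with (- (2 * 1 * ln (1 - exp (- (2 * PI * sqrt (INR (S n))))))) by (unfold g; ring).
      eapply intR_ext; [|exact H]; intros y; cbv beta; unfold w.
      rewrite Ropp_involutive, <- Rsqr_pow2, Rsqr_sqrt by apply pos_INR; ring.
    - eapply intR_ext; [|apply (intR_refl f J Cf HJ)].
      intros y; unfold f, w; rewrite Ropp_involutive; ring. }
  assert (HPhi : Phi k = exp (- (J / 2))).
  { apply (Phi_eq_exp k g).
    - reflexivity.
    - intros n; destruct n as [|n]; [simpl; lra|].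
      destruct (Hg (S n) ltac:(lia)) as [H1 H2]; apply ln_le in H2; [|exact H1].
      rewrite ln_1 in H2; unfold g; lra.
    - intros n Hn; destruct n as [|n]; [lia|].
      unfold g; rewrite Ropp_involutive, exp_ln by (apply Hg; lia); reflexivity.
    - replace (J / 2) with (/ 2 * J) by field.
      eapply is_series_ext; [|apply (is_series_scal_R (/ 2) _ _ HS)].
      intros n; cbv beta; fold j; change_eq_R.
      destruct n as [|n]; simpl; field. }
  rewrite HPhi, ln_exp; replace (- (2 * - (J / 2))) with J by field; exact HJ.
Qed.

(* The finite part of the Epstein zeta function at its pole (Kronecker limit formula). *)
Lemma vth_pow_mellin_const (k : nat) : (1 <= k)%nat -> let a := INR k / 2 in
  lim2 (fun A B => RInt (fun y => (vth y ^ k - 1) * exp (a * y)) (- A) B - A)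
    (Gamma a * Rpower PI (- a) * zeta (k - 1) a + euler_gamma - 2 * ln (Phi k) - ln (4 * PI)).
Proof.
  intros Hk a; set (j := (k - 1)%nat).
  assert (Ek : k = S j) by (unfold j; lia).
  assert (Ea : a = (INR j + 1) / 2) by (unfold a; rewrite Ek, S_INR; reflexivity).
  destruct gaussian_and_theta_const as [_ H3].
  assert (H1 := intR_vth_zeta j); cbv zeta in H1; rewrite <- Ea in H1.
  assert (H2 := intR_vth_Phi k); cbv zeta in H2; fold j in H2.
  replace (Gamma a * Rpower PI (- a) * zeta j a + euler_gamma - 2 * ln (Phi k) - ln (4 * PI))
    with ((Gamma a * Rpower PI (- a) * zeta j a + - (2 * ln (Phi k))) + (euler_gamma - ln (4 * PI))) by ring.
  eapply lim2_ext; [|apply (lim2_plus _ _ _ _ (lim2_plus _ _ _ _ H1 H2) H3)].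
  intros A B _ _; cbv beta.
  assert (C1 : cont (fun y => (vth y ^ j - 1) * exp (a * y))) by auto_cont.
  assert (C2 : cont (fun y => (vth y - 1) * exp (y / 2) * (vth (- y) ^ j - 1))) by auto_cont.
  (* Pointwise, [(vth y ^ k - 1) exp (a y)] is [(vth y ^ j - 1) exp (a y)] plus
     [(vth y - 1) exp (y / 2) vth (- y) ^ j]; writing the last power as [(vth (- y) ^ j - 1) + 1]
     gives the three integrals. *)
  match goal with |- ?x + ?y + (?z - A) = ?w - A => replace w with (x + y + z); [ring|] end.
  rewrite <- (RInt_plus_cont _ _ _ _ C1 C2).
  rewrite <- (RInt_plus_cont _ _ _ _ (cont_plus _ _ C1 C2) cont_vth_half).
  apply RInt_ext; intros y _; cbv beta.
  rewrite vth_pow_opp, Ek.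
  replace (exp (a * y)) with (exp (y / 2) * exp (INR j * y / 2)).
  - change_eq_R; simpl; ring.
  - rewrite <- exp_plus; f_equal; rewrite Ea; field.
Qed.

(** * Kummer and Whittaker functions *)

(** The integral as a function of the integrand, so that [kummer] can be differentiated in [x]. *)
Definition intR_val (f : R -> R) : R := Lim_seq (fun n => RInt f (- INR n) (INR n)).

Lemma intR_val_unique (f : R -> R) (l : R) : intR f l -> intR_val f = l.
Proof.
  intros Hf; unfold intR_val.
  assert (H : is_lim_seq (fun n => RInt f (- INR n) (INR n)) l).
  { apply is_lim_seq_spec; intros eps; destruct (Hf eps (cond_pos eps)) as [M HM].
    destruct (nfloor_ex (Rmax M 0) (Rmax_r _ _)) as [N [_ HN]].
    exists (S N); intros n Hn; apply le_INR in Hn; rewrite S_INR in Hn.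
    generalize (Rmax_l M 0); intros; apply HM; lra. }
  rewrite (is_lim_seq_unique _ _ H); reflexivity.
Qed.

Lemma sigm_refl (a y : R) : sigm a y = exp (a * y) * sigm a (- y).
Proof.
  unfold sigm, Rpower; rewrite <- exp_plus, Ropp_involutive; f_equal.
  assert (E : ln (1 + exp y) = y + ln (1 + exp (- y))).
  { rewrite <- (ln_exp y) at 2; rewrite <- ln_mult by (generalize (exp_pos y) (exp_pos (- y)); lra).
    f_equal; rewrite Rmult_plus_distr_l, <- exp_plus, Rplus_opp_r, exp_0; ring. }
  rewrite E; ring.
Qed.

Lemma exp_minus_sigm (a y : R) : 0 <= a -> 0 <= exp (a * y) - sigm a y <= a * exp ((a + 1) * y).
Proof.
  intros Ha; split; [generalize (sigm_le_exp a y Ha); lra|].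
  rewrite sigm_refl; generalize (one_minus_sigm a (- y) Ha) (exp_pos (a * y)); rewrite Ropp_involutive; intros.
  replace ((a + 1) * y) with (a * y + y) by ring; rewrite exp_plus; nra.
Qed.

(** For [i = 0], the integrand of [Gamma(a) U(a, 1, x)] in the variable [exp y]; the factor
    [exp (i y)] makes it the [i]-th derivative in [x] up to sign. The form [x * - exp y] is that of
    [is_derive_intR_exp]. *)
Definition kummer_kernel (a : R) (i : nat) (x y : R) : R := exp (INR i * y) * sigm a y * exp (x * - exp y).

Definition kummer (a : R) (i : nat) (x : R) : R := intR_val (kummer_kernel a i x).

Lemma cont_kummer_kernel (a : R) (i : nat) (x : R) : cont (kummer_kernel a i x).
Proof.
  unfold kummer_kernel; auto_cont.
Qed.

#[export] Hint Resolve cont_kummer_kernel : cont.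

Lemma kummer_kernel_pos (a : R) (i : nat) (x y : R) : 0 < kummer_kernel a i x y.
Proof. repeat apply Rmult_lt_0_compat; try apply exp_pos; apply sigm_pos. Qed.

Lemma kummer_kernel_le (a : R) (i : nat) (x y : R) : 0 <= a ->
  kummer_kernel a i x y <= exp ((a + INR i) * y - x * exp y).
Proof.
  intros Ha; unfold kummer_kernel.
  replace ((a + INR i) * y - x * exp y) with (INR i * y + a * y + x * - exp y) by ring.
  rewrite !exp_plus; apply Rmult_le_compat_r; [apply exp_ge0|].
  apply Rmult_le_compat_l; [apply exp_ge0|apply sigm_le_exp, Ha].
Qed.

Lemma intR_kummer (a : R) (i : nat) (x : R) : 0 < a -> 0 < x -> intR (kummer_kernel a i x) (kummer a i x).
Proof.
  intros Ha Hx; assert (Hi := pos_INR i).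
  destruct (intR_gamma_kernel_ex (a + INR i) x ltac:(lra) Hx) as [m Hm].
  destruct (intR_ex_dom (kummer_kernel a i x) _ m (cont_kummer_kernel a i x)
     (cont_gamma_kernel (a + INR i) x)) as [l [Hl _]].
  - intros y; rewrite Rabs_pos_eq by (left; apply kummer_kernel_pos).
    apply kummer_kernel_le; lra.
  - exact Hm.
  - unfold kummer; rewrite (intR_val_unique _ _ Hl); exact Hl.
Qed.

Lemma kummer_pos (a : R) (i : nat) (x : R) : 0 < a -> 0 < x -> 0 < kummer a i x.
Proof.
  intros Ha Hx; apply (intR_pos (kummer_kernel a i x)).
  - apply cont_kummer_kernel.
  - apply kummer_kernel_pos.
  - apply intR_kummer; auto.
Qed.

Lemma kummer_antitone (a : R) (i : nat) (x x' : R) : 0 < a -> 0 < x -> x <= x' -> kummer a i x' <= kummer a i x.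
Proof.
  intros Ha Hx Hxx.
  apply (intR_le (kummer_kernel a i x') (kummer_kernel a i x)); try apply cont_kummer_kernel.
  - intros y; unfold kummer_kernel; apply Rmult_le_compat_l.
    + apply Rmult_le_pos; [apply exp_ge0|left; apply sigm_pos].
    + apply exp_le; generalize (exp_pos y); intros; nra.
  - apply intR_kummer; lra.
  - apply intR_kummer; lra.
Qed.

Lemma kummer_kernel_S (a : R) (i : nat) (x y : R) : kummer_kernel a (S i) x y = exp y * kummer_kernel a i x y.
Proof.
  unfold kummer_kernel; rewrite S_INR, Rmult_plus_distr_r, exp_plus, Rmult_1_l; ring.
Qed.

Lemma is_derive_kummer (a : R) (i : nat) (x : R) : 0 < a -> 0 < x ->
  is_derive (kummer a i) x (- kummer a (S i) x).
Proof.
  intros Ha Hx.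
  apply (is_derive_intR_exp (fun y => exp (INR i * y) * sigm a y) (fun y => - exp y) _ x (x / 2) _
     (kummer a (S (S i)) (x + x / 2) + kummer a (S (S i)) (x - x / 2))).
  - auto_cont.
  - auto_cont.
  - intros y; apply Rmult_le_pos; [apply exp_ge0|left; apply sigm_pos].
  - lra.
  - intros h Hh; apply Rabs_def2 in Hh; apply (intR_kummer a i (x + h)); lra.
  - replace (- kummer a (S i) x) with (-1 * kummer a (S i) x) by ring.
    eapply intR_ext; [|apply (intR_scal (-1)); [apply cont_kummer_kernel|apply intR_kummer; lra]].
    intros y; cbv beta; rewrite kummer_kernel_S; unfold kummer_kernel; ring.
  - eapply intR_ext; [|apply intR_plus; [apply cont_kummer_kernel|apply cont_kummer_kernel| |]; apply
      intR_kummer; lra].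
    intros y; cbv beta; rewrite !kummer_kernel_S; unfold kummer_kernel; ring.
Qed.

(** Kummer's equation [x U'' + (1 - x) U' - a U = 0] for [U = kummer a 0], with [kummer a 1 = - U'].
    The combined integrand is the derivative of [- (exp y + 1) * kummer_kernel a 0 x y], which
    decays at both ends. *)
Lemma kummer_equation (a x : R) : 0 < a -> 0 < x ->
  x * kummer a 2 x + (x - 1) * kummer a 1 x - a * kummer a 0 x = 0.
Proof.
  intros Ha Hx.
  set (f := fun y => x * kummer_kernel a 2 x y + (x - 1) * kummer_kernel a 1 x y - a * kummer_kernel a 0 x y).
  assert (Cf : cont f) by auto_cont.
  apply (intR_unique f).
  - apply intR_minus.
    + auto_cont.
    + auto_cont.
    + apply intR_plus; try auto_cont; apply intR_scal; auto using cont_kummer_kernel, intR_kummer.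
    + apply intR_scal; auto using cont_kummer_kernel, intR_kummer.
  - destruct (exp_exp_bound 1 x Rlt_0_1 Hx) as [K1 [HK1 H1]].
    destruct (exp_exp_bound (2 * a + 1) x ltac:(lra) Hx) as [K2 [HK2 H2]].
    destruct (exp_exp_bound (2 * a) x ltac:(lra) Hx) as [K3 [HK3 H3]].
    assert (Hb : forall y, Rabs (- (exp y + 1) * kummer_kernel a 0 x y) <= exp ((a + 1) * y - x * exp y) +
        exp (a * y - x * exp y)).
    { intros y; assert (P := exp_pos y); assert (P' := kummer_kernel_pos a 0 x y).
      rewrite Rabs_mult, Rabs_Ropp, !Rabs_pos_eq by lra.
      assert (H4 := kummer_kernel_le a 0 x y ltac:(lra)); simpl (INR 0) in H4; rewrite Rplus_0_r in H4.
      replace ((a + 1) * y - x * exp y) with (y + (a * y - x * exp y)) by ring.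
      rewrite exp_plus; nra. }
    apply (intR_exact (fun y => - (exp y + 1) * kummer_kernel a 0 x y) f (1 + K1 + K2 + K3) a Ha).
    + intros y; unfold f.
      assert (HD : is_derive (kummer_kernel a 0 x) y
        (a * (sigm a y - sigm (a + 1) y) * exp (x * - exp y) + sigm a y * (exp (x * - exp y) * (x * - exp y)))).
      { apply is_derive_ext with (fun y => sigm a y * exp (x * - exp y)).
        - intros t; unfold kummer_kernel; simpl (INR 0); rewrite Rmult_0_l, exp_0; change_eq_R; ring.
        - apply (is_derive_mult (sigm a) (fun y => exp (x * - exp y))).
          + apply is_derive_sigm.
          + auto_derive; [trivial|ring].
          + intros; apply Rmult_comm. }
      assert (HE : is_derive (fun y => - (exp y + 1)) y (- exp y)) by (auto_derive; [trivial|ring]).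
      evar_last.
      * apply (is_derive_mult (fun y => - (exp y + 1)) (kummer_kernel a 0 x) y _ _ HE HD).
        intros; apply Rmult_comm.
      * unfold plus, mult; simpl.
        assert (Es : sigm (a + 1) y = sigm a y * (exp y / (1 + exp y))).
        { assert (P := exp_pos y); assert (P' := exp_pos (- y)).
          unfold sigm; replace (- (a + 1)) with (- a + - (1)) by ring.
          rewrite Rpower_plus, (Rpower_Ropp _ 1), Rpower_1 by lra.
          rewrite exp_Ropp; field; lra. }
        unfold kummer_kernel; rewrite Es.
        replace (INR 2 * y) with (y + y) by (simpl; ring); rewrite exp_plus.
        simpl (INR 1); simpl (INR 0); rewrite Rmult_1_l, Rmult_0_l, exp_0.
        assert (P := exp_pos y); field; lra.
    + exact Cf.
    + intros y; eapply Rle_trans; [apply Hb|].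
      replace ((a + 1) * y - x * exp y) with ((1 * y - x * exp y) + a * y) by ring.
      rewrite exp_plus; specialize (H1 y).
      assert (exp (a * y - x * exp y) <= exp (a * y)) by (apply exp_le; generalize (exp_pos y); intros; nra).
      generalize (exp_pos (a * y)); nra.
    + intros y; eapply Rle_trans; [apply Hb|].
      replace ((a + 1) * y - x * exp y) with (((2 * a + 1) * y - x * exp y) + - a * y) by ring.
      replace (a * y - x * exp y) with ((2 * a * y - x * exp y) + - a * y) by ring.
      rewrite !exp_plus; specialize (H2 y); specialize (H3 y).
      generalize (exp_pos (- a * y)); nra.
Qed.

(** Replacing [sigm a y] by its left asymptote [exp (a y)] gives the Gamma integral, and the error
    is at most [a exp ((a + 1) y)], again a Gamma integrand. *)
Lemma kummer_asymptotics (a x : R) : 0 < a -> 0 < x ->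
  0 <= Gamma a * Rpower x (- a) - kummer a 0 x <= a * (Gamma (a + 1) * Rpower x (- (a + 1))).
Proof.
  intros Ha Hx.
  assert (H := intR_minus _ _ _ _ (cont_gamma_kernel a x) (cont_kummer_kernel a 0 x)
     (intR_gamma_scaled a x Ha Hx) (intR_kummer a 0 x Ha Hx)).
  assert (E : forall y, exp (a * y - x * exp y) - kummer_kernel a 0 x y = (exp (a * y) - sigm a y) * exp (x
      * - exp y)).
  { intros y; unfold kummer_kernel; simpl (INR 0); rewrite Rmult_0_l, exp_0.
    replace (a * y - x * exp y) with (a * y + x * - exp y) by ring; rewrite exp_plus; ring. }
  assert (Cd : cont (fun y => exp (a * y - x * exp y) - kummer_kernel a 0 x y)) by auto_cont.
  split.
  - apply (intR_ge0 _ _ Cd); [|exact H].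
    intros y; rewrite E; apply Rmult_le_pos; [apply exp_minus_sigm; lra|apply exp_ge0].
  - refine (intR_le _ _ _ _ Cd _ _ H _); [| |apply (intR_scal a); [|apply intR_gamma_scaled; lra]].
    + auto_cont.
    + intros y; rewrite E.
      replace ((a + 1) * y - x * exp y) with ((a + 1) * y + x * - exp y) by ring; rewrite exp_plus, <-
          Rmult_assoc.
      apply Rmult_le_compat_r; [apply exp_ge0|apply exp_minus_sigm; lra].
    + apply cont_gamma_kernel.
Qed.

Lemma constant_of_zero_derivative (f : R -> R) (x y : R) : 0 < x -> 0 < y ->
  (forall t, 0 < t -> is_derive f t 0) -> f x = f y.
Proof.
  intros Hx Hy Hf.
  assert (Hm : forall t, Rmin x y <= t -> 0 < t).
  { intros t Ht; generalize (Rmin_glb_lt x y 0 Hx Hy); lra. }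
  destruct (MVT_gen f x y (fun _ => 0)) as [c [_ E]].
  - intros t Ht; apply Hf, Hm; lra.
  - intros t Ht; apply derivable_continuous_pt, ex_derive_Reals_0; eexists; apply Hf, Hm; lra.
  - lra.
Qed.

(* The Wronskian [c] of [W] and a bounded positive solution [V] is constant and [(W / V)' = c / V ^ 2],
   so the convergence of [W / V] at infinity forces [c = 0]. *)
Lemma recessive_solution_unique (q W dW V dV : R -> R) (l B : R) :
  (forall x, 0 < x -> is_derive W x (dW x)) -> (forall x, 0 < x -> is_derive dW x (q x * W x)) ->
  (forall x, 0 < x -> is_derive V x (dV x)) -> (forall x, 0 < x -> is_derive dV x (q x * V x)) ->
  (forall x, 0 < x -> 0 < V x) -> (forall x, 1 <= x -> V x <= B) ->
  is_lim (fun x => W x / V x) p_infty l ->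
  forall x, 0 < x -> W x = l * V x.
Proof.
  intros HW HdW HV HdV Vpos VB Hl.
  set (Wr := fun x => dW x * V x - W x * dV x).
  assert (HWr : forall x, 0 < x -> is_derive Wr x 0).
  { intros x Hx; evar_last.
    - apply (is_derive_minus (fun x => dW x * V x) (fun x => W x * dV x)).
      + apply (is_derive_mult dW V); [apply HdW, Hx|apply HV, Hx|intros; apply Rmult_comm].
      + apply (is_derive_mult W dV); [apply HW, Hx|apply HdV, Hx|intros; apply Rmult_comm].
    - unfold minus, plus, opp, mult; simpl; ring. }
  set (c := Wr 1).
  assert (Hc : forall x, 0 < x -> Wr x = c).
  { intros x Hx; apply constant_of_zero_derivative; auto; lra. }
  set (Q := fun x => W x / V x).
  assert (HQ : forall x, 0 < x -> is_derive Q x (c / V x ^ 2)).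
  { intros x Hx; assert (P := Vpos x Hx); evar_last.
    - apply (is_derive_div W V x _ _ (HW x Hx) (HV x Hx)); lra.
    - rewrite <- (Hc x Hx); unfold Wr; reflexivity. }
  assert (HB : 0 < B) by (generalize (Vpos 1 Rlt_0_1) (VB 1 (Rle_refl 1)); lra).
  assert (c0 : c = 0).
  { destruct (Req_dec c 0) as [E|E]; [exact E|exfalso].
    (* By the mean value theorem [Q] varies by at least [Rabs c / B ^ 2] over each unit interval
       beyond 1; half of this is a tolerance that convergence cannot meet. *)
    assert (He : 0 < Rabs c / B ^ 2 / 2).
    { assert (0 < Rabs c) by (apply Rabs_pos_lt, E).
      apply Rdiv_lt_0_compat; [apply Rdiv_lt_0_compat; [lra|nra]|lra]. }
    apply is_lim_spec in Hl; destruct (Hl (mkposreal _ He)) as [M HM]; cbn [pos] in HM.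
    set (x := Rmax M 0 + 1).
    assert (Hx : 1 <= x /\ M < x) by (generalize (Rmax_l M 0) (Rmax_r M 0); unfold x; lra).
    generalize (HM x ltac:(lra)) (HM (x + 1) ltac:(lra)); intros H1 H2.
    change (Rabs (Q x - l) < Rabs c / B ^ 2 / 2) in H1.
    change (Rabs (Q (x + 1) - l) < Rabs c / B ^ 2 / 2) in H2.
    destruct (MVT_gen Q x (x + 1) (fun x => c / V x ^ 2)) as [t [Ht E']].
    - intros t Ht; rewrite Rmin_left in Ht by lra; apply HQ; lra.
    - intros t Ht; rewrite Rmin_left in Ht by lra.
      apply derivable_continuous_pt, ex_derive_Reals_0; eexists; apply HQ; lra.
    - rewrite Rmin_left, Rmax_right in Ht by lra.
      assert (P := Vpos t ltac:(lra)); assert (P' := VB t ltac:(lra)).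
      assert (Hle : Rabs c / B ^ 2 <= Rabs (Q (x + 1) - Q x)).
      { rewrite E'; replace (x + 1 - x) with 1 by ring; rewrite Rmult_1_r; unfold Rdiv.
        rewrite Rabs_mult, (Rabs_pos_eq (/ V t ^ 2)) by (left; apply Rinv_0_lt_compat; nra).
        apply Rmult_le_compat_l; [apply Rabs_pos|apply Rinv_le_contravar; nra]. }
      apply Rabs_def2 in H1; apply Rabs_def2 in H2.
      assert (Rabs (Q (x + 1) - Q x) < Rabs c / B ^ 2) by (apply Rabs_def1; lra).
      lra. }
  intros x Hx.
  assert (HQx : Q x = l).
  { assert (H : is_lim Q p_infty (Q x)).
    { apply is_lim_ext_loc with (fun _ => Q x); [|apply is_lim_const].
      exists 0; intros y Hy; apply constant_of_zero_derivative; auto.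
      intros t Ht; replace 0 with (c / V t ^ 2); [apply HQ, Ht|].
      rewrite c0; unfold Rdiv; apply Rmult_0_l. }
    apply is_lim_unique in H; apply is_lim_unique in Hl; unfold Q in *; rewrite Hl in H.
    injection H; auto. }
  rewrite <- HQx; unfold Q; field; generalize (Vpos x Hx); lra.
Qed.

(** [V] solves the equation of [W] by [kummer_equation], and [kummer_asymptotics] gives the limit
    [/ Gamma a] of [W / V]; uniqueness of the recessive solution identifies them. *)
Lemma Whittaker_eq_kummer (a : R) (W : R -> R) : 0 < a -> is_Whittaker0 (/ 2 - a) W ->
  forall x, 0 < x -> W x = / Gamma a * (exp (- x / 2) * sqrt x * kummer a 0 x).
Proof.
  intros Ha [HW Hlim].
  assert (HG := Gamma_pos a Ha).
  set (q := fun x => - ((/ 2 - a) / x + / (4 * x ^ 2) - / 4)).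
  set (E := fun x => exp (- x / 2) * sqrt x).
  (* [p] is the logarithmic derivative of the factor [E] that turns Kummer's equation into
     Whittaker's. *)
  set (p := fun x => - / 2 + / (2 * x)).
  set (V := fun x => E x * kummer a 0 x).
  set (dV := fun x => E x * (p x * kummer a 0 x - kummer a 1 x)).
  assert (Epos : forall x, 0 < x -> 0 < E x).
  { intros x Hx; apply Rmult_lt_0_compat; [apply exp_pos|apply sqrt_lt_R0, Hx]. }
  assert (HE : forall x, 0 < x -> is_derive E x (E x * p x)).
  { intros x Hx; assert (Hs : 0 < sqrt x) by (apply sqrt_lt_R0, Hx).
    unfold E, p; auto_derive; [exact Hx|].
    assert (Ex : / (2 * x) = / (2 * sqrt x * sqrt x)) by (rewrite Rmult_assoc, sqrt_sqrt by lra; reflexivity).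
    rewrite Ex; unfold Rdiv; field; lra. }
  assert (HV : forall x, 0 < x -> is_derive V x (dV x)).
  { intros x Hx; evar_last.
    - apply (is_derive_mult E (kummer a 0) x _ _ (HE x Hx) (is_derive_kummer a 0 x Ha Hx)).
      intros; apply Rmult_comm.
    - unfold dV, plus, mult; simpl; ring. }
  assert (HdV : forall x, 0 < x -> is_derive dV x (q x * V x)).
  { intros x Hx; evar_last.
    - apply (is_derive_mult E (fun x => p x * kummer a 0 x - kummer a 1 x) x (E x * p x)
        ((- / (2 * x ^ 2) * kummer a 0 x + p x * - kummer a 1 x) - - kummer a 2 x) (HE x Hx)).
      + apply (is_derive_minus (fun x => p x * kummer a 0 x) (kummer a 1)).
        * apply (is_derive_mult p (kummer a 0) x (- / (2 * x ^ 2))).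
          -- unfold p; auto_derive; [lra|]; field; lra.
          -- apply is_derive_kummer; auto.
          -- intros; apply Rmult_comm.
        * apply is_derive_kummer; auto.
      + intros; apply Rmult_comm.
    - unfold minus, opp, plus, mult; simpl.
      assert (K := kummer_equation a x Ha Hx).
      assert (K2 : kummer a 2 x = (a * kummer a 0 x - (x - 1) * kummer a 1 x) / x).
      { apply (Rmult_eq_reg_l x); [|lra]; field_simplify; lra. }
      rewrite K2; unfold V, q, p; field; lra. }
  intros x Hx; fold (E x); change (E x * kummer a 0 x) with (V x).
  apply (recessive_solution_unique q W (Derive W) V dV (/ Gamma a) (kummer a 0 1)); auto.
  - intros y Hy; apply Derive_correct, HW, Hy.
  - intros y Hy; destruct (HW y Hy) as [_ [H1 H2]].
    replace (q y * W y) with (Derive (Derive W) y) by (unfold q; lra).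
    apply Derive_correct, H1.
  - intros y Hy; apply Rmult_lt_0_compat; [apply Epos, Hy|apply kummer_pos; auto].
  - intros y Hy; unfold V.
    rewrite <- (Rmult_1_l (kummer a 0 1)); apply Rmult_le_compat.
    + left; apply Epos; lra.
    + left; apply kummer_pos; lra.
    + unfold E; assert (H1 : sqrt y <= exp (y / 2)).
      { apply Rsqr_incr_0_var; [|apply exp_ge0].
        rewrite Rsqr_sqrt by lra; unfold Rsqr; rewrite <- exp_plus.
        replace (y / 2 + y / 2) with y by field; generalize (exp_ineq1_le y); lra. }
      apply (Rmult_le_compat_l (exp (- y / 2))) in H1; [|apply exp_ge0].
      rewrite <- exp_plus in H1; replace (- y / 2 + y / 2) with 0 in H1 by field.
      rewrite exp_0 in H1; exact H1.
    + apply kummer_antitone; lra.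
  - assert (HVl : is_lim (fun y => V y / (Rpower y (/ 2 - a) * exp (- y / 2))) p_infty (Gamma a)).
    { apply is_lim_ext_loc with (fun y => Rpower y a * kummer a 0 y).
      - exists 0; intros y Hy; unfold V, E.
        unfold Rminus; rewrite Rpower_plus, Rpower_sqrt, Rpower_Ropp by exact Hy.
        assert (0 < sqrt y) by (apply sqrt_lt_R0, Hy).
        assert (0 < Rpower y a) by apply exp_pos.
        field; repeat split; try lra; apply Rgt_not_eq, exp_pos.
      - apply is_lim_le_le_loc with (f := fun y => Gamma a - a * Gamma (a + 1) * / y) (g := fun _ => Gamma a).
        + exists 0; intros y Hy.
          destruct (kummer_asymptotics a y Ha Hy) as [H1 H2].
          assert (P : 0 < Rpower y a) by apply exp_pos.
          apply (Rmult_le_compat_l (Rpower y a)) in H1; [|lra].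
          apply (Rmult_le_compat_l (Rpower y a)) in H2; [|lra].
          rewrite Rmult_0_r in H1.
          replace (- (a + 1)) with (- a + - (1)) in H2 by ring.
          rewrite Rpower_plus, (Rpower_Ropp y 1), Rpower_1, Rpower_Ropp in H2 by exact Hy.
          rewrite Rpower_Ropp in H1.
          replace (Rpower y a * (Gamma a * / Rpower y a - kummer a 0 y))
            with (Gamma a - Rpower y a * kummer a 0 y) in H1, H2 by (field; lra).
          replace (Rpower y a * (a * (Gamma (a + 1) * (/ Rpower y a * / y))))
            with (a * Gamma (a + 1) * / y) in H2 by (field; lra).
          lra.
        + replace (Finite (Gamma a)) with (Rbar_minus (Gamma a) (Rbar_mult (a * Gamma (a + 1)) 0))
            by (simpl; f_equal; ring).
          apply is_lim_minus with (Gamma a) (Rbar_mult (a * Gamma (a + 1)) 0).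
          * apply is_lim_const.
          * apply is_lim_scal_l.
            replace (Finite 0) with (Rbar_inv p_infty) by reflexivity.
            apply is_lim_inv; [apply is_lim_id|discriminate].
          * reflexivity.
        + apply is_lim_const. }
    apply is_lim_ext_loc with (fun y => W y / (Rpower y (/ 2 - a) * exp (- y / 2)) / (V y / (Rpower y (/ 2
        - a) * exp (- y / 2)))).
    + exists 0; intros y Hy.
      assert (0 < Rpower y (/ 2 - a) * exp (- y / 2)) by (apply Rmult_lt_0_compat; apply exp_pos).
      assert (0 < V y) by (apply Rmult_lt_0_compat; [apply Epos, Hy|apply kummer_pos; auto]).
      assert (0 < Rpower y (/ 2 - a)) by apply exp_pos.
      assert (0 < exp (- y / 2)) by apply exp_pos.
      field; lra.
    + replace (Finite (/ Gamma a)) with (Rbar_div 1 (Gamma a)) by (simpl; f_equal; field; lra).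
      apply is_lim_div; auto.
      * intros H; injection H; lra.
      * simpl; unfold ex_Rbar_div, ex_Rbar_mult; simpl; exact I.
Qed.

(** * The transformation formula *)

(** On the left each of the two terms is of order [exp (a y)], which merely offsets the growth
    [exp (- a y)] of [vth y ^ k]; their difference gains a factor [exp y], whence convergence. *)
Definition bracket (a lam y : R) : R := exp (a * y - a * lam) - exp (a * lam) * sigm a (y - 2 * lam).

Lemma bracket_eq (a lam y : R) :
  bracket a lam y = exp (a * lam) * (exp (a * (y - 2 * lam)) - sigm a (y - 2 * lam)).
Proof.
  unfold bracket; replace (a * y - a * lam) with (a * lam + a * (y - 2 * lam)) by ring.
  rewrite exp_plus; ring.
Qed.

Lemma cont_sigm_shift (a c : R) : cont (fun y => sigm a (y - c)).
Proof.
  apply (cont_comp (sigm a) (fun y => y - c)); [apply cont_sigm|].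
  auto_cont.
Qed.

#[export] Hint Resolve cont_sigm_shift : cont.

Lemma cont_bracket (a lam : R) : cont (bracket a lam).
Proof.
  unfold bracket; auto_cont.
Qed.

#[export] Hint Resolve cont_bracket : cont.

Lemma bracket_bounds (a lam y : R) : 0 <= a ->
  0 <= bracket a lam y /\ bracket a lam y <= exp (a * lam) * exp (a * (y - 2 * lam))
  /\ bracket a lam y <= exp (a * lam) * (a * exp ((a + 1) * (y - 2 * lam))).
Proof.
  intros Ha; rewrite bracket_eq.
  destruct (exp_minus_sigm a (y - 2 * lam) Ha) as [H1 H2].
  assert (P := exp_pos (a * lam)); assert (P' := sigm_pos a (y - 2 * lam)).
  split; [apply Rmult_le_pos; lra|split; apply Rmult_le_compat_l; lra].
Qed.

Lemma intR_bracket_ex (k : nat) (lam : R) : (1 <= k)%nat -> let a := INR k / 2 in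
  exists Z, intR (fun y => (vth y ^ k - 1) * bracket a lam y) Z.
Proof.
  intros Hk a.
  assert (Ha : 0 < a) by (assert (0 < INR k) by (apply lt_0_INR; lia); unfold a; lra).
  destruct (vth_pow_decay k (a + / 2) ltac:(lra)) as [C1 [HC1 H1]].
  destruct (vth_pow_bounded k) as [C2 [HC2 H2]].
  set (C3 := exp (a * lam) * exp (- (2 * a * lam))).
  set (C4 := exp (a * lam) * (a * exp (- (2 * (a + 1) * lam)))).
  assert (H3 : 0 <= C3) by (apply Rmult_le_pos; apply exp_ge0).
  assert (H4 : 0 <= C4) by (apply Rmult_le_pos; [apply exp_ge0|apply Rmult_le_pos; [lra|apply exp_ge0]]).
  apply (intR_ex_two_sided (/ 2) (C1 * C3) (C2 * C4)).
  - lra.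
  - auto_cont.
  - intros y Hy; specialize (H1 y Hy); assert (V := vth_pow_ge_1 k y).
    destruct (bracket_bounds a lam y ltac:(lra)) as [B0 [B1 _]].
    rewrite Rabs_pos_eq by (apply Rmult_le_pos; lra).
    apply Rle_trans with (C1 * exp (- (a + / 2) * y) * (C3 * exp (a * y))).
    + apply Rmult_le_compat; try lra.
      eapply Rle_trans; [exact B1|]; unfold C3; rewrite Rmult_assoc, <- (exp_plus (- _)); right.
      do 2 f_equal; ring.
    + replace (- / 2 * y) with (- (a + / 2) * y + a * y) by ring; rewrite exp_plus; right; ring.
  - intros y Hy; specialize (H2 y Hy); assert (V := vth_pow_ge_1 k (- y)); assert (V' := vth_pow_ge_1 k y).
    destruct (bracket_bounds a lam (- y) ltac:(lra)) as [B0 [_ B1]].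
    rewrite Rabs_pos_eq by (apply Rmult_le_pos; lra).
    apply Rle_trans with (vth (- y) ^ k * bracket a lam (- y)); [apply Rmult_le_compat_r; lra|].
    rewrite vth_pow_opp.
    apply Rle_trans with (exp (INR k * y / 2) * C2 * (C4 * exp (- (a + 1) * y))).
    + apply Rmult_le_compat; [apply Rmult_le_pos; [apply exp_ge0|lra]|exact B0| |].
      * apply Rmult_le_compat_l; [apply exp_ge0|exact H2].
      * eapply Rle_trans; [exact B1|]; unfold C4.
        replace ((a + 1) * (- y - 2 * lam)) with (- (2 * (a + 1) * lam) + - (a + 1) * y) by ring.
        rewrite exp_plus; right; ring.
    + assert (E : exp (INR k * y / 2) * exp (- (a + 1) * y) <= exp (- / 2 * y)).
      { rewrite <- exp_plus; apply exp_le; replace (INR k * y / 2) with (a * y) by (unfold a; field); lra. }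
      replace (exp (INR k * y / 2) * C2 * (C4 * exp (- (a + 1) * y)))
        with (C2 * C4 * (exp (INR k * y / 2) * exp (- (a + 1) * y))) by ring.
      apply Rmult_le_compat_l; [apply Rmult_le_pos; lra|exact E].
Qed.

Lemma is_series_bracket (k : nat) (lam Z : R) : (1 <= k)%nat -> let a := INR k / 2 in
  intR (fun y => (vth y ^ k - 1) * bracket a lam y) Z ->
  is_series (fun n => rcoef k n * (exp (a * lam) *
    (Gamma a * Rpower (PI * INR n * exp (2 * lam)) (- a) - kummer a 0 (PI * INR n * exp (2 * lam))))) Z.
Proof.
  intros Hk a HZ.
  assert (Ha : 0 < a) by (assert (0 < INR k) by (apply lt_0_INR; lia); unfold a; lra).
  apply (intR_vth_series k (bracket a lam)
    (fun n => exp (a * lam) * (Gamma a * Rpower (PI * INR n * exp (2 * lam)) (- a) - kummer a 0 (PI * INR n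
        * exp (2 * lam))))).
  - apply cont_bracket.
  - intros y; apply bracket_bounds; lra.
  - intros n Hn; set (X := PI * INR n * exp (2 * lam)).
    assert (HX : 0 < X).
    { apply Rmult_lt_0_compat; [apply Rmult_lt_0_compat; [apply PI_RGT_0|apply lt_0_INR; lia]|apply exp_pos]. }
    assert (Cd : cont (fun y => exp (a * y - X * exp y) - kummer_kernel a 0 X y)) by auto_cont.
    assert (H := intR_minus _ _ _ _ (cont_gamma_kernel a X) (cont_kummer_kernel a 0 X)
      (intR_gamma_scaled a X Ha HX) (intR_kummer a 0 X Ha HX)).
    (* This translation turns [X * exp y] into [PI n exp y], the exponent of the theta series. *)
    apply (intR_shift (- (2 * lam)) _ _ Cd) in H.
    apply (intR_scal (exp (a * lam))) in H.
    + eapply intR_ext; [|exact H]; intros y; cbv beta.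
      rewrite bracket_eq; unfold kummer_kernel; simpl (INR 0); rewrite Rmult_0_l, exp_0.
      replace (y - 2 * lam) with (y + - (2 * lam)) by ring.
      replace (a * (y + - (2 * lam)) - X * exp (y + - (2 * lam)))
        with (a * (y + - (2 * lam)) + X * - exp (y + - (2 * lam))) by ring.
      rewrite (exp_plus (a * _)).
      replace (X * - exp (y + - (2 * lam))) with (- (PI * INR n * exp y)).
      * ring.
      * unfold X; rewrite exp_plus, exp_Ropp; field; apply Rgt_not_eq, exp_pos.
    + apply (cont_comp (fun y => exp (a * y - X * exp y) - kummer_kernel a 0 X y) (fun y => y + - (2 *
        lam)) Cd).
      auto_cont.
  - exact HZ.
Qed.

(** The power of [n] subtracted in the summand is, up to the common factor, the leading term
    [Gamma a * Rpower X (- a)] of [kummer a 0 X]; so the summand is the remainder of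
    [kummer_asymptotics] with sign reversed. *)
Lemma summand_eq (k : nat) (W : R -> R) (alpha : R) (n : nat) : (1 <= k)%nat -> 0 < alpha ->
  is_Whittaker0 ((1 - INR k) / 2) W -> let a := INR k / 2 in let lam := ln alpha in
  summand k W alpha n = - (sqrt PI * exp (lam - a * lam) / Gamma a) * (rcoef k n * (exp (a * lam) *
    (Gamma a * Rpower (PI * INR n * exp (2 * lam)) (- a) - kummer a 0 (PI * INR n * exp (2 * lam))))).
Proof.
  intros Hk Hal HW a lam; assert (HP := PI_RGT_0).
  assert (Ha : 0 < a) by (assert (0 < INR k) by (apply lt_0_INR; lia); unfold a; lra).
  assert (HG := Gamma_pos a Ha).
  destruct n as [|n]; [simpl; ring|].
  unfold summand, rcoef.
  assert (Hn : 0 < INR (S n)) by (apply lt_0_INR; lia).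
  set (m := INR (S n)) in *.
  assert (Ea : alpha = exp lam) by (symmetry; apply exp_ln, Hal).
  assert (E2 : alpha ^ 2 = exp (2 * lam)) by (rewrite Ea, exp_pow; reflexivity).
  rewrite E2; set (X := PI * m * exp (2 * lam)).
  assert (HX : 0 < X) by (apply Rmult_lt_0_compat; [apply Rmult_lt_0_compat; lra|apply exp_pos]).
  replace ((1 - INR k) / 2) with (/ 2 - a) in HW by (unfold a; field).
  rewrite (Whittaker_eq_kummer a W Ha HW X HX).
  assert (EX : sqrt X = sqrt PI * sqrt m * exp lam).
  { assert (0 < PI * m) by (apply Rmult_lt_0_compat; lra).
    unfold X; rewrite sqrt_mult, (sqrt_mult PI m) by (lra || (apply exp_ge0)); f_equal.
    apply sqrt_lem_1; [apply exp_ge0|apply exp_ge0|].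
    rewrite <- exp_plus; f_equal; ring. }
  assert (Ee : exp (X / 2) * exp (- X / 2) = 1).
  { rewrite <- exp_plus; replace (X / 2 + - X / 2) with 0 by field; apply exp_0. }
  assert (Hsm : 0 < sqrt m) by (apply sqrt_lt_R0, Hn).
  replace (exp (X / 2) / sqrt m * (/ Gamma a * (exp (- X / 2) * sqrt X * kummer a 0 X)))
    with (exp (X / 2) * exp (- X / 2) * (/ Gamma a * (sqrt X / sqrt m * kummer a 0 X))) by (field; lra).
  rewrite Ee, EX.
  assert (Epow : Rpower PI ((1 - INR k) / 2) / (Rpower m (INR k / 2) * Rpower alpha (INR k - 1))
     = sqrt PI * exp (lam - a * lam) * (exp (a * lam) * Rpower X (- a))).
  { assert (ElX : ln X = ln PI + ln m + 2 * lam).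
    { assert (0 < PI * m) by (apply Rmult_lt_0_compat; lra).
      unfold X; rewrite ln_mult, (ln_mult PI m), ln_exp by (lra || apply exp_pos); reflexivity. }
    rewrite <- Rpower_sqrt by exact HP.
    unfold Rpower; rewrite ElX; fold lam; unfold Rdiv.
    rewrite <- !exp_plus, <- exp_Ropp, <- !exp_plus; f_equal.
    unfold a; field. }
  rewrite Epow.
  replace (exp (lam - a * lam)) with (exp lam * / exp (a * lam)).
  - field; repeat split; try lra; apply Rgt_not_eq, exp_pos.
  - unfold Rminus; rewrite exp_plus, exp_Ropp; reflexivity.
Qed.

Definition sym_kernel (k : nat) (lam y : R) : R :=
  vth y ^ k * (exp (INR k / 2 * lam) * sigm (INR k / 2) (y - 2 * lam)).

Lemma cont_sym_kernel (k : nat) (lam : R) : cont (sym_kernel k lam).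
Proof.
  unfold sym_kernel; auto_cont.
Qed.

#[export] Hint Resolve cont_sym_kernel : cont.

(** Inverting [theta ^ k] produces the weight [exp (k y / 2)], and
    [sigm a z = exp (a z) sigm a (- z)] produces its inverse up to a constant because [a = k / 2];
    that constant changes [exp (a lam)] into [exp (- a lam)]. *)
Lemma sym_kernel_opp (k : nat) (lam y : R) : sym_kernel k lam (- y) = sym_kernel k (- lam) y.
Proof.
  unfold sym_kernel; rewrite vth_pow_opp, sigm_refl.
  replace (- (- y - 2 * lam)) with (y - 2 * - lam) by ring.
  replace (exp (INR k / 2 * - lam))
    with (exp (INR k * y / 2) * exp (INR k / 2 * lam) * exp (INR k / 2 * (- y - 2 * lam))).
  - ring.
  - rewrite <- !exp_plus; f_equal; field.
Qed.

Lemma RInt_sym_kernel_opp (k : nat) (lam A B : R) :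
  RInt (sym_kernel k (- lam)) (- A) B = RInt (sym_kernel k lam) (- B) A.
Proof.
  rewrite <- (RInt_ext (fun y => sym_kernel k lam (- y))) by (intros y _; apply sym_kernel_opp).
  rewrite (RInt_refl (sym_kernel k lam)), Ropp_involutive by apply cont_sym_kernel; reflexivity.
Qed.

(** Pointwise, [sym_kernel] is [exp (- a lam) (vth ^ k - 1) exp (a y) + exp (a lam) sigm a (y - 2
    lam) - (vth ^ k - 1) bracket]. The translation by [2 lam] lowers the finite part of [sigm] by
    [2 lam]. *)
Lemma sym_kernel_limit (k : nat) (lam D c Z : R) : let a := INR k / 2 in
  lim2 (fun A B => RInt (fun y => (vth y ^ k - 1) * exp (a * y)) (- A) B - A) D ->
  is_sigm_const a c ->
  intR (fun y => (vth y ^ k - 1) * bracket a lam y) Z ->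
  lim2 (fun A B => RInt (sym_kernel k lam) (- A) B - exp (- (a * lam)) * A - exp (a * lam) * B)
    (exp (- (a * lam)) * D + exp (a * lam) * (c - 2 * lam) - Z).
Proof.
  intros a HD Hc HZ.
  assert (C1 : cont (fun y => (vth y ^ k - 1) * exp (a * y))) by auto_cont.
  assert (C2 : cont (fun y => (vth y ^ k - 1) * bracket a lam y)) by auto_cont.
  assert (Hs : lim2 (fun A B => RInt (fun y => sigm a (y - 2 * lam)) (- A) B - B) (c - 2 * lam)).
  { eapply lim2_ext; [|apply (lim2_minus _ _ _ _ (lim2_shift _ _ (2 * lam) (- (2 * lam)) Hc) (lim2_const (2
      * lam)))].
    intros A B _ _; cbv beta.
    rewrite (RInt_shift (sigm a) (- (2 * lam))) by apply cont_sigm.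
    replace (- (A + 2 * lam)) with (- A + - (2 * lam)) by ring; ring. }
  eapply lim2_ext; [|apply (lim2_minus _ _ _ _ (lim2_plus _ _ _ _
     (lim2_scal (exp (- (a * lam))) _ _ HD) (lim2_scal (exp (a * lam)) _ _ Hs)) HZ)].
  intros A B _ _; cbv beta.
  assert (E : RInt (sym_kernel k lam) (- A) B =
     exp (- (a * lam)) * RInt (fun y => (vth y ^ k - 1) * exp (a * y)) (- A) B
     + exp (a * lam) * RInt (fun y => sigm a (y - 2 * lam)) (- A) B
     - RInt (fun y => (vth y ^ k - 1) * bracket a lam y) (- A) B).
  { rewrite <- (RInt_scal_cont (fun y => (vth y ^ k - 1) * exp (a * y))) by exact C1.
    rewrite <- (RInt_scal_cont (fun y => sigm a (y - 2 * lam))) by apply cont_sigm_shift.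
    assert (C3 : cont (fun y => exp (- (a * lam)) * ((vth y ^ k - 1) * exp (a * y)))) by auto_cont.
    assert (C4 : cont (fun y => exp (a * lam) * sigm a (y - 2 * lam))) by auto_cont.
    rewrite <- (RInt_plus_cont _ _ _ _ C3 C4), <- (RInt_minus_cont _ _ _ _ (cont_plus _ _ C3 C4) C2).
    apply RInt_ext; intros y _; unfold sym_kernel, bracket; fold a.
    unfold Rminus; rewrite exp_plus.
    change_eq_R; ring. }
  rewrite E; ring.
Qed.

(** The sum of [exp (a lam) (c - 2 lam)] and [exp (- (a lam)) (c + 2 lam)] is even in [lam], so in
    this form a side of the formula is invariant as soon as [T] is. Of the two [euler_gamma] in it,
    one comes from the Kronecker constant and one from [c]. *)
Lemma guinand_side (k : nat) (W : R -> R) (alpha T : R) : (1 <= k)%nat -> 0 < alpha ->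
  is_Whittaker0 ((1 - INR k) / 2) W -> let a := INR k / 2 in let lam := ln alpha in
  let c := - euler_gamma - digamma a in
  lim2 (fun A B => RInt (sym_kernel k lam) (- A) B - exp (- (a * lam)) * A - exp (a * lam) * B) T ->
  ex_series (summand k W alpha) /\
  Rpower alpha (INR k / 2 - 1) * Series (summand k W alpha)
    + Rpower PI ((1 - INR k) / 2) * Rpower alpha (- (INR k / 2)) * zeta (k - 1) (INR k / 2)
    + sqrt PI / (Gamma (INR k / 2) * Rpower alpha (INR k / 2))
      * (2 * euler_gamma + digamma (INR k / 2) - 2 * ln (Phi k) - ln (4 * PI * alpha ^ 2))
  = sqrt PI / Gamma a * (T - exp (a * lam) * (c - 2 * lam) - exp (- (a * lam)) * (c + 2 * lam)).
Proof.
  intros Hk Hal HW a lam c HT; assert (HP := PI_RGT_0).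
  assert (Ha : 0 < a) by (assert (0 < INR k) by (apply lt_0_INR; lia); unfold a; lra).
  assert (HG := Gamma_pos a Ha).
  destruct (intR_bracket_ex k lam Hk) as [Z HZ]; fold a in HZ.
  assert (HD := vth_pow_mellin_const k Hk); cbv zeta in HD; fold a in HD.
  assert (Hc := is_sigm_const_digamma k Hk); fold a in Hc; fold c in Hc.
  assert (ET := lim2_unique _ _ _ HT (sym_kernel_limit k lam _ c Z HD Hc HZ)); fold a in ET.
  assert (HS : is_series (summand k W alpha) (- (sqrt PI * exp (lam - a * lam) / Gamma a) * Z)).
  { eapply is_series_ext; [|apply (is_series_scal_R (- (sqrt PI * exp (lam - a * lam) / Gamma a)) _ _
      (is_series_bracket k lam Z Hk HZ))].
    intros n; symmetry; apply summand_eq; auto. }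
  split; [eexists; exact HS|].
  rewrite (is_series_unique _ _ HS), ET; fold a.
  assert (E0 : exp (- (a * lam)) = / exp (a * lam)) by apply exp_Ropp.
  assert (E1 : Rpower alpha (a - 1) = exp (a * lam) / exp lam).
  { unfold Rpower; fold lam; replace ((a - 1) * lam) with (a * lam + - lam) by ring.
    rewrite exp_plus, exp_Ropp; reflexivity. }
  assert (E2 : Rpower alpha (- a) = / exp (a * lam)).
  { unfold Rpower; fold lam; rewrite <- E0; f_equal; ring. }
  assert (E3 : Rpower alpha a = exp (a * lam)) by reflexivity.
  assert (E4 : Rpower PI ((1 - INR k) / 2) = sqrt PI * Rpower PI (- a)).
  { rewrite <- Rpower_sqrt, <- Rpower_plus by exact HP; f_equal; unfold a; field. }
  assert (E5 : exp (lam - a * lam) = exp lam / exp (a * lam)).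
  { unfold Rminus; rewrite exp_plus, exp_Ropp; reflexivity. }
  assert (E6 : ln (4 * PI * alpha ^ 2) = ln (4 * PI) + 2 * lam).
  { rewrite ln_mult by nra; f_equal; rewrite ln_pow by exact Hal; simpl; fold lam; ring. }
  rewrite E0, E1, E2, E3, E4, E5, E6; unfold c.
  assert (P1 := exp_pos lam); assert (P2 := exp_pos (a * lam)).
  field; lra.
Qed.

Theorem theorem1 (k : nat) (alpha beta : R) (W : R -> R) :
  (1 <= k)%nat -> 0 < alpha -> 0 < beta -> alpha * beta = 1 ->
  is_Whittaker0 ((1 - INR k) / 2) W ->
  ex_series (summand k W alpha) /\ ex_series (summand k W beta) /\
  Rpower alpha (INR k / 2 - 1) * Series (summand k W alpha)
    + Rpower PI ((1 - INR k) / 2) * Rpower alpha (- (INR k / 2)) * zeta (k - 1) (INR k / 2)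
    + sqrt PI / (Gamma (INR k / 2) * Rpower alpha (INR k / 2))
      * (2 * euler_gamma + digamma (INR k / 2) - 2 * ln (Phi k) - ln (4 * PI * alpha ^ 2))
  =
  Rpower beta (INR k / 2 - 1) * Series (summand k W beta)
    + Rpower PI ((1 - INR k) / 2) * Rpower beta (- (INR k / 2)) * zeta (k - 1) (INR k / 2)
    + sqrt PI / (Gamma (INR k / 2) * Rpower beta (INR k / 2))
      * (2 * euler_gamma + digamma (INR k / 2) - 2 * ln (Phi k) - ln (4 * PI * beta ^ 2)).
Proof.
  intros Hk Hal Hbe Hab HW.
  set (a := INR k / 2); set (lam := ln alpha).
  assert (Hlam : ln beta = - lam).
  { replace beta with (/ alpha) by (apply (Rmult_eq_reg_l alpha); [rewrite Hab; field|]; lra).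
    apply ln_Rinv, Hal. }
  destruct (intR_bracket_ex k lam Hk) as [Z HZ].
  assert (HT := sym_kernel_limit k lam _ _ Z (vth_pow_mellin_const k Hk) (is_sigm_const_digamma k Hk) HZ).
  cbv zeta in HT; match type of HT with lim2 _ ?t => set (T := t) in HT end.
  destruct (guinand_side k W alpha T Hk Hal HW HT) as [Hex1 E1].
  destruct (guinand_side k W beta T Hk Hbe HW) as [Hex2 E2].
  (* Exchanging [A] and [B] carries the limit at [lam] to the one at [- lam], counterterms included:
     the same [T] serves [beta]. *)
  { rewrite Hlam; eapply lim2_ext; [|apply (lim2_swap _ _ HT)].
    intros A B _ _; cbv beta; rewrite RInt_sym_kernel_opp.
    replace (- (INR k / 2 * - lam)) with (INR k / 2 * lam) by ring.
    replace (INR k / 2 * - lam) with (- (INR k / 2 * lam)) by ring; ring. }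
  split; [exact Hex1|split; [exact Hex2|]].
  unfold a; rewrite E1, E2, Hlam; fold lam.
  replace (- (INR k / 2 * - lam)) with (INR k / 2 * lam) by ring.
  replace (INR k / 2 * - lam) with (- (INR k / 2 * lam)) by ring; ring.
Qed.
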